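(* For all integers $t\ge 2$ and $r\ge 1$ there exist an integer $n_*=n_*(r,t)$ and constants $c_i=c_i(r,t)$, $i=1,2,3$, such that the following holds. From every $rt^2$-graph $H=(V,E)$ in $\mathfrak{E}(r,t;n,m)$ with $n\ge n_*$ vertices and $m>\binom{\lfloor n/t\rfloor}{rt}$ edges one can remove at most $c_1$ edges to get a graph which consists of $\ell\le 7t^2$ many $(rt(t-1))$-stars $S^1,S^2,\dots,S^\ell$ and, perhaps, some number of isolated vertices. Moreover, we can also assume that (i) $|\operatorname{cr}_v(S^i)|\ge n/(7t^2)$ for $i=1,2,\dots,\ell-1$; (ii) $\bigl|V\setminus\bigcup_{i=1}^{\ell}\operatorname{cr}_v(S^i)\bigr|\le c_2$; (iii) the centres of the stars $S^1,\dots,S^\ell$ are pairwise disjoint. In particular, we can delete from $H$ at most $c_3n^{(r-1)t}$ edges to get a union of at most $\ell$ vertex disjoint $(rt(t-1))$-stars.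
   Context: A $k$-graph ($k$-uniform hypergraph) is a pair $H=(V,E)$ where $E$ is a set of $k$-element subsets of the finite vertex set $V$. The degree of a vertex is the number of edges containing it; $\Delta(H)$ is the maximum vertex degree. The class $\mathcal{J}(r,t)$: for integers $r\ge1$, $t\ge2$ let $I=\{s\ge 0 : t\mid s \text{ or } s\ge rt(t-1)\}$. $\mathcal{J}(r,t)$ consists of all $rt^2$-graphs $H$ with $|e\cap f|\in I$ for all edges $e,f$ of $H$. Extremal family: $f(r,t;n,m)=\min\{\Delta(H): H=(V,E)\in\mathcal{J}(r,t),\ |V|=n,\ |E|=m\}$, and $\mathfrak{E}(r,t;n,m)$ is the collection of all $H=(V,E)\in\mathcal{J}(r,t)$ with $|V|=n$, $|E|=m$ and $\Delta(H)=f(r,t;n,m)$. Stars: for $k\ge s\ge0$, an $s$-star is a $k$-graph $(V,E)$ together with a distinguished set $S\subseteq V$, $|S|=s$, such that $S\subseteq e$ for all $e\in E$. $S$ is the centre of the star and $\bigcup_{h\in E}(h\setminus S)$ is its body. Here stars are $rt^2$-uniform. Cores: an $(rt(t-1))$-star with exactly $N$ vertices in its body is heavy if its minimum vertex degree (over vertices of the body) is at least $2r^2t^3N^{rt-2}$. Fix a linear order of the vertices. Starting from an $(rt(t-1))$-star $S$, repeatedly remove the (first in the order) body vertex of smallest degree, together with all edges containing it, until the resulting star, possibly empty, is heavy. The substar obtained is called the core of $S$, and $\operatorname{cr}_v(S)$ denotes the set of vertices forming the body of the core of $S$. *)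

(* Defs.v *)
From mathcomp Require Import all_boot all_order.

Set Implicit Arguments.
Unset Strict Implicit.
Unset Printing Implicit Defensive.

Section Hypergraphs.
Variable V : finType.
Implicit Types (E F : {set {set V}}) (C : {set V}) (v : V).

Definition uniform (k : nat) E : bool := [forall e in E, #|e| == k].

Definition degree E v : nat := #|[set e in E | v \in e]|.

Definition max_degree E : nat := \max_(v : V) degree E v.

Definition admissible (r t s : nat) : bool := (t %| s) || (r * t * (t - 1) <= s).

Definition class_J (r t : nat) E : bool :=
  uniform (r * t ^ 2) E &&
  [forall e in E, forall f in E, admissible r t #|e :&: f|].

(* The s-star (F, C): edge set F, centre C. *)
Definition is_star (k s : nat) C F : bool :=
  [&& #|C| == s, uniform k F & [forall e in F, C \subset e]].

Definition body C F : {set V} := \bigcup_(e in F) (e :\: C).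

(* The star with empty body is (vacuously) heavy. *)
Definition heavy (r t : nat) C F : bool :=
  [forall v in body C F,
     2 * r ^ 2 * t ^ 3 * #|body C F| ^ (r * t - 2) <= degree F v].

Definition star_vertices C F : {set V} := C :|: body C F.

End Hypergraphs.

(* [max_degree E <= #|E| = m], so the default value [m] is never below the
   minimum; it is only returned when no hypergraph satisfies the constraints. *)
Definition min_max_degree (r t n m : nat) : nat :=
  \big[minn/m]_(E : {set {set 'I_n}} | class_J r t E && (#|E| == m))
    max_degree E.

Definition extremal (r t n m : nat) (V : finType) (E : {set {set V}}) : Prop :=
  [/\ #|V| = n, #|E| = m, class_J r t E & max_degree E = min_max_degree r t n m].

Section Core.
Variables (d : Order.disp_t) (V : finOrderType d).
Implicit Types (F : {set {set V}}) (C : {set V}).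

Definition first_min_vertex C F : option V :=
  [pick v in body C F |
    [forall u in body C F,
      (degree F v < degree F u) ||
      (degree F v == degree F u) && (v <= u)%O]].

Definition core_step (r t : nat) C F : {set {set V}} :=
  if heavy r t C F then F
  else if first_min_vertex C F is Some v then [set e in F | v \notin e] else F.

(* A step on a star that is not heavy removes at least one edge, so [#|F|]
   steps always suffice to reach a heavy star. *)
Definition core (r t : nat) C F : {set {set V}} :=
  iter #|F| (core_step r t C) F.

Definition core_body (r t : nat) C F : {set V} := body C (core r t C F).

End Core.

(* Main.v *)
Require Import Defs.
From mathcomp Require Import all_boot all_order.
From mathcomp Require Import zify.

Set Implicit Arguments.
Unset Strict Implicit.
Unset Printing Implicit Defensive.

(** Write q = rt and s = q(t - 1). Edges have qt = s + q vertices, and two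
    edges meet in a number of vertices which is divisible by t or at least s.
    There are two dense configurations: stars with a centre of s vertices,
    whose edges are the centre plus q vertices of the body, and block
    hypergraphs, whose edges are unions of q members of a fixed family of
    disjoint t-sets, at most C(floor(n/t), q) in number. An extremal
    hypergraph minimises the maximum degree D; as soon as m exceeds
    C(floor(n/t), q) the block configuration is too small, and the edges must
    be spread over stars.

    Decomposition. Every hypergraph of the class on w vertices consists of
    block edges, of stars with pairwise disjoint bodies, and of O(w^(q-1))
    other edges ([decomposition_card], [decomposition_space]). Label the
    vertices of each edge by 0, ..., qt-1. In a family of labelled edges, call
    a set J of labels homogeneous if the vertices of any edge outside its
    labels J can be exchanged, within the family, so as to avoid any few
    prescribed vertices. Homogeneous sets are closed under intersection
    ([homogI]), and their sizes are admissible, like the sizes of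
    intersections of edges. A family in which no subfamily has proper
    homogeneous sets covering all (q-1)-sets of labels is small
    ([no_covering_card]); when the homogeneous sets do cover, a purely
    combinatorial argument ([union_closed_classification]) shows that they
    contain all those of a star or those of a block hypergraph.

    Cores. A pair (C, P) is heavy when all vertices of P have degree at least
    a large multiple of |P|^(q-2) among the edges between C and C + P. Then
    every edge that meets P contains C ([heavy_pair_edge]), and distinct heavy
    pairs have disjoint bodies. Deleting vertices of low degree from the star
    of all edges through C yields its core; this loses few edges per vertex.

    Comparison. Disjoint complete stars on n vertices, truncated to D - 1
    edges each, have maximum degree less than D, so by extremality they have
    fewer than m edges in total ([extremal_competitor]). Let N be the least
    body size whose complete star has at least D - 1 edges. To first order,
    counting the m edges through the decomposition gives a lower bound for N
    linear in n ([full_size_bounds]); here the case that nearly all vertices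
    are covered by blocks is excluded by the exact estimate [exact_bound], and
    only there the precise hypothesis on m matters. Then comparing with
    competitors that rearrange the vertices shows that only a small fraction
    of the vertices lies outside the cores of linear size ([outside_small]),
    that at most one such core has less than N/2 vertices
    ([nonfull_core_unique]), because by convexity two such stars are better
    replaced by a larger and a smaller one, and that the centres are disjoint
    ([centers_disjoint]), because a common vertex bounds the number of edges
    of two stars together by D. To second order ([cores_full],
    [near_complete]), either boundedly many vertices are outside the cores, or
    the edges there form an almost complete star whose body misses O(1) of
    them. In both cases one gets a list of at most 7t^2 heavy pairs which
    cover all but boundedly many vertices ([star_structure]).

    Each edge that meets some body contains its centre, so only boundedly many
    edges are in none of the stars, and the greedy core of each star contains
    its body ([core_body_sup]). Finally, an edge of one star with less than t
    vertices outside its centre and all bodies is disjoint from every such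
    edge of another star, while the remaining edges have t further vertices in
    a set of bounded size, hence are O(n^((r-1)t)) in number. *)

(** * Finite sets and hypergraph counting *)

(** Membership facts in the context are bool atoms on which [lia] case-splits;
    this variant keeps the equations and inequalities on nat only. *)
Ltac nat_lia :=
  repeat match goal with
  | H : is_true (leq _ _) |- _ => revert H
  | H : @eq nat _ _ |- _ => revert H
  end; clear; intros; lia.

Lemma dvdn_succF t n : 2 <= t -> t %| n -> ~~ (t %| n.+1).
Proof. by move=> t2 tn; rewrite -addn1 dvdn_addr // dvdn1; lia. Qed.

Lemma exists_subset_card (T : finType) (S : {set T}) n : n <= #|S| ->
  exists2 S' : {set T}, S' \subset S & #|S'| = n.
Proof.
move=> nS; exists [set x in take n (enum S)].
  by apply/subsetP => x; rewrite inE => /mem_take; rewrite mem_enum.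
rewrite cardsE (card_uniqP _) ?take_uniq ?enum_uniq //.
by rewrite size_takel // -cardE.
Qed.

Lemma card_bigcup_le (I T : finType) (P : pred I) (F : I -> {set T}) :
  #|\bigcup_(i | P i) F i| <= \sum_(i | P i) #|F i|.
Proof.
elim/big_rec2: _ => [|i n A _ le_n]; first by rewrite cards0.
by rewrite (leq_trans (leq_card_setU _ _)) // leq_add2l.
Qed.

Lemma card_bigcup_le_const (I T : finType) (P : {set I}) (F : I -> {set T}) n :
  (forall i, i \in P -> #|F i| <= n) -> #|\bigcup_(i in P) F i| <= #|P| * n.
Proof.
move=> le_n; rewrite (leq_trans (card_bigcup_le _ _)) //.
by rewrite -sum_nat_const; apply: leq_sum.
Qed.

Lemma sum_card_disjoint (I T : finType) (P : pred I) (F : I -> {set T}) :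
  (forall i j, P i -> P j -> i != j -> [disjoint F i & F j]) ->
  \sum_(i | P i) #|F i| = #|\bigcup_(i | P i) F i|.
Proof.
move=> Fdis.
have h (i : I) : P i -> #|F i| = \sum_(x in \bigcup_(i | P i) F i) (x \in F i).
  move=> Pi; rewrite -sum1_card big_mkcond [RHS]big_mkcond /=.
  apply: eq_bigr => x _; have [xF|xF] := boolP (x \in F i); last by case: ifP.
  by rewrite ifT //; apply/bigcupP; exists i.
rewrite (eq_bigr _ h) exchange_big /= -sum1_card; apply: eq_bigr => x.
case/bigcupP => i Pi xF; rewrite (bigD1 i) //= xF big1 ?addn0 // => j /andP[Pj ji].
by apply/eqP; rewrite eqb0; apply/negP => xFj; have := pred0P (Fdis j i Pj Pi ji) x; rewrite /= xF xFj.
Qed.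

Lemma card_inj_le (aT rT : finType) (f : aT -> rT) (A : {set aT}) (B : {set rT}) :
  {in A &, injective f} -> (forall x, x \in A -> f x \in B) -> #|A| <= #|B|.
Proof.
move=> f_inj fAB; rewrite -(card_in_imset f_inj); apply: subset_leq_card.
by apply/subsetP => _ /imsetP[x xA ->]; apply: fAB.
Qed.

Lemma card_edges_through (V : finType) (k : nat) (F : {set {set V}}) (X P : {set V}) :
  (forall e, e \in F -> [/\ #|e| = k, X \subset e & e \subset X :|: P]) ->
  #|F| <= 'C(#|P|, k - #|X|).
Proof.
move=> hF; rewrite -cards_draws; apply: (@card_inj_le _ _ (fun e => e :\: X)).
  move=> e e' /hF[_ Xe _] /hF[_ Xe' _] /= ee'.
  by rewrite -(setID e X) -(setID e' X) ee' (setIidPr Xe) (setIidPr Xe').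
move=> e /hF[ce Xe eXP]; rewrite inE cardsD (setIidPr Xe) ce eqxx andbT.
by rewrite subDset.
Qed.

Lemma bigmin_le (I : eqType) (l : seq I) (P : pred I) (F : I -> nat) m j :
  j \in l -> P j -> \big[minn/m]_(i <- l | P i) F i <= F j.
Proof.
elim: l => // i l IH; rewrite inE big_cons => /orP[/eqP <- ->|jl Pj]; first exact: geq_minl.
by case: ifP => _; [apply: leq_trans (geq_minr _ _) _|]; apply: IH.
Qed.

Section Blocks.
Variables (V : finType) (q t : nat) (Bs : {set {set V}}).
Hypotheses (t_gt0 : 0 < t) (Bs_card : forall B, B \in Bs -> #|B| = t).
Hypothesis Bs_dis : forall B B', B \in Bs -> B' \in Bs -> B != B' -> [disjoint B & B'].

(** Such edges are unions of blocks, exactly q of them by counting, and are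
    determined by the set of these blocks. *)
Lemma block_unions_card (F : {set {set V}}) :
  (forall e, e \in F -> #|e| = q * t) ->
  (forall e v, e \in F -> v \in e -> exists B, [/\ B \in Bs, v \in B & B \subset e]) ->
  #|F| <= 'C(#|Bs|, q).
Proof.
move=> Fcard Fcov.
pose bl (e : {set V}) := [set B in Bs | B \subset e].
have cov e : e \in F -> e = \bigcup_(B in bl e) B.
  move=> eF; apply/setP => v; apply/idP/bigcupP => [ve|[B]].
    have [B [BB vB sBe]] := Fcov e v eF ve.
    by exists B => //; rewrite inE BB.
  by rewrite inE => /andP[_ /subsetP]; apply.
rewrite -cards_draws; apply: (@card_inj_le _ _ bl).
  by move=> e e' eF e'F ee'; rewrite (cov e eF) (cov e' e'F) ee'.
move=> e eF; rewrite inE; apply/andP; split; first by apply/subsetP => B; rewrite inE => /andP[].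
have := Fcard e eF; rewrite {1}(cov e eF) -sum_card_disjoint; last first.
  by move=> B B'; rewrite !inE => /andP[BB _] /andP[BB' _]; apply: Bs_dis.
rewrite (eq_bigr (fun=> t)); last by move=> B; rewrite inE => /andP[/Bs_card].
by rewrite sum_nat_const => /eqP; rewrite eqn_pmul2r.
Qed.

End Blocks.

(** * Powers and binomial coefficients *)

Lemma ffact_le_exp n m : n ^_ m <= n ^ m.
Proof.
elim: m n => [|m IH] n //; rewrite ffactnS expnS leq_mul2l.
by rewrite (leq_trans (IH _)) ?orbT //; case: m {IH} => // m; rewrite leq_exp2r // leq_pred.
Qed.

Lemma bin_le_exp n m : 'C(n, m) <= n ^ m.
Proof.
by rewrite (leq_trans _ (ffact_le_exp n m)) // -bin_ffact leq_pmulr ?fact_gt0.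
Qed.

Lemma leq_exp a b n : a <= b -> a ^ n <= b ^ n.
Proof. by move=> le; case: n => // n; rewrite leq_exp2r. Qed.

Lemma expn_pred_mul x q : 0 < q -> x ^ q = x * x ^ (q - 1).
Proof. by move=> q0; rewrite -expnS; congr (_ ^ _); nat_lia. Qed.

Lemma bin_superadd q a b : 0 < q -> 'C(a, q) + 'C(b, q) <= 'C(a + b, q).
Proof.
case: q => // q _; elim: b => [|b IH]; first by rewrite bin0n addn0 addn0.
rewrite addnS !binS addnA leq_add // leq_bin2l //; exact: leq_addl.
Qed.

Lemma bin_sum_le (I : Type) (r : seq I) (P : pred I) (F : I -> nat) q : 0 < q ->
  \sum_(i <- r | P i) 'C(F i, q) <= 'C(\sum_(i <- r | P i) F i, q).
Proof.
move=> q0; elim/big_rec2: _ => [|i x y _ le]; first by [].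
by apply: leq_trans (bin_superadd _ _ q0); rewrite leq_add2l.
Qed.

Lemma bin_add_le q a b : 'C(a + b, q.+1) <= 'C(a, q.+1) + b * (a + b) ^ q.
Proof.
elim: b => [|b IH]; first by rewrite addn0 mul0n addn0.
rewrite addnS binS mulSn [(a + b).+1 ^ q + _]addnC addnA leq_add //.
  by apply: leq_trans IH _; rewrite leq_add2l leq_mul2l leq_exp ?orbT.
by apply: leq_trans (bin_le_exp _ _) _; rewrite leq_exp.
Qed.

Lemma bin_add_ge q a b : 'C(a, q.+1) + b * 'C(a, q) <= 'C(a + b, q.+1).
Proof.
elim: b => [|b IH]; first by rewrite addn0 mul0n addn0.
rewrite addnS binS mulSn [_ + b * _]addnC addnA leq_add // leq_bin2l //; exact: leq_addr.
Qed.

(** Convexity: moving g points from the smaller to the larger of two sets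
    creates at least C(g, q) new q-sets. *)
Lemma bin_shift q x y g : 2 <= q -> y + g <= x ->
  'C(x, q) + 'C(y + g, q) + 'C(g, q) <= 'C(x + g, q) + 'C(y, q).
Proof.
case: q => [|[|q]] // _ le.
have : forall h, h <= g -> 'C(x, q.+2) + 'C(y + h, q.+2) + 'C(h, q.+2) <= 'C(x + h, q.+2) + 'C(y, q.+2).
  elim=> [|h IH] hg; first by rewrite !addn0.
  have := IH (ltnW hg); rewrite !addnS !binS.
  have : 'C(y + h, q.+1) + 'C(h, q.+1) <= 'C(x + h, q.+1).
    by apply: leq_trans (bin_superadd _ _ _) _ => //; rewrite leq_bin2l //; nat_lia.
  nat_lia.
by move/(_ g (leqnn g)).
Qed.

Lemma exp_le_ffact q x : x ^ q <= x ^_ q + q * q * x ^ (q - 1).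
Proof.
case: q => // q; rewrite subn1 /=; elim: q => [|q IH]; first by rewrite ffactn1 expn1; nat_lia.
have := ffact_le_exp x q.+1; rewrite [x ^_ q.+2]ffactnSr.
have : x * x ^_ q.+1 <= x ^_ q.+1 * (x - q.+1) + q.+1 * x ^_ q.+1 by nia.
have : x * x ^ q.+1 <= x * x ^_ q.+1 + q.+1 * q.+1 * x ^ q.+1.
  by rewrite [x ^ q.+1 in X in _ <= X]expnS; nia.
rewrite (expnS x q.+1); nia.
Qed.

Lemma bin_fact_le q x : 'C(x, q) * q`! <= x ^ q.
Proof. by rewrite bin_ffact ffact_le_exp. Qed.

(** Together with [bin_fact_le]: C(x, q) is x^q / q! up to an error of lower
    order. *)
Lemma exp_le_bin q x : x ^ q <= 'C(x, q) * q`! + q * q * x ^ (q - 1).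
Proof. by rewrite bin_ffact exp_le_ffact. Qed.

(** A binomial coefficient C(x, q) with x linear in n beats every fixed
    multiple of n^(q-1), the order of all error terms below. *)
Lemma bin_big q n B A x : 0 < q -> n <= B * x ->
  B * (q`! * A * B ^ (q - 1) + q * q) < n -> A * n ^ (q - 1) < 'C(x, q).
Proof.
move=> q0 nBx nbig; rewrite -(ltn_pmul2r (fact_gt0 q)).
have := exp_le_bin q x; case: q q0 nbig => // q _; rewrite subn1 /= => nbig h.
have xbig : (q.+1)`! * A * B ^ q + q.+1 * q.+1 < x.
  by rewrite -(@ltn_pmul2l B); [exact: leq_trans nbig nBx | case: B nBx nbig => //; nat_lia].
have h2 : n ^ q <= B ^ q * x ^ q.
  by rewrite -expnMn leq_exp.
have xq : 0 < x ^ q by rewrite expn_gt0; nat_lia.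
have : ((q.+1)`! * A * B ^ q + q.+1 * q.+1) * x ^ q < x * x ^ q by rewrite ltn_pmul2r.
rewrite expnS in h; have : q.+1`! * A * n ^ q <= (q.+1)`! * A * (B ^ q * x ^ q).
  by rewrite leq_mul2l h2 orbT.
rewrite mulnDl; nat_lia.
Qed.

Lemma exp_le_bin2 q x : 0 < q -> 2 * (q * q) <= x -> x ^ q <= 2 * q`! * 'C(x, q).
Proof.
move=> q0 qx; have h := exp_le_bin q x.
have e : x ^ q = x * x ^ (q - 1) by apply: expn_pred_mul.
have h1 : 2 * (q * q) * x ^ (q - 1) <= x ^ q by rewrite e leq_mul2r qx orbT.
rewrite -mulnA [q`! * _]mulnC; move: h h1; clear.
rewrite -[2 * (q * q) * _]mulnA; move: (x ^ q) (_ * x ^ _) (_ * q`!) => *; nat_lia.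
Qed.

(** Together with [expn_gap_bot]: n^q - b^q, divided by n - b, is at least
    n^(q-1) and at least q b^(q-1). *)
Lemma expn_gap_top q b n : 0 < q -> b <= n -> b ^ q + (n - b) * n ^ (q - 1) <= n ^ q.
Proof.
case: q => // q _ bn; rewrite subn1 /= !expnS.
have : b ^ q <= n ^ q by apply: leq_exp.
move: (b ^ q) (n ^ q) => x y xy; nia.
Qed.

Lemma expn_gap_bot q b n : 0 < q -> b <= n -> b ^ q + (n - b) * (q * b ^ (q - 1)) <= n ^ q.
Proof.
case: q => // q _ bn; rewrite subn1 /=; elim: q => [|q IH]; first by rewrite !expnS !expn0; nat_lia.
rewrite [b ^ q.+2]expnS [n ^ _]expnS; move: IH; rewrite expnS.
move: (b ^ q) (n ^ q.+1) => x y IH.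
have : n * (b * x + (n - b) * (q.+1 * x)) <= n * y by rewrite leq_mul2l IH orbT.
apply: leq_trans; have [d ->] : exists d, n = b + d by exists (n - b); nat_lia.
rewrite addKn; nia.
Qed.

Lemma expnD_le q y c : (y + c) ^ q <= y ^ q + q * c * (y + c) ^ (q - 1).
Proof.
case: q => [|q]; first by rewrite !expn0.
rewrite subn1 /=; elim: q => [|q IH]; first by rewrite !expnS !expn0; nat_lia.
have : (y + c) * (y + c) ^ q.+1 <= (y + c) * (y ^ q.+1 + q.+1 * c * (y + c) ^ q) by rewrite leq_mul2l IH orbT.
rewrite -expnS => /leq_trans; apply.
have h : y ^ q.+1 <= (y + c) ^ q.+1 by apply: leq_exp; nat_lia.
rewrite [y ^ q.+2]expnS; rewrite [(y + c) ^ q.+1]expnS in h *.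
move: (y ^ q.+1) ((y + c) ^ q) h => x z h; nia.
Qed.

(** A star with d body vertices and g edges that is small in absolute terms is
    also thin: g / d is at most (2n / B)^(q-1). If d is at most 2n / B, this
    follows from the trivial bound by d^q, and otherwise from the absolute
    bound. *)
Lemma small_star_scaling q' g d n B : 0 < B -> 0 < q' ->
  g <= d ^ q' -> B ^ q' * g <= (2 * n) ^ q' -> B ^ (q' - 1) * g <= d * (2 * n) ^ (q' - 1).
Proof.
move=> B0; case: q' => // q' _; rewrite subn1 /= => gd gn.
have [le|lt] := leqP (B * d) (2 * n).
  apply: (@leq_trans (B ^ q' * d ^ q'.+1)); first by rewrite leq_mul2l gd orbT.
  by rewrite expnS mulnCA -expnMn leq_mul2l leq_exp ?orbT.
rewrite -(leq_pmul2l B0) mulnA -expnS; apply: leq_trans gn _.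
by rewrite expnS mulnA leq_mul2r ltnW ?orbT.
Qed.

Lemma expn_shrink q x c : 0 < q -> x ^ q <= q`! * 'C(x - c, q) + (q * q + q * c) * x ^ (q - 1).
Proof.
move=> q0; have [cx|xc] := leqP c x; last first.
  apply: (@leq_trans (q * c * x ^ (q - 1))).
    have -> : x ^ q = x * x ^ (q - 1) by apply: expn_pred_mul.
    by rewrite leq_mul2r; apply/orP; right; nia.
  by rewrite mulnDl addnA leq_addl.
have h1 := expnD_le q (x - c) c; rewrite subnK // in h1.
have h2 := exp_le_bin q (x - c).
have h3 : q * q * (x - c) ^ (q - 1) <= q * q * x ^ (q - 1).
  by rewrite leq_mul2l leq_exp ?orbT // leq_subr.
rewrite [q`! * _]mulnC; move: h1 h2 h3; rewrite mulnDl; clear.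
move: (x ^ q) ((x - c) ^ q) ('C(_, _) * _) (q * c * _) (q * q * x ^ _) (q * q * _) => *.
nat_lia.
Qed.

(** The numerical reason why the vertices outside the cores cannot fill stars
    of full size N: aN + f of them would carry more edges in a full stars and
    one partial star, on the left, than the loose edges can number, on the
    right. For q at least 3 the crude bound 2aN for aN + f suffices; for q = 2
    the term f^2 is needed. *)
Lemma loose_count_contra q beta a f N CC : 2 <= q -> 8 + 4 * q < beta -> 64 <= beta -> 0 < a -> f < N -> CC < N ->
  beta * q * (a * N ^ q + f ^ q) <= (a * N + f) * N ^ (q - 1) * (beta + 4 + 2 * q) + CC * N ^ (q - 1) ->
  False.
Proof.
move=> q2 b1 b2 a0 fN CN.
have N0 : 0 < N by nat_lia.
have [q3|q_eq2] := leqP 3 q.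
  have Y0 : 0 < N ^ (q - 1) by rewrite expn_gt0 N0.
  have e : N ^ q = N * N ^ (q - 1) by apply: expn_pred_mul; apply: ltnW.
  move=> h; have h1 : (beta * q * (a * N)) * N ^ (q - 1) <=
     ((a * N + f) * (beta + 4 + 2 * q) + CC) * N ^ (q - 1).
    apply: (@leq_trans (beta * q * (a * N ^ q + f ^ q))).
      by rewrite e -!mulnA leq_mul2l leq_mul2l leq_addr !orbT.
    by apply: leq_trans h _; rewrite [(_ + CC) * _]mulnDl leq_add2r mulnAC.
  rewrite leq_pmul2r // in h1; move: h1 q3 b1 a0 fN CN; clear.
  move: (q) => x h1 q3 b1 a0 fN CN.
  have h2 : a * N + f <= 2 * (a * N) by nia.
  have h3 : (a * N + f) * (beta + 4 + 2 * x) <= 2 * (a * N) * (beta + 4 + 2 * x) by rewrite leq_mul2r h2 orbT.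
  have aN : N <= a * N by rewrite leq_pmull.
  move: (a * N) aN h1 h3 => y Ny h1 h3.
  have h4 : y * (beta * x) <= y * (2 * (beta + 4 + 2 * x) + 1) by nia.
  rewrite leq_pmul2l in h4; last by nat_lia.
  nia.
have -> : q = 2 by nat_lia.
rewrite !expnS !expn0 !muln1 => h; move: h b2 a0 fN CN N0; clear => h b2 a0 fN CN N0.
have [f4|f4] := leqP (4 * f) (3 * N).
  have aN : N <= a * N by rewrite leq_pmull.
  have h1 : 4 * (a * N + f) <= 7 * (a * N) by nat_lia.
  have h2 : 4 * (a * N + f) * (N * (beta + 8)) <= 7 * (a * N) * (N * (beta + 8)) by rewrite leq_mul2r h1 orbT.
  have h3 : N * (8 * beta * (a * N)) <= N * (7 * (a * N) * (beta + 8) + 4 * CC) by nat_lia.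
  rewrite leq_pmul2l // in h3; move: (a * N) h3 aN b2 CN => y; clear => h3 aN b2 CN.
  have : 64 * y <= beta * y by rewrite leq_mul2r b2 orbT.
  nat_lia.
have h1 : 9 * (N * N) <= 16 * (f * f) by nia.
have h1' : beta * (9 * (N * N)) <= beta * (16 * (f * f)) by rewrite leq_mul2l h1 orbT.
have h2 : (a * N + f) * (N * (beta + 8)) <= (a + 1) * N * (N * (beta + 8)).
  by rewrite leq_mul2r; apply/orP; right; nat_lia.
have h3 : N * ((32 * beta * a + 18 * beta) * N) <= N * (16 * (a + 1) * (beta + 8) * N + 16 * CC) by nat_lia.
rewrite leq_pmul2l // in h3.
have h4 : (32 * beta * a + 18 * beta) * N < (16 * (a + 1) * (beta + 8) + 16) * N by nat_lia.
rewrite ltn_pmul2r // in h4; move: h4 b2 a0; clear => h4 b2 a0.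
have : 64 * a <= beta * a by rewrite leq_mul2r b2 orbT.
nat_lia.
Qed.

Lemma bin_drop q' x c n : 0 < q' -> x <= n -> 'C(x, q') <= 'C(x - c, q') + c * n ^ (q' - 1).
Proof.
case: q' => // q' _ xn; rewrite subn1 /=; have [cx|xc] := leqP c x; last first.
  rewrite -(subnK (ltnW xc)) (_ : x - (c - x + x) = 0); last by nat_lia.
  have := bin_add_le q' 0 x; rewrite add0n => h; apply: leq_trans h _.
  by rewrite leq_add2l leq_mul ?leq_addl // leq_exp.
have := bin_add_le q' (x - c) c; rewrite subnK // => h; apply: leq_trans h _.
by rewrite leq_add2l leq_mul // leq_exp.
Qed.

Lemma admissible_small r t n : admissible r t n -> n < r * t * (t - 1) -> t %| n.
Proof. by rewrite /admissible; case/orP => // h1 h2; nat_lia. Qed.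

(** * Union-closed families without small transversals *)

Section UnionClosed.
Variables (T : finType) (q t : nat) (N : {set {set T}}).
Hypotheses (q_ge2 : 2 <= q) (t_ge2 : 2 <= t) (tq : t %| q).
Hypothesis cardT : #|T| = q * t.
Hypothesis N0 : set0 \in N.
Hypothesis NU : forall A B, A \in N -> B \in N -> A :|: B \in N.
Hypothesis Nsize : forall A, A \in N -> #|A| <= q \/ t %| #|A|.
Hypothesis Ncov : forall S : {set T}, #|S| < q ->
  exists A, [/\ A \in N, A != set0 & [disjoint A & S]].

(** By closure under union this is the largest member disjoint from S. *)
Definition avoid_union (S : {set T}) : {set T} :=
  \bigcup_(A in N | [disjoint A & S]) A.
Local Notation U := avoid_union.

Lemma avoid_union_in S : U S \in N.
Proof. by rewrite /U; elim/big_ind: _ => // A /andP[]. Qed.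

Lemma avoid_union_disj S : [disjoint U S & S].
Proof.
rewrite -setI_eq0; apply/eqP/setP => x; rewrite !inE; apply/negP => /andP[].
by case/bigcupP => A /andP[_ /pred0P dA] xA xS; have := dA x; rewrite /= xA xS.
Qed.

Lemma avoid_union_sup (S A : {set T}) : A \in N -> [disjoint A & S] -> A \subset U S.
Proof. by move=> AN dA; apply: (bigcup_sup A) => //; rewrite AN. Qed.

Lemma avoid_union_neq0 (S : {set T}) : #|S| < q -> U S != set0.
Proof.
move=> /Ncov[A [AN A0 dA]]; apply: contra_neq A0 => U0.
by apply/eqP; rewrite -subset0 -U0 avoid_union_sup.
Qed.

Lemma subset_avoid_union S x : U (x |: S) \subset U S :&: U [set x].
Proof.
have d1 := avoid_union_disj (x |: S).
rewrite subsetI !avoid_union_sup ?avoid_union_in //.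
  by apply: disjointWr d1; rewrite sub1set setU11.
by apply: disjointWr d1; rewrite subsetUr.
Qed.

Let Qs := [set x | [set x] \in N].

Lemma sub_singletons_in (S : {set T}) : S \subset Qs -> S \in N.
Proof.
move=> sS; have -> : S = \bigcup_(x in S) [set x].
  apply/setP => x; apply/idP/bigcupP => [xS|[y yS /set1P->//]].
  by exists x => //; rewrite inE.
elim/big_ind: _ => // x /(subsetP sS); by rewrite inE.
Qed.

Lemma card_singletons_le : #|Qs| <= q.
Proof.
rewrite leqNgt; apply/negP => /exists_subset_card[S sS cS].
have [] := Nsize (sub_singletons_in sS); first by lia.
by rewrite cS; apply/negP; apply: dvdn_succF.
Qed.

(** Let Qs be the set of singleton members, nonempty and of size less than q,
    and U the largest member that avoids it. If |U| + |Qs| is at most q, then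
    Qs and all but one point of U form a set too small to be a transversal,
    and the member it misses is a new singleton. Otherwise U together with Qs,
    and with Qs minus a point, gives two members of consecutive sizes, which
    cannot both be admissible. *)
Lemma singletons_none_or_all : Qs != set0 -> #|Qs| = q.
Proof.
move=> Q0; apply/eqP; rewrite eqn_leq card_singletons_le leqNgt.
apply/negP => Qlt; set U' := U Qs.
have U'0 : U' != set0 by apply: avoid_union_neq0.
have dU : [disjoint U' & Qs] := avoid_union_disj Qs.
have cardUQ (S : {set T}) : S \subset Qs -> #|U' :|: S| = #|U'| + #|S|.
  move=> sS; rewrite cardsU; suff -> : U' :&: S = set0 by rewrite cards0 subn0.
  by apply/eqP; rewrite setI_eq0; apply: disjointWr dU.
have [le_q|gt_q] := leqP (#|U'| + #|Qs|) q.
  case/set0Pn: U'0 => a aU.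
  have [|A [AN A0 dA]] := @Ncov (Qs :|: (U' :\ a)).
    rewrite cardsU; have := cardsD1 a U'; rewrite aU; nat_lia.
  have sA : A \subset U'.
    apply: avoid_union_sup => //; apply: disjointWr dA; exact: subsetUl.
  have /eqP Aa : A == [set a].
    rewrite eqEcard cards1 card_gt0 A0 andbT; apply/subsetP => x xA; rewrite inE.
    apply/negP => /negP xa; have := pred0P dA x; rewrite /= xA /= !inE xa.
    by rewrite (subsetP sA) // orbT.
  have aQ : a \in Qs by rewrite inE -Aa.
  by have := pred0P dU a; rewrite /= aU aQ.
have [x xQ] := set0Pn _ Q0.
have d1 : t %| #|U'| + #|Qs|.
  have := Nsize (NU (avoid_union_in Qs) (sub_singletons_in (subxx Qs))).
  by rewrite cardUQ // => -[] //; nat_lia.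
have sx : Qs :\ x \subset Qs by apply: subsetDl.
have cx : #|Qs| = (#|Qs :\ x|).+1 by rewrite (cardsD1 x) xQ.
have := Nsize (NU (avoid_union_in Qs) (sub_singletons_in sx)).
rewrite cardUQ // cx in d1 *; rewrite addnS in d1 => -[le_q|d2].
  have e : #|U'| + #|Qs :\ x| = q by nat_lia.
  by move: d1; rewrite e; apply/negP; apply: dvdn_succF.
by move: d1; apply/negP; apply: dvdn_succF.
Qed.

Hypothesis Q0 : Qs = set0.

Lemma no_singleton x : [set x] \notin N.
Proof.
apply/negP => h; have : x \in Qs by rewrite inE.
by rewrite Q0 in_set0.
Qed.

Lemma card_ge2_member A : A \in N -> A != set0 -> 2 <= #|A|.
Proof.
move=> AN A0; rewrite ltnNge; apply/negP => A1.
have /cards1P[x Ax] : #|A| == 1 by rewrite eqn_leq A1 card_gt0.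
by have := no_singleton x; rewrite -Ax AN.
Qed.

(** If W, the largest member missing y, has at most q points, then y together
    with the complement in W of a set of two points is not a transversal, so
    that every pair in W is a member. Hence so is W minus any point. A member
    that meets W in at most one point, united with W and with W minus another
    point, produces two consecutive sizes above q. *)
Lemma dvd_diff_small y A : 3 <= q -> A \in N -> #|U [set y]| <= q -> False.
Proof.
move=> q3 AN Uq; set W := U [set y] in Uq.
have yW : y \notin W.
  by have := pred0P (avoid_union_disj [set y]) y; rewrite /= set11 andbT => ->.
have Wsup B : B \in N -> y \notin B -> B \subset W.
  by move=> BN yB; apply: avoid_union_sup => //; rewrite disjoint_sym disjoints1.
(* y and W :\: S are too few points to be a transversal; the member that they
   miss avoids y, so it lies in W *)
have inW (S : {set T}) : S \subset W -> #|W :\: S| <= q - 2 ->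
    exists B, [/\ B \in N, B != set0 & B \subset S].
  move=> sS cS; have [|B [BN B0 dB]] := @Ncov (y |: (W :\: S)).
    rewrite cardsU1; have : (y \notin W :\: S) <= 1 by case: (_ \notin _).
    nat_lia.
  exists B; split=> //.
  have yB : y \notin B.
    apply/negP => yB; have := pred0P dB y; by rewrite /= yB setU11.
  apply/subsetP => x xB; have xW := subsetP (Wsup B BN yB) x xB.
  have := pred0P dB x; rewrite /= xB /= !inE xW andbT => /norP[_].
  by rewrite negbK.
have cW : #|W| = q.
  apply/eqP; rewrite eqn_leq Uq leqNgt; apply/negP => Wlt.
  have [a aW] : exists a, a \in W.
    apply/set0Pn; apply: avoid_union_neq0; rewrite cards1; nat_lia.
  have [||B [BN B0 sB]] := inW [set a].
  - by rewrite sub1set.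
  - have := cardsD1 a W; rewrite aW; nat_lia.
  have := card_ge2_member BN B0; have := subset_leq_card sB; rewrite cards1; nat_lia.
have pairW a b : a \in W -> b \in W -> a != b -> [set a; b] \in N.
  move=> aW bW ab; have [||B [BN B0 sB]] := inW [set a; b].
  - by rewrite subUset !sub1set aW.
  - have : #|W :\: [set a; b]| = q - 2.
      rewrite cardsD cW; have -> : W :&: [set a; b] = [set a; b].
        by apply/setIidPr; rewrite subUset !sub1set aW.
      by rewrite cards2 ab.
    nat_lia.
  have /eqP <- // : B == [set a; b].
  by rewrite eqEcard sB cards2 ab card_ge2_member.
have WDin b : b \in W -> W :\ b \in N.
  move=> bW; have sU : U [set y; b] \subset W :\ b.
    have d := avoid_union_disj [set y; b].
    apply/subsetP => x xU; have := pred0P d x; rewrite /= xU /= !inE => /norP[xy xb].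
    rewrite xb /=; apply: (subsetP (Wsup _ (avoid_union_in [set y; b]) _)) xU.
    by apply/negP => yU; have := pred0P d y; rewrite /= yU !inE eqxx.
  suff <- : U [set y; b] = W :\ b by apply: avoid_union_in.
  apply/eqP; rewrite eqEsubset sU; apply/subsetP => x; rewrite !inE => /andP[xb xW].
  have [z] : exists z, z \in W :\ b :\ x.
    apply/set0Pn; rewrite -card_gt0.
    have := cardsD1 b W; have := cardsD1 x (W :\ b); rewrite bW !inE xb xW; nat_lia.
  rewrite !inE => /and3P[zx zb zW].
  have xz : x != z by rewrite eq_sym.
  apply: (subsetP (avoid_union_sup (pairW _ _ xW zW xz) _)); last by rewrite !inE eqxx.
  rewrite -setI_eq0; apply/eqP/setP => u; rewrite !inE.
  apply/negP => /andP[/orP[]/eqP-> /orP[/eqP e|/eqP e]]; subst.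
  - by rewrite xW in yW.
  - by rewrite eqxx in xb.
  - by rewrite zW in yW.
  - by rewrite eqxx in zb.
have [a aW] : exists a, a \in W by apply/set0Pn; rewrite -card_gt0; nat_lia.
have [|B [BN B0 dB]] := @Ncov (W :\ a).
  by have := cardsD1 a W; rewrite aW; nat_lia.
have nBW x : x \in B -> x \in W -> x = a.
  move=> xB xW; apply/eqP; have := pred0P dB x; rewrite /= xB !inE xW andbT.
  by move=> /negbT; rewrite negbK.
have BW0 : B :\: W != set0.
  apply/negP => /eqP B0'; have sB : B \subset W by rewrite -setD_eq0 B0'.
  have : B \subset [set a].
    by apply/subsetP => x xB; rewrite inE (nBW _ xB (subsetP sB _ xB)).
  by move/subset_leq_card; rewrite cards1; have := card_ge2_member BN B0; nat_lia.
have cBWpos : 0 < #|B :\: W| by rewrite card_gt0.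
have cU (S : {set T}) : S \subset W -> B :&: W \subset S ->
    #|B :|: S| = #|B :\: W| + #|S|.
  move=> sS sBS; have -> : B :|: S = (B :\: W) :|: S.
    apply/setP => x; rewrite !inE; case xW: (x \in W) => //=.
      case xB: (x \in B) => //=; rewrite (subsetP sBS) //.
      by rewrite inE xB xW.
  rewrite cardsU; suff -> : (B :\: W) :&: S = set0 by rewrite cards0 subn0.
  apply/setP => x; rewrite !inE; apply/negP => /andP[/andP[/negP xW _] xS].
  by apply: xW; apply: (subsetP sS).
have WN : W \in N by apply: avoid_union_in.
have t1 : t %| #|B :\: W| + q.
  by have := Nsize (NU BN WN); rewrite cU ?subsetIr // cW => -[] //; nat_lia.
have t1' : t %| #|B :\: W| by rewrite -(dvdn_addl _ tq).
have ct : t <= #|B :\: W| by apply: dvdn_leq.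
have [b] : exists b, b \in W :\ a.
  by apply/set0Pn; rewrite -card_gt0; have := cardsD1 a W; rewrite aW; nat_lia.
rewrite !inE => /andP[ba bW].
have cb : #|W| = (#|W :\ b|).+1 by rewrite (cardsD1 b) bW.
have := Nsize (NU BN (WDin b bW)); rewrite cU ?subsetDl //; last first.
  apply/subsetP => x; rewrite !inE => /andP[xB xW]; rewrite xW andbT.
  by rewrite (nBW x) // eq_sym.
case; first by nat_lia.
move=> t2; have := dvdn_succF t_ge2 t2; have -> : (#|B :\: W| + #|W :\ b|).+1 = #|B :\: W| + q by nat_lia.
by rewrite t1.
Qed.

(** Enlarging the avoided set by y only removes multiples of t: the largest
    member W that misses y and its union with A both have sizes divisible by
    t. *)
Lemma dvd_diff y A : A \in N -> t %| #|A :\: U [set y]|.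
Proof.
move=> AN; set W := U [set y].
have WN : W \in N := avoid_union_in _.
have cA : #|W :|: A| = #|W| + #|A :\: W|.
  have -> : W :|: A = W :|: (A :\: W).
    by apply/setP => x; rewrite !inE; case: (x \in W).
  rewrite cardsU; suff -> : W :&: (A :\: W) = set0 by rewrite cards0 subn0.
  by apply/setP => x; rewrite !inE; case: (x \in W).
have mult B : B \in N -> (q < #|B|) || (q == 2) -> t %| #|B|.
  move=> BN; case/orP => [qB|/eqP q2]; first by have [|//] := Nsize BN; lia.
  have t2 : t = 2 by move: tq; rewrite q2 => /dvdn_leq; lia.
  have [B0|B0] := eqVneq B set0; first by rewrite B0 cards0 dvdn0.
  have := card_ge2_member BN B0; have [Bq|//] := Nsize BN.
  move=> B2; have -> : #|B| = 2 by lia.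
  by rewrite t2.
(* For q = 2 the bound of the sizes by q does not exclude |W| <= q, but then
   t = 2, and members of size at most 2 are empty or pairs. *)
have [q2|q2] := eqVneq q 2.
  rewrite -(@dvdn_addr #|W|) -?cA; apply: mult => //; last by rewrite q2 orbT.
  - exact: NU.
  - by rewrite q2 orbT.
have q3 : 3 <= q by lia.
have [Wq|Wq] := leqP #|W| q; first by case: (dvd_diff_small q3 AN Wq).
rewrite -(@dvdn_addr #|W|) -?cA; apply: mult => //; first exact: NU.
  by rewrite cA; lia.
by rewrite Wq.
Qed.

Lemma avoid_union_step S x : x \in U S -> #|U (x |: S)| + t <= #|U S|.
Proof.
move=> xU; have s1 := subset_avoid_union S x.
have d := @dvd_diff x _ (avoid_union_in S).
have x1 : x \in U S :\: U [set x].
  rewrite inE xU andbT; apply/negP => xU1.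
  by have := pred0P (avoid_union_disj [set x]) x; rewrite /= xU1 set11.
have : t <= #|U S :\: U [set x]|.
  by apply: dvdn_leq => //; rewrite card_gt0; apply/set0Pn; exists x.
have := cardsID (U [set x]) (U S); have := subset_leq_card s1; nat_lia.
Qed.

(** One can avoid q - 1 points in succession, and each of them costs at least
    t points. *)
Lemma avoid_union_card_ge n (S : {set T}) : #|S| + n.+1 <= q -> n.+1 * t <= #|U S|.
Proof.
elim: n S => [|n IH] S Sq.
  have /set0Pn[x xU] : U S != set0 by apply: avoid_union_neq0; nat_lia.
  by have := avoid_union_step xU; nat_lia.
have /set0Pn[x xU] : U S != set0 by apply: avoid_union_neq0; nat_lia.
have := avoid_union_step xU; have := IH (x |: S).
have : #|x |: S| <= #|S|.+1 by rewrite cardsU1; case: (_ \notin _) => /=; lia.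
move=> h1 h2 h3; have := h2 ltac:(lia); nia.
Qed.

(** The chain of q successive losses of at least t points starts from at most
    qt points, so that each loss is exactly t. *)
Lemma card_avoid_union1 y : #|U [set y]| = q.-1 * t.
Proof.
have hT : #|U set0| <= q * t by rewrite -cardT max_card.
have ge0 : q * t <= #|U set0|.
  have := @avoid_union_card_ge q.-1 set0; rewrite cards0 prednK; last by lia.
  by apply.
have yU : y \in U set0.
  have /eqP -> : U set0 == setT by rewrite eqEcard subsetT cardsT cardT.
  by rewrite inE.
have := avoid_union_step yU; rewrite setU0.
have := @avoid_union_card_ge q.-2 [set y]; rewrite cards1.
have -> : q.-2.+1 = q.-1 by lia.
move=> /(_ ltac:(lia)) h1 h2.
have e : q * t = q.-1 * t + t by nia.
lia.
Qed.

(** The blocks are the complements of the largest members missing one point. *)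
Lemma block_partition y : [/\ y \in ~: U [set y], #|~: U [set y]| = t &
   forall z, z \in ~: U [set y] -> U [set z] = U [set y]].
Proof.
have dy x : x \notin U [set x].
  apply/negP => xU1.
  by have := pred0P (avoid_union_disj [set x]) x; rewrite /= xU1 set11.
have ct : #|~: U [set y]| = t.
  have := cardsC (U [set y]); rewrite cardT card_avoid_union1; nia.
split=> [|//|z]; first by rewrite inE dy.
move=> zU; apply/eqP; rewrite eqEcard !card_avoid_union1 leqnn andbT.
rewrite -setD_eq0 -cards_eq0.
have := @dvd_diff y _ (avoid_union_in [set z]).
have : #|U [set z] :\: U [set y]| < t.
  rewrite -ct; apply: proper_card; apply/properP; split.
    by apply/subsetP => x; rewrite !inE => /andP[].
  by exists z => //; rewrite inE (negPf (dy z)) andbF.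
case: (posnP #|U [set z] :\: U [set y]|) => [->//|h1 h2 h3].
by have := dvdn_leq h1 h3; nat_lia.
Qed.

End UnionClosed.

(** The family N models the complements of homogeneous sets of labels: the
    first alternative is the pattern of a star (Q indexes the labels outside
    the centre), and the second one that of a union of blocks. *)
Lemma union_closed_classification (T : finType) (q t : nat) (N : {set {set T}}) :
  2 <= q -> 2 <= t -> t %| q -> #|T| = q * t -> set0 \in N ->
  (forall A B, A \in N -> B \in N -> A :|: B \in N) ->
  (forall A, A \in N -> #|A| <= q \/ t %| #|A|) ->
  (forall S : {set T}, #|S| < q ->
     exists A, [/\ A \in N, A != set0 & [disjoint A & S]]) ->
  (exists2 Q : {set T}, #|Q| = q & forall S : {set T}, S \subset Q -> S \in N) \/
  (exists B : T -> {set T}, forall y, [/\ y \in B y, #|B y| = t, ~: B y \in N &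
      forall z, z \in B y -> B z = B y]).
Proof.
move=> q2 t2 tq cT N0 NU Nsize Ncov.
have [Q0|Qn0] := eqVneq [set x | [set x] \in N] set0.
  right; exists (fun y => ~: avoid_union N [set y]) => y.
  have [h1 h2 h3] := block_partition q2 t2 tq cT N0 NU Nsize Ncov Q0 y.
  split=> // [|z /h3 -> //].
  by rewrite setCK; apply: avoid_union_in.
left; exists [set x | [set x] \in N].
  by apply: (@singletons_none_or_all T q t).
by move=> S sS; apply: sub_singletons_in.
Qed.

(** * Homogeneous sets of labels *)

Section Homogeneous.
Variables (V : finType) (k mu : nat).
Implicit Types (X Y : {set {ffun 'I_k -> V}}) (J T : {set 'I_k}).
Implicit Types (x y : {ffun 'I_k -> V}).

Definition agree J x y := [forall i in J, y i == x i].

Lemma agreeP J x y : reflect (forall i, i \in J -> y i = x i) (agree J x y).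
Proof.
by apply: (iffP forall_inP) => h i iJ; [apply/eqP/h|apply/eqP/h].
Qed.

(** The set Z is any set of at most mu vertices to be avoided outside J;
    taking for Z the union of few edges makes the intersection with them lie
    inside the labels J. *)
Definition free X J x :=
  [forall Z : {set V}, (#|Z| <= mu) ==>
    [exists y in X, agree J x y && [forall (i | i \notin J), y i \notin Z]]].

Lemma freeP X J x : reflect (forall Z : {set V}, #|Z| <= mu -> exists y,
    [/\ y \in X, forall i, i \in J -> y i = x i &
        forall i, i \notin J -> y i \notin Z]) (free X J x).
Proof.
apply: (iffP forallP) => h Z.
  move=> cZ; have /implyP/(_ cZ)/exists_inP[y yX /andP[/agreeP ag /forall_inP fr]] := h Z.
  by exists y.
apply/implyP => /h[y [yX ag fr]]; apply/exists_inP; exists y => //.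
by apply/andP; split; [apply/agreeP|apply/forall_inP].
Qed.

Lemma free_sub X Y J x : X \subset Y -> free X J x -> free Y J x.
Proof.
move=> /subsetP sXY /freeP h; apply/freeP => Z /h[y [yX ag fr]].
by exists y; split=> //; apply: sXY.
Qed.

Definition homog X J := [forall x in X, free X J x].

Lemma homog_setT X : homog X setT.
Proof.
apply/forall_inP => x xX; apply/freeP => Z _.
by exists x; split=> // i; rewrite inE.
Qed.

(** Exchange first the vertices outside J and then, in the new edge, those
    outside J'. A vertex that the second step keeps and that is not labelled
    by J was changed in the first step, so it already avoids Z. *)
Lemma homogI X J J' : homog X J -> homog X J' -> homog X (J :&: J').
Proof.
move=> /forall_inP h /forall_inP h'; apply/forall_inP => x xX.
apply/freeP => Z cZ.
have /freeP/(_ Z cZ)[y [yX ag fr]] := h x xX.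
have /freeP/(_ Z cZ)[z [zX ag' fr']] := h' y yX.
exists z; split=> // i; rewrite inE.
  by case/andP=> iJ iJ'; rewrite ag' // ag.
by have [iJ'|/fr'//] := boolP (i \in J'); rewrite andbT ag' // => /fr.
Qed.

(** Hereditary failure: no nonempty subfamily is homogeneous for J. *)
Definition unhomog X J := forall Y, Y \subset X -> Y != set0 -> ~~ homog Y J.

Lemma unhomog_sub X Y J : Y \subset X -> unhomog X J -> unhomog Y J.
Proof. by move=> sYX h Z sZY; apply: h; apply: subset_trans sYX. Qed.

(** A nonempty fibre over fixed labels J is not homogeneous for J, so that a
    set Z of at most mu vertices is met, outside J, by each of its elements.
    Branching over the label and the vertex of this incidence fixes one more
    label at a cost of k mu. *)
Lemma unhomog_fiber X J x :
  (forall J', J \subset J' -> J' != setT -> unhomog X J') ->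
  #|[set y in X | agree J x y]| <= (k * mu) ^ #|~: J|.
Proof.
move En: #|~: J| => n; elim: n => [|n IH] in J x En * => h.
  have JT : J = setT by apply: setC_inj; rewrite setCT; apply/eqP; rewrite -cards_eq0 En.
  rewrite expn0 -(cards1 x); apply: subset_leq_card; apply/subsetP => y.
  rewrite !inE => /andP[_ /agreeP ag]; apply/eqP/ffunP => i.
  by apply: ag; rewrite JT inE.
set Xa := [set y in X | _].
have [->|Xa0] := eqVneq Xa set0; first by rewrite cards0.
have JT : J != setT by apply/eqP => e; move: En; rewrite e setCT cards0.
have sXa : Xa \subset X by apply/subsetP => y; rewrite inE => /andP[].
have := h J (subxx _) JT Xa sXa Xa0.
rewrite negb_forall_in => /exists_inP[y]; rewrite inE => /andP[yX /agreeP yx].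
rewrite negb_forall => /existsP[Z]; rewrite negb_imply => /andP[cZ].
rewrite negb_exists_in => /forall_inP hZ.
(* The function that is compared with is x with the label i sent to z. *)
have cover : Xa \subset \bigcup_(i in ~: J) \bigcup_(z in Z)
    [set u in X | agree (i |: J) [ffun j => if j == i then z else x j] u].
  apply/subsetP => u uX; have := hZ u uX; move: uX.
  rewrite inE => /andP[uX /agreeP ux]; rewrite negb_and => /orP[/negP[]|].
    by apply/agreeP => i iJ; rewrite yx // ux.
  rewrite negb_forall_in => /exists_inP[i iJ]; rewrite negbK => uZ.
  apply/bigcupP; exists i; first by rewrite inE.
  apply/bigcupP; exists (u i) => //; rewrite inE uX /=; apply/agreeP => j.
  by rewrite !inE ffunE; case: eqVneq => [->//|_ /= /ux].
apply: leq_trans (subset_leq_card cover) _.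
have cI (i : 'I_k) : i \in ~: J -> #|\bigcup_(z in Z)
    [set u in X | agree (i |: J) [ffun j => if j == i then z else x j] u]| <= mu * (k * mu) ^ n.
  move=> iJ; rewrite (leq_trans (card_bigcup_le_const (n := (k * mu) ^ n) _)) //.
    move=> z _; apply: IH => [|J' sJ']; last first.
      by apply: h; apply: subset_trans sJ'; apply: subsetUr.
    apply/eqP; rewrite -eqSS -En (cardsD1 i (~: J)) iJ add1n eqSS; apply/eqP.
    by apply: eq_card => j; rewrite !inE negb_or.
  by rewrite leq_mul2r cZ orbT.
rewrite (leq_trans (card_bigcup_le_const cI)) // expnS mulnA leq_mul2r.
by rewrite leq_mul2r (leq_trans (max_card _)) ?card_ord // !orbT.
Qed.

(** There are at most |W|^|J| choices for the vertices with labels in J. *)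
Lemma unhomog_card (W : {set V}) X J :
  (forall x i, x \in X -> x i \in W) ->
  (forall J', J \subset J' -> J' != setT -> unhomog X J') ->
  #|X| <= #|W| ^ #|J| * (k * mu).+1 ^ k.
Proof.
move=> XW h.
have gen n (J0 : {set 'I_k}) x : J0 \subset J -> #|J :\: J0| = n ->
    #|[set y in X | agree J0 x y]| <= #|W| ^ n * (k * mu).+1 ^ k.
  elim: n J0 x => [|n IH] J0 x sJ0 En.
    have -> : J0 = J.
      by apply/eqP; rewrite eqEsubset sJ0 -setD_eq0 -cards_eq0 En.
    rewrite expn0 mul1n (leq_trans (unhomog_fiber _ h)) //.
    rewrite (leq_trans (n := (k * mu).+1 ^ #|~: J|)) //.
      by case: #|~: J| => // n; rewrite leq_exp2r.
    by rewrite leq_pexp2l // (leq_trans (max_card _)) ?card_ord.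
  have [i iJ] : exists i, i \in J :\: J0 by apply/set0Pn; rewrite -card_gt0 En.
  have cover : [set y in X | agree J0 x y] \subset \bigcup_(z in W)
     [set u in X | agree (i |: J0) [ffun j => if j == i then z else x j] u].
    apply/subsetP => u; rewrite inE => /andP[uX /agreeP ag].
    apply/bigcupP; exists (u i); first exact: XW.
    rewrite inE uX; apply/agreeP => j.
    by rewrite !inE ffunE; case: eqVneq => [->//|_ /= /ag].
  apply: leq_trans (subset_leq_card cover) _; rewrite expnS -mulnA.
  apply: card_bigcup_le_const => z _; apply: IH.
    by rewrite subUset sub1set sJ0 andbT; case/setDP: iJ.
  apply/eqP; rewrite -eqSS -En (cardsD1 i (J :\: J0)) iJ add1n eqSS; apply/eqP.
  by apply: eq_card => j; rewrite !inE negb_or -andbA.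
have [->|/set0Pn[x xX]] := eqVneq X set0; first by rewrite cards0.
have := gen #|J| set0 x (sub0set _); rewrite setD0 => /(_ erefl).
suff -> : [set y in X | agree set0 x y] = X by [].
by apply/setP => y; rewrite inE; case: (y \in X) => //=; apply/agreeP => i; rewrite inE.
Qed.

(** Remove repeatedly an element that is not free for some J in M and give it
    the colour J. In a subfamily of one colour class, the element that was
    removed first witnesses that the subfamily is not homogeneous. *)
Lemma unhomog_split (M : {set {set 'I_k}}) X :
  (forall Y, Y \subset X -> Y != set0 -> exists2 J, J \in M & ~~ homog Y J) ->
  exists c : {ffun 'I_k -> V} -> {set 'I_k}, forall x, x \in X -> c x \in M /\
     forall J, J \in M -> unhomog [set y in X | c y == J] J.
Proof.
move En: #|X| => n; elim: n X En => [|n IH] X En h.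
  by exists (fun=> set0) => x; rewrite (cards0_eq En) inE.
have X0 : X != set0 by rewrite -card_gt0 En.
have [J JM] := h X (subxx _) X0.
rewrite negb_forall_in => /exists_inP[e eX nfree].
have sX : X :\ e \subset X by apply: subsetDl.
have [||c hc] := IH (X :\ e).
- by apply/eqP; rewrite -eqSS -En (cardsD1 e X) eX.
- by move=> Y sY; apply: h; apply: subset_trans sY sX.
exists (fun x => if x == e then J else c x) => x xX.
have hun J' : J' \in M -> unhomog [set y in X | (if y == e then J else c y) == J'] J'.
  move=> J'M Y sY Y0; have [eY|eY] := boolP (e \in Y).
    apply/negP => /forall_inP/(_ e eY) fr.
    have := subsetP sY e eY; rewrite inE eqxx => /andP[_ /eqP JJ'].
    move: nfree; rewrite JJ' => /negP[]; apply: free_sub fr.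
    by apply: subset_trans sY _; apply/subsetP => y; rewrite inE => /andP[].
  have /set0Pn[y yY] := Y0.
  have yXe z : z \in Y -> (z \in X :\ e) && (c z == J').
    move=> zY; have ze : z != e by apply: contraNneq eY => <-.
    by have := subsetP sY z zY; rewrite !inE (negPf ze).
  have [yX _] := andP (yXe y yY).
  apply: (proj2 (hc y yX) J' J'M) => //.
  by apply/subsetP => z /yXe; rewrite inE.
split=> //; case: eqVneq => // xe.
by have [] : c x \in M /\ _ := hc x _; rewrite ?inE ?xe.
Qed.

Variable q : nat.

(** The condition under which the homogeneous sets of labels are classified:
    no set of q - 1 labels is a transversal of their complements. *)
Definition covering X := [forall T : {set 'I_k}, (#|T| == q.-1) ==>
  [exists J, [&& homog X J, J != setT & T \subset J]]].

(** The set M contains the proper sets of labels for which some subfamily may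
    still be homogeneous. If it leaves some (q-1)-set T uncovered, T can be
    used in [unhomog_card]. Otherwise every nonempty subfamily fails to be
    homogeneous for some J in M, the family splits by [unhomog_split], and on
    each part M has lost an element. *)
Lemma no_covering_card_rec (W : {set V}) n (M : {set {set 'I_k}}) X :
  #|M| <= n -> q.-1 <= k -> setT \notin M ->
  (forall x i, x \in X -> x i \in W) ->
  (forall J, J != setT -> J \notin M -> unhomog X J) ->
  (forall Y, Y \subset X -> Y != set0 -> ~~ covering Y) ->
  #|X| <= n`! * (#|W| ^ q.-1 * (k * mu).+1 ^ k).
Proof.
move=> cM qk; elim: n M cM X => [|n IH] M cM X MT XW unM nocov.
  have [T cT] : exists T : {set 'I_k}, #|T| = q.-1.
    have [|S _ cS] := @exists_subset_card _ [set: 'I_k] q.-1; last by exists S.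
    by rewrite cardsT card_ord.
  rewrite fact0 mul1n -cT; apply: unhomog_card => // J _ JT; apply: unM => //.
  by move: cM; rewrite leqn0 cards_eq0 => /eqP->; rewrite inE.
have [/existsP[T /andP[/eqP cT /forallP nT]]|] :=
  boolP [exists T : {set 'I_k}, (#|T| == q.-1) && [forall J in M, ~~ (T \subset J)]].
  rewrite (leq_trans (n := #|W| ^ q.-1 * (k * mu).+1 ^ k)) //; last first.
    by rewrite leq_pmull ?fact_gt0.
  rewrite -cT; apply: unhomog_card => // J sTJ JT; apply: unM => //.
  by apply/negP => JM; have := nT J; rewrite JM sTJ.
rewrite negb_exists => /forallP Mcov.
have hM Y : Y \subset X -> Y != set0 -> exists2 J, J \in M & ~~ homog Y J.
  move=> sY Y0; have := nocov Y sY Y0; rewrite negb_forall => /existsP[T].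
  rewrite negb_imply => /andP[cT]; rewrite negb_exists => /forallP hT.
  have := Mcov T; rewrite cT /= negb_forall_in => /exists_inP[J JM]; rewrite negbK => sTJ.
  exists J => //; have := hT J; rewrite sTJ andbT negb_and negbK => /orP[//|/eqP JT].
  by rewrite -JT JM in MT.
have [c hc] := unhomog_split hM.
have cover : X \subset \bigcup_(J in M) [set y in X | c y == J].
  apply/subsetP => x xX; apply/bigcupP; exists (c x); last by rewrite inE xX eqxx.
  by case: (hc x xX).
rewrite (leq_trans (subset_leq_card cover)) // factS -mulnA.
rewrite (leq_trans (n := #|M| * (n`! * (#|W| ^ q.-1 * (k * mu).+1 ^ k)))) //; last first.
  by rewrite leq_mul2r cM orbT.
apply: card_bigcup_le_const => J JM.
have sXJ : [set y in X | c y == J] \subset X.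
  by apply/subsetP => y; rewrite inE => /andP[].
have [->|/set0Pn[x]] := eqVneq [set y in X | c y == J] set0; first by rewrite cards0.
rewrite inE => /andP[xX _]; have [_ /(_ J JM) unJ] := hc x xX.
apply: (IH (M :\ J)).
- by have := cardsD1 J M; rewrite JM; nat_lia.
- by rewrite inE negb_and MT orbT.
- by move=> y i /(subsetP sXJ); apply: XW.
- move=> J' J'T; rewrite !inE negb_and negbK => /orP[/eqP->//|J'M].
  by apply: unhomog_sub sXJ _; apply: unM.
- by move=> Y sY; apply: nocov; apply: subset_trans sY sXJ.
Qed.

Definition bad_const := (2 ^ k)`! * (k * mu).+1 ^ k.

Lemma no_covering_card (W : {set V}) X : q.-1 <= k ->
  (forall x i, x \in X -> x i \in W) ->
  (forall Y, Y \subset X -> Y != set0 -> ~~ covering Y) ->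
  #|X| <= bad_const * #|W| ^ q.-1.
Proof.
move=> qk XW nocov; rewrite /bad_const -mulnA [_.+1 ^ k * _]mulnC.
(* Initially all proper sets of labels are possible, fewer than 2^k. *)
apply: (@no_covering_card_rec W (2 ^ k) [set~ setT]) => //.
- rewrite (leq_trans (max_card _)) //.
  by rewrite cardsT_powerset || (rewrite -cardsT -powersetT card_powerset cardsT card_ord).
- by rewrite !inE eqxx.
- by move=> J; rewrite !inE => ->.
Qed.

End Homogeneous.

(** * Blocks, stars and few other edges *)

Section Extremal.
Variables (r t : nat) (hr : 1 <= r) (ht : 2 <= t).
Local Notation q := (r * t).
Local Notation s := (r * t * (t - 1)).
Local Notation k := (r * t ^ 2).

Section Kernels.

Lemma q_ge2 : 2 <= q. Proof. nia. Qed.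
Lemma k_eq : k = q * t. Proof. by rewrite expnS expn1 mulnA. Qed.
Lemma k_split : k = s + q. Proof. rewrite k_eq; nia. Qed.
Lemma t_dvd_s : t %| s. Proof. by rewrite -mulnA mulnCA dvdn_mulr. Qed.
Lemma t_dvd_k : t %| k. Proof. by rewrite k_eq dvdn_mull. Qed.
Lemma t_le_s : t <= s. Proof. nia. Qed.

Variable V : finType.
Implicit Types (G : {set {set V}}) (e f K B C Z : {set V}).

(** A kernel behaves like an edge with respect to intersections: some edge
    containing it avoids any given edge outside of it. Hence sizes of
    intersections with edges and with other kernels are admissible. *)
Definition kernel G K := [forall Z : {set V}, (#|Z| <= k) ==>
  [exists f in G, (K \subset f) && [disjoint f :\: K & Z]]].

Lemma kernelP G K : reflect (forall Z, #|Z| <= k -> exists f,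
   [/\ f \in G, K \subset f & [disjoint f :\: K & Z]]) (kernel G K).
Proof.
apply: (iffP forallP) => h Z.
  by move=> cZ; have /implyP/(_ cZ)/exists_inP[f fG /andP[]] := h Z; exists f.
apply/implyP => /h[f [fG Kf df]]; apply/exists_inP; exists f => //.
by rewrite Kf.
Qed.

Lemma disjoint_diffI f K Z : K \subset f -> [disjoint f :\: K & Z] -> f :&: Z = K :&: Z.
Proof.
move=> sK d; apply/setP => x; rewrite !inE.
have := pred0P d x; rewrite /= inE.
case: (x \in K) (subsetP sK x) => /= [->//|_].
by case: (x \in f) => //= ->.
Qed.

Variable G : {set {set V}}.
Hypothesis GJ : class_J r t G.

Lemma class_J_card e : e \in G -> #|e| = k.
Proof. by case/andP: GJ => /forall_inP h _ /h /eqP. Qed.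

Lemma class_J_inter e f : e \in G -> f \in G -> admissible r t #|e :&: f|.
Proof. by case/andP: GJ => _ /forall_inP h /h /forall_inP; apply. Qed.

Lemma kernel_edge K e : kernel G K -> e \in G -> admissible r t #|K :&: e|.
Proof.
move=> /kernelP hK eG; have [|f [fG Kf df]] := hK e; first by rewrite class_J_card.
by rewrite -(disjoint_diffI Kf df) class_J_inter.
Qed.

Lemma kernel_card_le K : kernel G K -> #|K| <= k.
Proof.
move/kernelP/(_ set0); rewrite cards0 => /(_ isT)[f [fG Kf _]].
by rewrite -(class_J_card fG) subset_leq_card.
Qed.

Lemma kernel_kernel K K' : kernel G K -> kernel G K' -> admissible r t #|K :&: K'|.
Proof.
move=> /kernelP hK hK'; have [|f [fG Kf df]] := hK K'; first exact: kernel_card_le.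
by rewrite -(disjoint_diffI Kf df) setIC kernel_edge.
Qed.

Definition blocks := [set B : {set V} | (#|B| == t) && kernel G B].

(** The intersection is nonempty and at most t, hence has size t because t is
    at most s. *)
Lemma block_edge_subset B e : B \in blocks -> e \in G -> ~~ [disjoint B & e] -> B \subset e.
Proof.
rewrite inE => /andP[/eqP cB kB] eG; rewrite -setI_eq0 => Be.
have le_t : #|B :&: e| <= t by rewrite -cB subset_leq_card ?subsetIl.
have := kernel_edge kB eG; have := t_le_s; move=> ts adm.
have t_le : t <= #|B :&: e|.
  rewrite leqNgt; apply/negP => lt; have := admissible_small adm (leq_trans lt ts).
  by move/dvdn_leq; rewrite card_gt0 => /(_ Be); nat_lia.
by apply/setIidPl/eqP; rewrite eqEcard subsetIl cB.
Qed.

Lemma blocks_disjoint B B' : B \in blocks -> B' \in blocks -> B != B' -> [disjoint B & B'].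
Proof.
rewrite !inE => /andP[/eqP cB kB] /andP[/eqP cB' kB'].
apply: contraR; rewrite -setI_eq0 => Be.
have le_t : #|B :&: B'| <= t by rewrite -cB subset_leq_card ?subsetIl.
have := kernel_kernel kB kB'; have := t_le_s; move=> ts adm.
have t_le : t <= #|B :&: B'|.
  rewrite leqNgt; apply/negP => lt; have := admissible_small adm (leq_trans lt ts).
  by move/dvdn_leq; rewrite card_gt0 => /(_ Be); nat_lia.
have /eqP/setIidPl BB' : B :&: B' == B by rewrite eqEcard subsetIl cB.
by rewrite eqEcard BB' cB cB' leqnn.
Qed.

(** In such an edge the q vertices outside C can be exchanged independently of
    each other. *)
Definition star_group C := [set e in G | (C \subset e) &&
  [forall S : {set V}, (S \subset e :\: C) ==> kernel G (e :\: S)]].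

Definition star_body C := \bigcup_(e in star_group C) (e :\: C).

Lemma star_groupP C e : reflect [/\ e \in G, C \subset e &
   forall S : {set V}, S \subset e :\: C -> kernel G (e :\: S)] (e \in star_group C).
Proof.
rewrite inE; apply: (iffP and3P) => -[eG Ce h]; split=> //.
  by move=> S sS; have /implyP/(_ sS) := forallP h S.
by apply/forallP => S; apply/implyP/h.
Qed.

Lemma card_diff_center C e : #|C| = s -> e \in star_group C -> #|e :\: C| = q.
Proof.
move=> cC /star_groupP[eG Ce _]; rewrite cardsD (setIidPr Ce) (class_J_card eG) cC k_split.
by rewrite addKn.
Qed.

(** Both C and C + x are kernels, so |C :&: f| and |C :&: f| + 1 are
    admissible; this is possible only when the former is s. *)
Lemma star_body_edge C x f : #|C| = s -> x \in star_body C -> f \in G -> x \in f -> C \subset f.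
Proof.
move=> cC /bigcupP[e eS]; rewrite inE => /andP[xC xe] fG xf.
have [eG Ce ker] := star_groupP _ _ eS.
have k1 : kernel G C by have := ker _ (subxx _); rewrite setDDr setDv set0U (setIidPr Ce).
have k2 : kernel G (x |: C).
  have := ker (e :\: C :\ x) (subsetDl _ _); congr kernel.
  apply/setP => y; rewrite !inE; have [->|_] := eqVneq y x; first by rewrite xe.
  by case yC: (y \in C) => /=; rewrite ?(subsetP Ce _ yC) //; case: (y \in e).
have a1 := kernel_edge k1 fG; have := kernel_edge k2 fG.
have -> : (x |: C) :&: f = x |: (C :&: f).
  by apply/setP => y; rewrite !inE; case: eqVneq => [->|].
rewrite cardsU1 !inE (negPf xC) /= add1n => a2.
have [lt|ge] := ltnP #|C :&: f| s; last first.
  by apply/setIidPl/eqP; rewrite eqEcard subsetIl cC.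
have d1 := admissible_small a1 lt.
case/orP: a2 => [d2|ge]; first by have := dvdn_succF ht d1; rewrite d2.
have e1 : (#|C :&: f|).+1 = s by nat_lia.
by have := dvdn_succF ht d1; rewrite e1 t_dvd_s.
Qed.

(** An edge through v contains both centres; exchanging a vertex u of the
    second centre gives an edge through v without u, which contradicts
    [star_body_edge]. *)
Lemma star_bodies_disjoint C C' : #|C| = s -> #|C'| = s -> C != C' ->
  [disjoint star_body C & star_body C'].
Proof.
move=> cC cC' CC'; rewrite -setI_eq0; apply/set0Pn => -[v]; rewrite inE => /andP[vD vD'].
have [u uC' uC] : exists2 u, u \in C' & u \notin C.
  apply/subsetPn; apply: contra CC' => sC'.
  by rewrite eq_sym eqEcard sC' cC cC' leqnn.
have vC' : v \notin C' by case/bigcupP: vD' => e _; rewrite inE => /andP[].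
have vC : v \notin C by case/bigcupP: vD => e _; rewrite inE => /andP[].
case/bigcupP: (vD) => e eS; rewrite inE vC /= => ve.
have [eG Ce ker] := star_groupP _ _ eS.
have ue : u \in e by apply: (subsetP (star_body_edge cC' vD' eG ve)).
have /kernelP/(_ [set u]) : kernel G (e :\ u) by apply: ker; rewrite sub1set inE uC.
rewrite cards1 k_eq; case=> [|f [fG sf df]]; first by rewrite muln_gt0 (ltnW q_ge2) ltnW.
have vu : v != u by apply: contraNneq vC' => ->.
have vf : v \in f by apply: (subsetP sf); rewrite !inE vu.
have uf := subsetP (star_body_edge cC' vD' fG vf) u uC'.
by have := pred0P df u; rewrite /= !inE eqxx uf.
Qed.

(** A block through v lies in an edge in which v can be exchanged;
    intersecting with the resulting kernel would leave t - 1 vertices of the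
    block. *)
Lemma star_body_block C B : #|C| = s -> B \in blocks -> [disjoint B & star_body C].
Proof.
move=> cC BB; rewrite -setI_eq0; apply/set0Pn => -[v]; rewrite inE => /andP[vB vD].
case/bigcupP: (vD) => e eS; rewrite inE => /andP[vC ve].
have [eG Ce ker] := star_groupP _ _ eS.
have sBe : B \subset e.
  apply: block_edge_subset => //; apply/negP => d.
  by have := pred0P d v; rewrite /= vB ve.
have ke : kernel G (e :\ v) by apply: ker; rewrite sub1set inE vC.
move: BB; rewrite inE => /andP[/eqP cB kB].
have := kernel_kernel kB ke.
have -> : B :&: (e :\ v) = B :\ v.
  apply/setP => x; rewrite !inE; case xB: (x \in B); last by rewrite andbF.
  by rewrite (subsetP sBe _ xB).
have := cardsD1 v B; rewrite vB cB /= => cBv /admissible_small.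
have := t_le_s => ts /(_ ltac:(nat_lia)) d1.
by have := dvdn_succF ht d1; rewrite -add1n -cBv dvdnn.
Qed.

Lemma star_group_card C : #|C| = s -> #|star_group C| <= 'C(#|star_body C|, q).
Proof.
move=> cC; rewrite -cards_draws; apply: (@card_inj_le _ _ (fun e => e :\: C)).
  move=> e e' /star_groupP[_ Ce _] /star_groupP[_ Ce' _] /= ee'.
  by rewrite -(setID e C) -(setID e' C) ee' (setIidPr Ce) (setIidPr Ce').
move=> e eS; rewrite inE (card_diff_center cC eS) eqxx andbT.
exact: (bigcup_sup e).
Qed.

Definition star_edge e := [exists C : {set V}, (#|C| == s) && (e \in star_group C)].
Definition block_edge e := [forall v in e, [exists B in blocks, (v \in B) && (B \subset e)]].

Section Labelled.
Variable Y : {set {ffun 'I_k -> V}}.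
Hypothesis YG : forall x, x \in Y -> x @: setT \in G.

Lemma labelling_inj x : x \in Y -> injective x.
Proof.
move=> xY; have /imset_injP h : #|x @: setT| == #|[set: 'I_k]|.
  by rewrite (class_J_card (YG xY)) cardsT card_ord.
by move=> i j; apply: h; rewrite inE.
Qed.

Lemma homog_kernel J x : homog k Y J -> x \in Y -> kernel G (x @: J).
Proof.
move=> /forall_inP h xY; have /freeP fr := h x xY.
apply/kernelP => Z /fr[y [yY ag av]]; exists (y @: setT); split; first exact: YG.
  apply/subsetP => _ /imsetP[i iJ ->]; rewrite -(ag i iJ); exact: imset_f.
rewrite -setI_eq0; apply/set0Pn => -[v]; rewrite !inE => /andP[/andP[vJ /imsetP[i _ vi]] vZ].
have [iJ|/av] := boolP (i \in J); last by rewrite -vi vZ.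
by move: vJ; rewrite vi ag // imset_f.
Qed.

(** The labels J of an edge form a kernel contained in that edge. *)
Lemma homog_card J x : homog k Y J -> x \in Y -> admissible r t #|J|.
Proof.
move=> hJ xY; have xinj := labelling_inj xY.
have := kernel_edge (homog_kernel hJ xY) (YG xY).
rewrite (setIidPl _) ?imsetS ?subsetT // card_imset //.
Qed.

(** The complements of the homogeneous sets satisfy the hypotheses of
    [union_closed_classification]: sizes are admissible, and k = s + q turns
    sizes at least s into complements of size at most q. *)
Lemma covering_good x : covering k (r * t) Y -> x \in Y ->
  star_edge (x @: setT) || block_edge (x @: setT).
Proof.
move=> /forallP cov xY; have xinj := labelling_inj xY.
have := @union_closed_classification _ q t [set A | homog k Y (~: A)].
case.
- exact: q_ge2.
- exact: ht.
- by rewrite dvdn_mull.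
- by rewrite card_ord k_eq.
- by rewrite inE setC0 homog_setT.
- by move=> A B; rewrite !inE setCU; apply: homogI.
- move=> A; rewrite inE => hA; have := homog_card hA xY.
  have := cardsC A; rewrite card_ord => cA; case/orP => [d|ge].
    by right; rewrite -(dvdn_addl _ d) cA t_dvd_k.
  by left; have := k_split; nat_lia.
- move=> S cS.
  have [|S' sS' cS'] := @exists_subset_card _ (~: S) (q.-1 - #|S|).
    by have := cardsC S; have := k_split; rewrite card_ord; nia.
  have /implyP := cov (S :|: S').
  have -> : #|S :|: S'| == q.-1.
    rewrite cardsU cS'; have -> : S :&: S' = set0.
      apply/eqP; rewrite setI_eq0 disjoint_sym disjoints_subset //.
    rewrite cards0; nat_lia.
  move=> /(_ isT)/existsP[J /and3P[hJ JT sJ]]; exists (~: J).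
  rewrite inE setCK hJ; split=> //.
    by apply: contra JT => /eqP/(congr1 (@setC _)); rewrite setCK setC0 => ->.
  rewrite disjoint_sym disjoints_subset setCK.
  by apply: subset_trans sJ; apply: subsetUl.
- case=> Q cQ hQ; apply/orP; left; apply/existsP; exists (x @: (~: Q)).
  rewrite card_imset //.
  have -> : #|~: Q| == s.
    by have := cardsC Q; have := k_split; rewrite card_ord; nat_lia.
  rewrite /=; apply/star_groupP; split; [exact: YG|exact: imsetS (subsetT _)|].
  move=> S sS; have -> : x @: setT :\: S = x @: (~: (x @^-1: S)).
    apply/setP => v; rewrite inE; apply/andP/imsetP => [[vS /imsetP[i _ vi]]|[i]].
      by exists i => //; rewrite !inE -vi.
    by rewrite !inE => iS ->; rewrite imset_f.
  apply: homog_kernel xY; have := hQ (x @^-1: S); rewrite inE; apply.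
  apply/subsetP => i; rewrite inE => /(subsetP sS); rewrite inE => /andP[+ _].
  by apply: contraR => iQ; rewrite imset_f // inE.
- case=> B hB; apply/orP; right; apply/forall_inP => _ /imsetP[i _ ->].
  apply/exists_inP; have [iB cB] := hB i; rewrite inE setCK => hom _.
  exists (x @: B i).
    by rewrite inE card_imset // cB eqxx; apply: homog_kernel.
  by rewrite imset_f // imsetS ?subsetT.
Qed.

End Labelled.

Lemma exists_labelling e : #|e| = k -> exists x : {ffun 'I_k -> V}, x @: setT = e.
Proof.
move=> ce; exists [ffun i => enum_val (cast_ord (esym ce) i)].
apply/setP => v; apply/imsetP/idP => [[i _ ->]|ve]; first by rewrite ffunE enum_valP.
exists (cast_ord ce (enum_rank_in ve v)) => //.
by rewrite ffunE cast_ordK enum_rankK_in.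
Qed.

Definition bad_edges := [set e in G | ~~ (star_edge e || block_edge e)].

Variable W : {set V}.
Hypothesis GW : forall e, e \in G -> e \subset W.

(** A covering subfamily of the labelled bad edges would contain a bad edge
    that is good. *)
Lemma bad_edges_card : #|bad_edges| <= bad_const k k * #|W| ^ q.-1.
Proof.
pose X := [set x : {ffun 'I_k -> V} | x @: setT \in bad_edges].
have XG x : x \in X -> x @: setT \in G by rewrite !inE => /andP[].
apply: (@leq_trans #|X|).
  apply: leq_trans (leq_imset_card (fun x : {ffun 'I_k -> V} => x @: setT) X).
  apply: subset_leq_card; apply/subsetP => e eb.
  have [x xe] := @exists_labelling e ltac:(by apply: class_J_card; move: eb; rewrite inE => /andP[]).
  by apply/imsetP; exists x => //; rewrite inE xe.
apply: no_covering_card.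
- by rewrite k_eq; nia.
- by move=> x i /XG /GW /subsetP; apply; apply: imset_f.
- move=> Y /subsetP sY /set0Pn[x xY]; apply/negP => cov.
  have := sY x xY; rewrite !inE => /andP[_ /negP[]].
  by apply: covering_good cov xY => y /sY /XG.
Qed.

Theorem decomposition_card : #|G| <= 'C(#|blocks|, q) +
   \sum_(C : {set V} | #|C| == s) #|star_group C| + bad_const k k * #|W| ^ q.-1.
Proof.
have cover : G \subset [set e in G | block_edge e] :|:
    (\bigcup_(C : {set V} | #|C| == s) star_group C) :|: bad_edges.
  apply/subsetP => e eG; rewrite !inE eG /=.
  have [//|_] := boolP (block_edge e); rewrite orbF /=.
  have [/existsP[C /andP[cC eC]]|_] := boolP (star_edge e); last by rewrite orbT.
  by rewrite orbF; apply/bigcupP; exists C.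
rewrite (leq_trans (subset_leq_card cover)) // (leq_trans (leq_card_setU _ _)) //.
rewrite leq_add ?bad_edges_card // (leq_trans (leq_card_setU _ _)) //.
rewrite leq_add ?card_bigcup_le //.
apply: (@block_unions_card _ q t); first by nat_lia.
- by move=> B; rewrite inE => /andP[/eqP].
- exact: blocks_disjoint.
- by move=> e; rewrite inE => /andP[/class_J_card-> _]; rewrite k_eq.
- move=> e v; rewrite inE => /andP[_ /forall_inP h] /h /exists_inP[B BB /andP[vB Be]].
  by exists B.
Qed.

Lemma block_sub B : B \in blocks -> B \subset W.
Proof.
rewrite inE => /andP[_ /kernelP/(_ set0)]; rewrite cards0 => /(_ isT)[f [fG Bf _]].
exact: subset_trans Bf (GW fG).
Qed.

Lemma star_body_sub C : star_body C \subset W.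
Proof.
apply/bigcupsP => e /star_groupP[eG _ _].
by apply: subset_trans (GW eG); apply: subsetDl.
Qed.

(** Blocks and star bodies compete for the vertices; this is what makes the
    terms of [decomposition_card] add up to at most one binomial coefficient. *)
Theorem decomposition_space :
  t * #|blocks| + \sum_(C : {set V} | #|C| == s) #|star_body C| <= #|W|.
Proof.
have -> : t * #|blocks| = #|\bigcup_(B in blocks) B|.
  rewrite -sum_card_disjoint; last exact: blocks_disjoint.
  rewrite (eq_bigr (fun=> t)); last by move=> B; rewrite inE => /andP[/eqP].
  by rewrite sum_nat_const mulnC.
rewrite sum_card_disjoint; last first.
  by move=> C C' /eqP cC /eqP cC'; apply: star_bodies_disjoint.
set U1 := \bigcup_(B in _) _; set U2 := \bigcup_(C | _) _.
have d : U1 :&: U2 = set0.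
  apply/eqP/set0Pn => -[v]; rewrite inE => /andP[/bigcupP[B BB vB] /bigcupP[C /eqP cC vC]].
  by have := pred0P (star_body_block cC BB) v; rewrite /= vB vC.
have -> : #|U1| + #|U2| = #|U1 :|: U2| by rewrite cardsU d cards0 subn0.
apply: subset_leq_card; rewrite subUset; apply/andP; split.
  by apply/bigcupsP => B; apply: block_sub.
by apply/bigcupsP => C _; apply: star_body_sub.
Qed.

End Kernels.

(** * Heavy pairs and peeling *)

(** The factor 2^q is an addition to the constant in the definition of a heavy
    star: it makes the pair (C, P) heavy inside a star with up to 2|P| body
    vertices. *)
Definition heavy_factor := 2 * r ^ 2 * t ^ 3 * 2 ^ (r * t).

Lemma heavy_factor_gt : k < heavy_factor.
Proof.
rewrite /heavy_factor.
have h1 : 0 < 2 ^ (r * t) by rewrite expn_gt0.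
have h2 : r * t ^ 2 < 2 * r ^ 2 * t ^ 3.
  rewrite (_ : 2 * r ^ 2 * t ^ 3 = (r * t ^ 2) * (2 * r * t)); last first.
    by rewrite !expnS !expn0; nia.
  have p1 : 0 < r * t ^ 2 by rewrite muln_gt0 expn_gt0; nat_lia.
  have p2 : 1 < 2 * r * t by nia.
  by rewrite ltn_Pmulr.
by apply: leq_trans h2 _; rewrite leq_pmulr.
Qed.

Local Notation A := heavy_factor.
Local Notation K := (bad_const k k).

Section HeavyPairs.
Variable V : finType.
Implicit Types (e f C P U Z : {set V}) (v u : V).
Variable E : {set {set V}}.
Hypothesis EJ : class_J r t E.

Definition star_in C P := [set e in E | (C \subset e) && (e \subset C :|: P)].

Lemma star_inP C P e : reflect [/\ e \in E, C \subset e & e \subset C :|: P]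
  (e \in star_in C P).
Proof. by rewrite inE; apply: and3P. Qed.

Lemma star_in_sub C P U : P \subset U -> star_in C P \subset star_in C U.
Proof.
move=> sPU; apply/subsetP => e /star_inP[eE Ce eCP]; apply/star_inP; split=> //.
exact: subset_trans eCP (setUS _ sPU).
Qed.

Definition star_deg C P v := degree (star_in C P) v.

(** All edges considered lie between C and C + P, and P plays the role of the
    body of a heavy star. *)
Definition heavy_pair C P := [&& #|C| == s, [disjoint C & P], P != set0 &
  [forall v in P, A * #|P| ^ (q - 2) <= star_deg C P v]].

Lemma star_in_card C P : #|C| = s -> #|star_in C P| <= 'C(#|P|, q).
Proof.
move=> cC; have -> : q = k - #|C| by rewrite cC (k_split) addKn.
by apply: card_edges_through => e /star_inP[eE Ce eCP]; rewrite (class_J_card EJ eE).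
Qed.

Lemma star_in_card_through C P (X : {set V}) j : #|C| = s -> X \subset P -> [disjoint C & P] ->
  #|X| = j -> #|[set e in star_in C P | X \subset e]| <= #|P| ^ (q - j).
Proof.
move=> cC XP dCP cX; have -> : q - j = k - #|C :|: X|.
  rewrite cardsU cC cX; have -> : C :&: X = set0.
    by apply/eqP; rewrite setI_eq0; apply: disjointWr dCP.
  by rewrite cards0 (k_split); nat_lia.
apply: leq_trans (bin_le_exp _ _).
apply: card_edges_through => e; rewrite inE => /andP[/star_inP[eE Ce eCP] Xe].
rewrite (class_J_card EJ eE) subUset Ce Xe; split=> //.
by apply: subset_trans eCP _; rewrite setSU ?subsetUl.
Qed.

Lemma star_deg_le C P v : #|C| = s -> [disjoint C & P] -> v \in P ->
  star_deg C P v <= #|P| ^ (q - 1).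
Proof.
move=> cC dCP vP; have := @star_in_card_through C P [set v] 1 cC _ dCP (cards1 v).
rewrite sub1set => /(_ vP); apply: leq_trans; apply: subset_leq_card.
by apply/subsetP => e; rewrite inE => /andP[eS ve]; rewrite inE eS sub1set.
Qed.

Lemma heavy_pairP C P : reflect [/\ #|C| = s, [disjoint C & P], P != set0 &
    forall v, v \in P -> A * #|P| ^ (q - 2) <= star_deg C P v] (heavy_pair C P).
Proof.
apply: (iffP and4P) => -[h1 h2 h3 h4]; split=> //; first exact/eqP.
- exact/forall_inP.
- exact/eqP.
- exact/forall_inP.
Qed.

Lemma heavy_pair_card C P : heavy_pair C P -> A <= #|P|.
Proof.
case/heavy_pairP => cC dCP /set0Pn[v vP] /(_ v vP) h.
have := leq_trans h (star_deg_le cC dCP vP).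
have -> : q - 1 = (q - 2).+1 by have := q_ge2; nat_lia.
rewrite expnSr [_ ^ _ * _]mulnC leq_pmul2r // expn_gt0.
by rewrite card_gt0; case: set0Pn => // -[]; exists v.
Qed.

(** Edges through v and another vertex of Z number at most k |P|^(q-2), which
    is less than the degree of v. *)
Lemma heavy_pair_avoid C P v Z : heavy_pair C P -> v \in P -> #|Z| <= k ->
  exists e, [/\ e \in star_in C P, v \in e & e :&: Z \subset v |: C].
Proof.
move=> hp vP cZ; have [cC dCP _ /(_ v vP) h] := heavy_pairP _ _ hp.
have Ppos : 0 < #|P| by rewrite card_gt0; apply/set0Pn; exists v.
pose bad := \bigcup_(u in Z :&: P :\ v) [set e in star_in C P | [set v; u] \subset e].
have cbad : #|bad| <= k * #|P| ^ (q - 2).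
  apply: leq_trans (card_bigcup_le_const (n := #|P| ^ (q - 2)) _) _.
    move=> u; rewrite !inE => /and3P[uv uZ uP].
    by apply: star_in_card_through; rewrite ?subUset ?sub1set ?vP ?uP // cards2 eq_sym uv.
  rewrite leq_mul2r; apply/orP; right; apply: leq_trans cZ.
  by apply: subset_leq_card; apply/subsetP => u; rewrite !inE => /and3P[].
have lt : #|bad| < #|[set e in star_in C P | v \in e]|.
  apply: leq_ltn_trans cbad _; apply: leq_trans h; rewrite ltn_pmul2r ?heavy_factor_gt //.
  by rewrite expn_gt0 Ppos.
have /subsetPn[e] : ~~ ([set e in star_in C P | v \in e] \subset bad).
  by apply: contraL lt => /subset_leq_card; rewrite -leqNgt.
rewrite inE => /andP[eS ve] ebad; exists e; split=> //.
apply/subsetP => u; rewrite !inE => /andP[ue uZ]; apply: contraR ebad.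
rewrite negb_or => /andP[uv uC]; apply/bigcupP; exists u.
  rewrite !inE uv uZ /=; have [_ _ /subsetP/(_ u ue)] := star_inP _ _ _ eS.
  by rewrite inE (negPf uC).
by rewrite inE eS subUset !sub1set ve ue.
Qed.

Lemma heavy_pair_edge_exists C P : heavy_pair C P -> exists e, e \in star_in C P.
Proof.
move=> hp; have [_ _ /set0Pn[v vP] _] := heavy_pairP _ _ hp.
have [|e [eS _ _]] := heavy_pair_avoid (Z := set0) hp vP; first by rewrite cards0.
by exists e.
Qed.

Lemma admissible_succ n : admissible r t n -> admissible r t n.+1 -> n <= s -> n = s.
Proof.
move=> a1 a2 le; apply/eqP; rewrite eqn_leq le leqNgt; apply/negP => lt.
have d1 := admissible_small a1 lt.
have [eq_s|ne_s] := eqVneq n.+1 s.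
  by have := dvdn_succF ht d1; rewrite eq_s t_dvd_s.
by have := dvdn_succF ht d1; rewrite (admissible_small a2) // ltn_neqAle ne_s lt.
Qed.

(** Choose edges of the star that meet e outside C in v only and not at all,
    respectively. They show that |C :&: e| + 1 and |C :&: e| are both
    admissible, which forces |C :&: e| = s. *)
Lemma heavy_pair_edge C P e : heavy_pair C P -> e \in E -> ~~ [disjoint P & e] -> C \subset e.
Proof.
move=> hp eE; rewrite -setI_eq0 => /set0Pn[v]; rewrite inE => /andP[vP ve].
have [cC dCP _ _] := heavy_pairP _ _ hp.
have ce := class_J_card EJ eE.
have vC : v \notin C by have := pred0P dCP v; rewrite /= vP andbT => ->.
have [f1 [/star_inP[f1E Cf1 _] vf1 d1]] := heavy_pair_avoid hp vP (eq_leq ce).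
have [v' v'P v'e] : exists2 v', v' \in P & v' \notin e.
  apply/subsetPn; apply/negP => /subset_leq_card; rewrite ce leqNgt.
  by rewrite (leq_trans heavy_factor_gt (heavy_pair_card hp)).
have [f2 [/star_inP[f2E Cf2 _] vf2 d2]] := heavy_pair_avoid hp v'P (eq_leq ce).
have i1 : f1 :&: e = v |: (C :&: e).
  apply/setP => u; apply/idP/idP; last first.
    by rewrite !inE => /orP[/eqP->|/andP[uC ->]]; rewrite ?vf1 ?ve // (subsetP Cf1).
  move=> uI; have := subsetP d1 u uI; move: uI.
  by rewrite !inE => /andP[_ ->]; rewrite andbT.
have i2 : f2 :&: e = C :&: e.
  apply/setP => u; apply/idP/idP; last first.
    by rewrite !inE => /andP[uC ->]; rewrite (subsetP Cf2).
  move=> uI; have := subsetP d2 u uI; move: uI.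
  rewrite !inE => /andP[_ ue]; rewrite ue andbT => /orP[/eqP uv'|//].
  by rewrite -uv' ue in v'e.
have a1 := class_J_inter EJ f2E eE; have := class_J_inter EJ f1E eE.
rewrite i2 in a1; rewrite i1 cardsU1 !inE (negPf vC) /= add1n => a2.
apply/setIidPl/eqP; rewrite eqEcard subsetIl cC /= eq_leq //.
by apply/esym/admissible_succ => //; rewrite -cC subset_leq_card ?subsetIl.
Qed.

Lemma heavy_pair_body_center C P C' P' : heavy_pair C P -> heavy_pair C' P' ->
  C != C' -> [disjoint P & C'].
Proof.
move=> hp hp' CC'; rewrite -setI_eq0; apply/set0Pn => -[v]; rewrite inE => /andP[vP vC'].
have [cC _ _ _] := heavy_pairP _ _ hp; have [cC' _ _ _] := heavy_pairP _ _ hp'.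
have [u uC uC'] : exists2 u, u \in C & u \notin C'.
  apply/subsetPn; apply: contra CC' => sC.
  by rewrite eqEcard sC cC cC' leqnn.
have [v'] : exists v', v' \in P' :\ u.
  apply/set0Pn; rewrite -card_gt0; have := heavy_pair_card hp'; have := heavy_factor_gt.
  have := cardsD1 u P'; have : (u \in P') <= 1 by case: (_ \in _).
  by have := k_split; have := q_ge2; nat_lia.
rewrite !inE => /andP[v'u v'P'].
have [|e [/star_inP[eE C'e _] v'e /subsetP d]] := heavy_pair_avoid (Z := [set u]) hp' v'P'.
  by rewrite cards1 (k_split); have := q_ge2; nat_lia.
have ue : u \in e.
  apply: (subsetP (heavy_pair_edge hp eE _)) => //.
  by apply/negP => dPe; have := pred0P dPe v; rewrite /= vP (subsetP C'e).
by have := d u; rewrite !inE ue eqxx (negPf uC') orbF eq_sym (negPf v'u) => /(_ isT).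
Qed.

Lemma heavy_pair_bodies_disjoint C P C' P' : heavy_pair C P -> heavy_pair C' P' ->
  C != C' -> [disjoint P & P'].
Proof.
move=> hp hp' CC'; rewrite -setI_eq0; apply/set0Pn => -[v]; rewrite inE => /andP[vP vP'].
have [cC _ _ _] := heavy_pairP _ _ hp; have [cC' dC'P' _ _] := heavy_pairP _ _ hp'.
have [u uC' uC] : exists2 u, u \in C' & u \notin C.
  apply/subsetPn; apply: contra CC' => sC.
  by rewrite eq_sym eqEcard sC cC cC' leqnn.
have uv : u != v.
  by apply: contraTneq vP' => <-; have := pred0P dC'P' u; rewrite /= uC' => /= ->.
have [|e [/star_inP[eE Ce _] ve /subsetP d]] := heavy_pair_avoid (Z := [set u]) hp vP.
  by rewrite cards1 (k_split); have := q_ge2; nat_lia.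
have ue : u \in e.
  apply: (subsetP (heavy_pair_edge hp' eE _)) => //.
  by apply/negP => dPe; have := pred0P dPe v; rewrite /= vP' ve.
by have := d u; rewrite !inE ue eqxx (negPf uC) orbF (negPf uv) => /(_ isT).
Qed.

(** Two edges of the pairs meet exactly in the intersection of the centres,
    which has less than s vertices. *)
Lemma heavy_pair_centers C P C' P' : heavy_pair C P -> heavy_pair C' P' ->
  C != C' -> t %| #|C :&: C'|.
Proof.
move=> hp hp' CC'; have C'C : C' != C by rewrite eq_sym.
have [cC _ _ _] := heavy_pairP _ _ hp; have [cC' _ _ _] := heavy_pairP _ _ hp'.
have [e /star_inP[eE Ce eCP]] := heavy_pair_edge_exists hp.
have [e' /star_inP[e'E Ce' eCP']] := heavy_pair_edge_exists hp'.
have := class_J_inter EJ eE e'E; have -> : e :&: e' = C :&: C'.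
  apply/eqP; rewrite eqEsubset; apply/andP; split; last exact: setISS.
  apply/subsetP => x.
  rewrite !inE => /andP[/(subsetP eCP) + /(subsetP eCP')]; rewrite !inE.
  have := pred0P (heavy_pair_body_center hp hp' CC') x.
  have := pred0P (heavy_pair_body_center hp' hp C'C) x.
  have := pred0P (heavy_pair_bodies_disjoint hp hp' CC') x; rewrite /=.
  by case: (x \in C); case: (x \in P); case: (x \in P'); case: (x \in C').
have le_s : #|C :&: C'| <= s by rewrite -cC subset_leq_card ?subsetIl.
move=> a; apply: (admissible_small a); rewrite ltn_neqAle le_s andbT.
apply: contra CC' => /eqP cI; have sC : C \subset C'.
  by apply/setIidPl/eqP; rewrite eqEcard subsetIl cC cI leqnn.
by rewrite eqEcard sC cC cC' leqnn.
Qed.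

Variable th : nat.

Definition peel_good C U := [disjoint C & U] && [forall v in U, th <= star_deg C U v].

(** The largest U such that all its vertices have degree at least th between C
    and C + U. *)
Definition peel C := \bigcup_(U | peel_good C U) U.

Lemma star_deg_sub C P U v : P \subset U -> star_deg C P v <= star_deg C U v.
Proof.
move=> sPU; apply: subset_leq_card; apply/subsetP => e; rewrite inE => /andP[eS ve].
by rewrite inE ve andbT; apply: (subsetP (star_in_sub C sPU)).
Qed.

Lemma peel_goodP C : peel_good C (peel C).
Proof.
apply/andP; split.
  rewrite -setI_eq0; apply/set0Pn => -[v]; rewrite inE => /andP[vC /bigcupP[U /andP[dU _] vU]].
  by have := pred0P dU v; rewrite /= vC vU.
apply/forall_inP => v /bigcupP[U gU vU]; case/andP: (gU) => _ /forall_inP/(_ v vU) h.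
by apply: leq_trans h (star_deg_sub _ _ _); apply: (bigcup_sup U).
Qed.

Lemma peel_disjoint C : [disjoint C & peel C].
Proof. by case/andP: (peel_goodP C). Qed.

Lemma peel_deg C v : v \in peel C -> th <= star_deg C (peel C) v.
Proof. by case/andP: (peel_goodP C) => _ /forall_inP; apply. Qed.

(** Deleting vertices of degree less than th one by one reaches the largest
    good set. *)
Lemma peel_count C U : #|C| = s -> peel C \subset U -> [disjoint C & U] ->
  #|star_in C U| <= 'C(#|peel C|, q) + th * #|U :\: peel C|.
Proof.
move=> cC; move En: #|_ :\: _| => n; elim: n U En => [|n IH] U En sU dU.
  have -> : U = peel C.
    by apply/eqP; rewrite eqEsubset sU -setD_eq0 -cards_eq0 En.
  by rewrite muln0 addn0 star_in_card.
have [v vU vdeg] : exists2 v, v \in U & star_deg C U v < th.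
  have : ~~ peel_good C U.
    apply/negP => gU; have sUP : U \subset peel C by apply: (bigcup_sup U).
    by move: En; have /eqP -> : U :\: peel C == set0; rewrite ?setD_eq0 ?cards0.
  rewrite negb_and dU /= negb_forall_in => /exists_inP[v vU].
  by rewrite -ltnNge => h; exists v.
have vP : v \notin peel C.
  apply/negP => vP; have := peel_deg vP; have := star_deg_sub C v sU; nat_lia.
have sUv : peel C \subset U :\ v.
  by apply/subsetP => x xP; rewrite inE (subsetP sU) // andbT inE; apply: contraNneq vP => <-.
have cUv : #|(U :\ v) :\: peel C| = n.
  apply/eqP; rewrite -eqSS -En (cardsD1 v (U :\: peel C)) inE vP vU add1n eqSS.
  by apply/eqP; apply: eq_card => x; rewrite !inE andbCA.
have := IH _ cUv sUv (disjointWr (subsetDl _ _) dU).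
have : #|star_in C U| <= #|star_in C (U :\ v)| + star_deg C U v.
  apply: leq_trans (leq_card_setU _ _); apply: subset_leq_card; apply/subsetP => e.
  move=> eS; rewrite inE; have [eE Ce eCU] := star_inP _ _ _ eS.
  have [ve|ve] := boolP (v \in e); first by rewrite [X in _ || X]inE eS ve orbT.
  apply/orP; left; apply/star_inP; split=> //; apply/subsetP => x xe.
  have := subsetP eCU x xe; rewrite !inE => /orP[->//|->]; rewrite andbT.
  by apply/orP; right; apply: contraNneq ve => <-.
rewrite mulnS; nat_lia.
Qed.

Lemma peel_heavy C : #|C| = s -> peel C != set0 -> A * #|peel C| ^ (q - 2) <= th ->
  heavy_pair C (peel C).
Proof.
move=> cC P0 Ath; apply/heavy_pairP; split=> //; first exact: peel_disjoint.
by move=> v /peel_deg; apply: leq_trans.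
Qed.

End HeavyPairs.

(** * Disjoint truncated stars as competitors *)

Lemma class_J_sub (V : finType) (G G' : {set {set V}}) :
  G' \subset G -> class_J r t G -> class_J r t G'.
Proof.
move=> /subsetP sG /andP[/forall_inP h1 /forall_inP h2]; apply/andP; split.
  by apply/forall_inP => e /sG /h1.
apply/forall_inP => e /sG /h2 /forall_inP h; apply/forall_inP => f /sG; exact: h.
Qed.

Lemma exists_star (V : finType) (U : {set V}) a D : a + s <= #|U| ->
  exists G : {set {set V}}, [/\ class_J r t G, forall e, e \in G -> e \subset U
    & #|G| = minn D 'C(a, q)].
Proof.
move=> aU; have [|C sC cC] := @exists_subset_card _ U s; first by nat_lia.
have [|P sP cP] := @exists_subset_card _ (U :\: C) a.
  by rewrite cardsD (setIidPr sC); nat_lia.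
pose Qs := [set Q : {set V} | (Q \subset P) && (#|Q| == q)].
have disC Q : Q \in Qs -> C :&: Q = set0.
  rewrite inE => /andP[sQ _]; apply/eqP; rewrite setI_eq0 disjoint_sym.
  apply: disjointWl (subset_trans sQ sP) _; rewrite -setI_eq0.
  by apply/eqP/setP => x; rewrite !inE; case: (x \in C); rewrite ?andbF.
pose full := [set C :|: Q | Q in Qs].
have cfull : #|full| = 'C(a, q).
  rewrite card_in_imset ?cards_draws ?cP // => Q Q' hQ hQ' e.
  have h X : X \in Qs -> (C :|: X) :\: C = X.
    by move=> /disC XC; rewrite setDUl setDv set0U; apply/setDidPl; rewrite disjoint_sym -setI_eq0 XC.
  by rewrite -(h Q hQ) -(h Q' hQ') e.
have [|G sG cG] := @exists_subset_card _ full (minn D 'C(a, q)).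
  by rewrite cfull geq_minr.
exists G; split=> //.
  apply/andP; split; apply/forall_inP => e /(subsetP sG)/imsetP[Q hQ ->].
    rewrite cardsU disC // cards0 subn0 cC; move: hQ; rewrite inE => /andP[_ /eqP->].
    by rewrite (k_split).
  apply/forall_inP => f /(subsetP sG)/imsetP[Q' hQ' ->].
  rewrite /admissible; apply/orP; right; rewrite -{1}cC subset_leq_card //.
  by rewrite subsetI !subsetUl.
move=> e /(subsetP sG)/imsetP[Q]; rewrite inE => /andP[sQ _] ->.
rewrite subUset sC; apply: subset_trans sQ _; apply: subset_trans sP _; exact: subsetDl.
Qed.

Lemma competitor (V : finType) (l : seq nat) (U : {set V}) D :
  \sum_(a <- l) (a + s) <= #|U| ->
  exists G : {set {set V}}, [/\ class_J r t G, forall e, e \in G -> e \subset U,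
    (forall v, degree G v <= D) & #|G| = \sum_(a <- l) minn D 'C(a, q)].
Proof.
elim: l U => [|a l IH] U.
  move=> _; exists set0; split.
  - by apply/andP; split; apply/forall_inP => e; rewrite inE.
  - by move=> e; rewrite inE.
  - by move=> v; rewrite /degree (_ : [set _ in _ | _] = set0) ?cards0 //; apply/setP => e; rewrite !inE.
  - by rewrite cards0 big_nil.
rewrite big_cons => le; have [|U1 sU1 cU1] := @exists_subset_card _ U (a + s); first by nat_lia.
have [|G1 [J1 in1 c1]] := @exists_star _ U1 a D; first by rewrite cU1.
have [|G2 [J2 in2 deg2 c2]] := IH (U :\: U1).
  by rewrite cardsD (setIidPr sU1); nat_lia.
have dis e f : e \in G1 -> f \in G2 -> e :&: f = set0.
  move=> /in1 eU /in2 fU; apply/eqP; rewrite -subset0.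
  apply: subset_trans (setISS eU fU) _; apply/subsetP => x.
  by rewrite !inE; case: (x \in U1).
have G12 e : e \in G1 -> e \in G2 -> False.
  move=> e1 e2; have := dis e e e1 e2; rewrite setIid => e0.
  have := class_J_card J1 e1; rewrite e0 cards0 (k_split); have := q_ge2; nat_lia.
exists (G1 :|: G2); split.
- apply/andP; split.
    by apply/forall_inP => e /setUP[/(class_J_card J1)->|/(class_J_card J2)->].
  apply/forall_inP => e eG; apply/forall_inP => f fG.
  case/setUP: eG => eG; case/setUP: fG => fG.
  + exact: class_J_inter J1 _ _ eG fG.
  + by rewrite dis // cards0 /admissible dvdn0.
  + by rewrite setIC dis // cards0 /admissible dvdn0.
  + exact: class_J_inter J2 _ _ eG fG.
- move=> e /setUP[/in1 h|/in2 h]; first exact: subset_trans h sU1.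
  by apply: subset_trans h (subsetDl _ _).
- move=> v; have [vU1|vU1] := boolP (v \in U1).
    have le1 : #|G1| <= D by rewrite c1 geq_minl.
    apply: leq_trans le1.
    apply: subset_leq_card; apply/subsetP => e; rewrite !inE => /andP[/orP[//|e2] ve].
    by have := subsetP (in2 e e2) v ve; rewrite inE vU1.
  rewrite (leq_trans _ (deg2 v)) //.
  apply: subset_leq_card; apply/subsetP => e; rewrite !inE => /andP[/orP[e1|->] ve] //.
  by have := subsetP (in1 e e1) v ve; rewrite (negPf vU1).
- rewrite cardsU big_cons c1 c2 (_ : G1 :&: G2 = set0) ?cards0 ?subn0 //.
  by apply/setP => e; rewrite !inE; apply/negP => /andP[]; apply: G12.
Qed.

(** Each truncated star has at most D - 1 edges and the stars are disjoint, so
    that the maximum degree is less than D; with m edges or more this would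
    contradict the minimality of D. *)
Lemma extremal_competitor (V : finType) (E : {set {set V}}) n m l :
  extremal r t n m E -> 0 < max_degree E ->
  \sum_(a <- l) (a + s) <= n ->
  \sum_(a <- l) minn (max_degree E).-1 'C(a, q) < m.
Proof.
move=> [_ _ _ Dmin] D0 le; rewrite ltnNge; apply/negP => mle.
have [|G [J _ deg c]] := @competitor 'I_n l setT (max_degree E).-1; first by rewrite cardsT card_ord.
have [|G' sG' cG'] := @exists_subset_card _ G m; first by rewrite c.
have : max_degree G' <= (max_degree E).-1.
  apply/bigmax_leqP => v _; apply: leq_trans (deg v).
  by apply: subset_leq_card; apply/subsetP => e; rewrite !inE => /andP[/(subsetP sG')->].
have : max_degree E <= max_degree G'.
  rewrite Dmin; apply: (@bigmin_le _ _ _ (fun E0 => max_degree E0) m G').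
    by rewrite mem_index_enum.
  by rewrite cG' eqxx andbT; apply: class_J_sub J.
nat_lia.
Qed.

(** * Cores of an extremal hypergraph *)

Section Config.

(** The blocks and bodies in [decomposition_space] share w vertices, and
    binomial coefficients are superadditive. *)
Lemma J_card_le (V : finType) (G : {set {set V}}) (W : {set V}) : class_J r t G ->
  (forall e, e \in G -> e \subset W) -> #|G| <= 'C(#|W|, q) + K * #|W| ^ (q - 1).
Proof.
move=> GJ GW; apply: leq_trans (decomposition_card GJ GW) _.
rewrite -[q.-1]subn1 leq_add2r.
have sp := decomposition_space GJ GW.
have q0 : 0 < q by have := q_ge2; nat_lia.
apply: (@leq_trans ('C(#|blocks G|, q) + 'C(\sum_(C : {set V} | #|C| == s) #|star_body G C|, q))).
  rewrite leq_add2l; apply: leq_trans (bin_sum_le _ _ _ q0).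
  by apply: leq_sum => C /eqP cC; apply: star_group_card.
apply: leq_trans (bin_superadd _ _ q0) _; apply: leq_bin2l.
apply: leq_trans sp; rewrite leq_add2r leq_pmull //; nat_lia.
Qed.

Variables (V : finType) (E : {set {set V}}) (n : nat).
Hypotheses (EJ : class_J r t E) (cV : #|V| = n).
Local Notation D := (max_degree E).

Local Notation th := (A * n ^ (q - 2)).

Implicit Types (C : {set V}) (M : {set {set V}}).

(** The threshold does not depend on the size of the core; it is at least the
    one required of a heavy pair because the core has at most n vertices. *)
Definition core_of C := peel E th C.
Local Notation P := core_of.

Definition centers M := forall C, C \in M -> #|C| = s /\ P C != set0.

Lemma core_heavy M C : centers M -> C \in M -> heavy_pair E C (P C).
Proof.
move=> hM CM; have [cC P0] := hM C CM; apply: peel_heavy => //.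
by rewrite leq_mul2l leq_exp ?orbT // -cV max_card.
Qed.

Definition outside M := ~: \bigcup_(C in M) P C.
(** The edges that contain none of the centres in M. For centres of nonempty
    cores they avoid all cores. *)
Definition loose M := [set e in E | [forall C in M, ~~ (C \subset e)]].
Definition star_of C := [set e in E | C \subset e].

Lemma cores_card M : centers M -> \sum_(C in M) #|P C| + #|outside M| = n.
Proof.
move=> hM; rewrite sum_card_disjoint ?cardsC //.
move=> C C' CM C'M; apply: (heavy_pair_bodies_disjoint EJ).
  exact: core_heavy hM CM.
exact: core_heavy hM C'M.
Qed.

Lemma loose_sub M e : centers M -> e \in loose M -> e \subset outside M.
Proof.
move=> hM; rewrite inE => /andP[eE /forall_inP h]; apply/subsetP => v ve.
rewrite inE; apply/bigcupP => -[C CM vP]; have := h C CM.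
rewrite (heavy_pair_edge EJ (core_heavy hM CM) eE) //.
by apply/negP => d; have := pred0P d v; rewrite /= vP ve.
Qed.

Lemma loose_J M : class_J r t (loose M).
Proof. by apply: class_J_sub EJ; apply/subsetP => e; rewrite inE => /andP[]. Qed.

Lemma star_of_card_le C : #|C| = s -> #|star_of C| <= D.
Proof.
move=> cC; have [v vC] : exists v, v \in C.
  by apply/set0Pn; rewrite -card_gt0 cC (leq_trans (ltnW ht)) ?t_le_s.
apply: leq_trans (leq_bigmax v); apply: subset_leq_card; apply/subsetP => e.
by rewrite !inE => /andP[-> /subsetP->].
Qed.

(** Edges through C that also meet another core contain its centre too. The
    two centres differ in at least t vertices, hence at least 2, so that this
    happens at most n^(q-2) times for each core. The other edges lie in the
    core or are counted when the outside vertices are peeled off. *)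
Lemma star_of_card M C : centers M -> C \in M ->
  #|star_of C| <= 'C(#|P C|, q) + (th * #|outside M| + #|M| * n ^ (q - 2)).
Proof.
move=> hM CM; have [cC P0] := hM C CM; have hC := core_heavy hM CM.
pose U := (P C :|: outside M) :\: C.
have dP : [disjoint C & P C] := peel_disjoint _ _ _.
have sPU : P C \subset U.
  by apply/subsetP => v vP; rewrite !inE vP andbT; have := pred0P dP v; rewrite /= vP andbT => ->.
have dU : [disjoint C & U].
  by rewrite disjoint_sym -setI_eq0; apply/eqP/setP => v; rewrite !inE; case: (v \in C); rewrite ?andbF.
have c1 := peel_count EJ cC sPU dU.
have c2 : #|U :\: P C| <= #|outside M|.
  by apply: subset_leq_card; apply/subsetP => v; rewrite !inE => /and3P[/negPf-> _].
pose X C' := [set e in E | [&& C \subset e, C' \subset e & C' != C]].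
have cover : star_of C \subset star_in E C U :|: \bigcup_(C' in M) X C'.
  apply/subsetP => e; rewrite inE => /andP[eE Ce].
  have [sub|/subsetPn[v ve]] := boolP (e \subset C :|: U).
    by rewrite inE; apply/orP; left; apply/star_inP.
  rewrite !inE negb_or negb_and negbK => /andP[vC]; rewrite (negPf vC) /= negb_or negbK.
  case/andP=> vP /bigcupP[C' C'M vP'].
  apply/orP; right; apply/bigcupP; exists C' => //; rewrite inE eE Ce /=.
  rewrite (heavy_pair_edge EJ (core_heavy hM C'M) eE) /=.
    by apply: contraNneq vP => <-.
  by apply/negP => d; have := pred0P d v; rewrite /= vP' ve.
have cX C' : C' \in M -> #|X C'| <= n ^ (q - 2).
  move=> C'M; have [->|C'C] := eqVneq C' C.
    by rewrite (_ : X C = set0) ?cards0 //; apply/setP => e; rewrite !inE eqxx /= !andbF.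
  have [cC' _] := hM C' C'M.
  have td := heavy_pair_centers EJ hC (core_heavy hM C'M) ltac:(by rewrite eq_sym).
  (* t divides both |C'| and |C :&: C'| *)
  have cD : 2 <= #|C' :\: C|.
    have pos : 0 < #|C' :\: C|.
      rewrite card_gt0 setD_eq0; apply: contra C'C => sC.
      by rewrite eqEcard sC cC cC' leqnn.
    have : t %| #|C' :\: C|.
      have := cardsID C C'; rewrite cC' setIC => e.
      by rewrite -(dvdn_addr _ td) e t_dvd_s.
    by move/(dvdn_leq pos); nat_lia.
  apply: (@leq_trans 'C(#|[set: V]|, k - #|C :|: C'|)).
    apply: card_edges_through => e; rewrite inE => /and4P[eE Ce C'e _].
    by rewrite (class_J_card EJ eE) subUset Ce C'e setUT subsetT.
  rewrite cardsT cV; apply: leq_trans (bin_le_exp _ _) _.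
  have : 0 < n by rewrite -cV; have [v _] := set0Pn _ P0; apply/card_gt0P; exists v.
  have : k - #|C :|: C'| <= q - 2.
    have := cardsID C (C :|: C').
    have -> : (C :|: C') :&: C = C by apply/setIidPr; apply: subsetUl.
    have -> : (C :|: C') :\: C = C' :\: C by rewrite setDUl setDv set0U.
    have := k_split; nat_lia.
  by move=> h1 h2; rewrite leq_pexp2l.
apply: leq_trans (subset_leq_card cover) _; apply: leq_trans (leq_card_setU _ _) _.
rewrite addnA leq_add ?card_bigcup_le_const //.
by apply: leq_trans c1 _; rewrite leq_add2l leq_mul2l c2 orbT.
Qed.

Lemma edges_le M m : #|E| = m -> m <= \sum_(C in M) #|star_of C| + #|loose M|.
Proof.
move=> cE; rewrite -cE; apply: leq_trans (leq_add (card_bigcup_le _ _) (leqnn _)).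
apply: leq_trans (leq_card_setU _ _); apply: subset_leq_card; apply/subsetP => e eE.
rewrite !inE eE /=; have [|/forall_inPn] := boolP [forall C in M, ~~ (C \subset e)].
  by rewrite orbT.
case=> C CM; rewrite negbK => Ce; apply/orP; left; apply/bigcupP; exists C => //.
by rewrite inE eE.
Qed.

Hypothesis D_gt0 : 0 < D.
Variable N : nat.
Hypothesis N_ge : D.-1 <= 'C(N, q).
Hypothesis N_lt : forall x, x < N -> 'C(x, q) < D.-1.

Definition star_error M := 1 + (th * #|outside M| + #|M| * n ^ (q - 2)).

Lemma minn_small x : x < N -> minn D.-1 'C(x, q) = 'C(x, q).
Proof. by move=> /N_lt h; apply/minn_idPr; apply: ltnW. Qed.

Lemma minn_large x : N <= x -> minn D.-1 'C(x, q) = D.-1.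
Proof. by move=> h; apply/minn_idPl; apply: leq_trans N_ge _; apply: leq_bin2l. Qed.

Lemma star_of_error M C : centers M -> C \in M ->
  #|star_of C| <= minn D.-1 'C(minn #|P C| N, q) + star_error M.
Proof.
move=> hM CM; have [cC P0] := hM C CM.
have h1 := star_of_card_le cC; have h2 := star_of_card hM CM; rewrite /star_error.
have [lt|ge] := ltnP #|P C| N; first by rewrite minn_small; nat_lia.
by rewrite minn_large; nat_lia.
Qed.

Variable m : nat.
Hypothesis cl : forall l, \sum_(a <- l) (a + s) <= n ->
  \sum_(a <- l) minn D.-1 'C(a, q) < m.

(** The competitors used below give body size a C to the star of each C in M
    and add further stars of sizes l on the vertices that are left. *)
Lemma exchange M (a : {set V} -> nat) (l : seq nat) :
  \sum_(C in M) (a C + s) + \sum_(x <- l) (x + s) <= n ->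
  \sum_(C in M) minn D.-1 'C(a C, q) + \sum_(x <- l) minn D.-1 'C(x, q) < m.
Proof.
move=> le; have := @cl ([seq a C | C <- enum M] ++ l).
by rewrite !big_cat !big_map /= !big_enum; apply.
Qed.

End Config.

(** * An exact bound when blocks cover almost everything *)

Section Respected.
Variables (V : finType) (G : {set {set V}}).
Hypothesis GJ : class_J r t G.

(** The property of a block that is needed for counting, without the
    requirement of many edges through it; a maximal family of such sets can
    absorb what the blocks miss. *)
Definition respects (B : {set V}) := [forall e in G, [disjoint B & e] || (B \subset e)].

Definition respected (Bs : {set {set V}}) :=
  [&& [forall B in Bs, (#|B| == t) && respects B] &
      [forall B in Bs, forall B' in Bs, (B != B') ==> [disjoint B & B']]].

Lemma blocks_respected : respected (blocks G).
Proof.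
apply/andP; split; apply/forall_inP => B BB.
  have := BB; rewrite inE => /andP[-> _] /=; apply/forall_inP => e eG.
  by have [//|/(block_edge_subset GJ BB eG)->] := boolP [disjoint B & e].
by apply/forall_inP => B' BB'; apply/implyP; apply: (blocks_disjoint GJ BB BB').
Qed.

Section Fam.
Variable Bs : {set {set V}}.
Hypothesis rBs : respected Bs.
Local Notation p := #|Bs|.

Lemma resp_card B : B \in Bs -> #|B| = t.
Proof. by case/andP: rBs => /forall_inP h _ /h /andP[/eqP]. Qed.

Lemma resp_sub B e : B \in Bs -> e \in G -> ~~ [disjoint B & e] -> B \subset e.
Proof.
case/andP: rBs => /forall_inP h _ /h /andP[_ /forall_inP h'] /h' /orP[->|->] //.
Qed.

Lemma resp_dis B B' : B \in Bs -> B' \in Bs -> B != B' -> [disjoint B & B'].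
Proof.
by case/andP: rBs => _ /forall_inP h /h /forall_inP h' /h' /implyP.
Qed.

Definition rest := ~: \bigcup_(B in Bs) B.

Lemma rest_card : t * p + #|rest| = #|V|.
Proof.
rewrite -(cardsC (\bigcup_(B in Bs) B)) -sum_card_disjoint; last exact: resp_dis.
rewrite (eq_bigr (fun=> t)); last by move=> B /resp_card.
by rewrite sum_nat_const mulnC.
Qed.

Definition blocks_in (e : {set V}) := [set B in Bs | B \subset e].

Lemma edge_split e : e \in G -> e = (e :&: rest) :|: \bigcup_(B in blocks_in e) B.
Proof.
move=> eG; apply/setP => v; rewrite !inE; apply/idP/orP.
  move=> ve; rewrite ve /=; have [/bigcupP[B BB vB]|_] := boolP (v \in \bigcup_(B in Bs) B); last by left.
  right; apply/bigcupP; exists B => //; rewrite inE BB; apply: resp_sub => //.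
  by apply/negP => d; have := pred0P d v; rewrite /= vB ve.
case=> [/andP[]//|/bigcupP[B]]; rewrite inE => /andP[_ /subsetP sB]; exact: sB.
Qed.

Lemma edge_card e : e \in G -> #|e :&: rest| + t * #|blocks_in e| = k.
Proof.
move=> eG; rewrite -(class_J_card GJ eG) {3}(edge_split eG) cardsU.
rewrite -(@sum_card_disjoint _ _ (fun B => B \in blocks_in e) id); last first.
  by move=> B B'; rewrite !inE => /andP[h _] /andP[h' _]; apply: resp_dis.
rewrite (eq_bigr (fun=> t)); last by move=> B; rewrite inE => /andP[/resp_card].
rewrite sum_nat_const mulnC; set X := _ :&: _ :&: _.
suff -> : X = set0 by rewrite cards0 subn0.
apply/setP => v; rewrite !inE; apply/negP => /andP[/andP[_ /negP vB] /bigcupP[B]].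
by rewrite inE => /andP[BB _] vBB; apply: vB; apply/bigcupP; exists B.
Qed.

Definition trace_class (S : {set V}) := [set e in G | e :&: rest == S].

(** Edges with the same trace on the rest are determined by their blocks. *)
Lemma trace_class_card (S : {set V}) (X : {set {set V}}) : X \subset Bs ->
  #|[set e in trace_class S | X \subset blocks_in e]| <= p ^ ((k - #|S|) %/ t - #|X|).
Proof.
move=> sX; apply: leq_trans (bin_le_exp _ _); rewrite -cards_draws.
apply: (@card_inj_le _ _ (fun e => blocks_in e :\: X)).
  move=> e e'; rewrite !inE => /andP[/andP[eG /eqP eS] Xe] /andP[/andP[e'G /eqP e'S] Xe'] ee'.
  have bb : blocks_in e = blocks_in e'.
    by rewrite -(setID (blocks_in e) X) -(setID (blocks_in e') X) ee' (setIidPr Xe) (setIidPr Xe').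
  by rewrite (edge_split eG) (edge_split e'G) eS e'S bb.
move=> e; rewrite !inE => /andP[/andP[eG /eqP eS] Xe]; apply/andP; split.
  by apply/subsetP => B; rewrite !inE => /and3P[].
rewrite cardsD (setIidPr Xe); have := edge_card eG; rewrite eS => <-.
by rewrite addKn mulKn //; nat_lia.
Qed.

Hypothesis max_Bs : forall Bs', respected Bs' -> #|Bs'| <= p.
Hypothesis p_gt0 : 0 < p.

(** Unless there is no such edge, the size of S is a multiple of t. If it is
    at least 2t, at most q - 2 blocks remain to be chosen. If it is t and
    there were more edges with trace S, then for every edge e some edge with
    trace S would share no block with e, so that S would be respected, in
    contradiction to the maximality of the family. *)
Lemma trace_class_small (S : {set V}) : S \subset rest -> S != set0 ->
  #|trace_class S| <= k * p ^ (q - 2).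
Proof.
move=> sS S0; have [->|/set0Pn[e0 e0S]] := eqVneq (trace_class S) set0; first by rewrite cards0.
have q2 := q_ge2; have kq := k_eq.
have Spos : 0 < #|S| by rewrite card_gt0.
have [e0G e0t] : e0 \in G /\ e0 :&: rest = S by move: e0S; rewrite inE => /andP[eG /eqP eS].
have cS := edge_card e0G; rewrite e0t in cS.
have tS : t %| #|S|.
  by rewrite -(dvdn_addl _ (dvdn_mulr #|blocks_in e0| (dvdnn t))) cS t_dvd_k.
have [St|St] := eqVneq #|S| t; last first.
  have := @trace_class_card S set0 (sub0set _).
  rewrite (_ : [set e in _ | _] = trace_class S); last first.
    by apply/setP => e; rewrite [LHS]inE sub0set andbT.
  rewrite cards0 subn0 => h; apply: leq_trans h _.
  apply: (@leq_trans (p ^ (q - 2))); last by rewrite leq_pmull //; nia.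
  rewrite leq_pexp2l // leq_subRL //.
  case/dvdnP: tS St Spos cS => j -> jt jpos cS.
  rewrite kq -mulnBl mulnK; last by nat_lia.
  have : 2 <= j by case: j jt jpos {cS} => [|[|j]] //; rewrite mul1n eqxx.
  have : j <= q by nia.
  nat_lia.
rewrite leqNgt; apply/negP => big.
have resS : respects S.
  apply/forall_inP => e eG.
  pose shared := \bigcup_(B in blocks_in e) [set f in trace_class S | [set B] \subset blocks_in f].
  have csh : #|shared| <= k * p ^ (q - 2).
    apply: leq_trans (card_bigcup_le_const (n := p ^ (q - 2)) _) _.
      move=> B; rewrite inE => /andP[BB _].
      have := @trace_class_card S [set B]; rewrite sub1set => /(_ BB).
      have e1 : (k - t) %/ t - 1 = q - 2.
        have -> : k - t = q.-1 * t by nia.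
        by rewrite mulnK; nat_lia.
      by rewrite cards1 St e1.
    rewrite leq_mul2r; apply/orP; right.
    have := edge_card eG; have : #|blocks_in e| <= t * #|blocks_in e| by rewrite leq_pmull; nat_lia.
    nat_lia.
  have /subsetPn[f fS fsh] : ~~ (trace_class S \subset shared).
    by apply: contraL (leq_ltn_trans csh big) => /subset_leq_card; rewrite -leqNgt.
  have [fG ft] : f \in G /\ f :&: rest = S by move: fS; rewrite inE => /andP[? /eqP].
  have fe : f :&: e = S :&: e.
    apply/setP => v; rewrite !inE; apply/andP/andP => -[vf ve]; split=> //; last first.
      by move: vf; rewrite -ft inE => /andP[].
    rewrite -ft inE vf inE /=; apply/bigcupP => -[B BB vB].
    have sBf : B \subset f by apply: resp_sub => //; apply/negP => d; have := pred0P d v; rewrite /= vB vf.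
    have sBe : B \subset e by apply: resp_sub => //; apply/negP => d; have := pred0P d v; rewrite /= vB ve.
    case/negP: fsh; apply/bigcupP; exists B; first by rewrite inE BB.
    by rewrite inE fS sub1set inE BB.
  have := class_J_inter GJ fG eG; rewrite fe => adm.
  have le_t : #|S :&: e| <= t by rewrite -St subset_leq_card ?subsetIl.
  have [//|ne] := boolP [disjoint S & e].
  rewrite -setI_eq0 in ne; have pos : 0 < #|S :&: e| by rewrite card_gt0.
  have t_le : t <= #|S :&: e|.
    have := t_le_s; case/orP: adm => [/(dvdn_leq pos)//|]; nat_lia.
  by apply/setIidPl/eqP; rewrite eqEcard subsetIl St.
have disS B : B \in Bs -> [disjoint B & S].
  move=> BB; rewrite -setI_eq0; apply/set0Pn => -[v]; rewrite inE => /andP[vB /(subsetP sS)].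
  by rewrite inE => /bigcupP[]; exists B.
have SB : S \notin Bs.
  by apply/negP => /disS; rewrite -setI_eq0 setIid (negPf S0).
have : respected (S |: Bs).
  apply/andP; split; apply/forall_inP => B.
    rewrite !inE => /orP[/eqP->|BB]; first by rewrite St eqxx.
    by rewrite (resp_card BB) eqxx; case/andP: rBs => /forall_inP/(_ B BB)/andP[].
  rewrite inE => BB; apply/forall_inP => B'; rewrite inE => BB'; apply/implyP.
  move: BB BB'; rewrite !inE => /orP[/eqP->|BB] /orP[/eqP->|BB'].
  - by rewrite eqxx.
  - by rewrite disjoint_sym disS.
  - by rewrite disS.
  - exact: resp_dis.
by move/max_Bs; rewrite cardsU1 SB add1n ltnn.
Qed.

(** Edges with nonempty trace are of order p^(q-2), fewer than the C(p, q-1)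
    unions of blocks gained by one more block on the rest. If the rest has
    less than t vertices there are no such edges at all. *)
Lemma edges_le_blocks : 2 ^ #|rest| * k * p ^ (q - 2) <= 'C(p, q - 1) ->
  #|G| <= 'C(#|V| %/ t, q).
Proof.
move=> hp; have q2 := q_ge2.
have cV := rest_card; have t0 : 0 < t by nat_lia.
have c0 : #|trace_class set0| <= 'C(p, q).
  apply: (@block_unions_card _ q t) => //.
  - exact: resp_card.
  - exact: resp_dis.
  - by move=> e; rewrite inE => /andP[/(class_J_card GJ)-> _]; rewrite k_eq.
  - move=> e v; rewrite inE => /andP[eG /eqP e0] ve.
    move: (ve); rewrite {1}(edge_split eG) e0 set0U => /bigcupP[B].
    by rewrite inE => /andP[BB Be] vB; exists B.
have sG : G \subset trace_class set0 :|:
    \bigcup_(S in [set S : {set V} | (S \subset rest) && (S != set0)]) trace_class S.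
  apply/subsetP => e eG; rewrite inE [X in X || _]inE eG /=.
  have [//|ne] := eqVneq (e :&: rest) set0.
  by apply/bigcupP; exists (e :&: rest); rewrite ?inE ?subsetIr ?ne ?eG ?eqxx.
have [rest_t|rest_t] := leqP t #|rest|; last first.
  apply: (@leq_trans 'C(p, q)).
    apply: leq_trans c0; apply: subset_leq_card; apply/subsetP => e eG.
    rewrite inE eG /=; rewrite -cards_eq0 -leqn0 leqNgt; apply/negP => pos.
    have := edge_card eG => ce.
    have : t %| #|e :&: rest|.
      by rewrite -(dvdn_addl _ (dvdn_mulr #|blocks_in e| (dvdnn t))) ce t_dvd_k.
    move/(dvdn_leq pos); have : #|e :&: rest| <= #|rest| by rewrite subset_leq_card ?subsetIr.
    nat_lia.
  by apply: leq_bin2l; rewrite leq_divRL // -cV mulnC leq_addr.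
apply: (@leq_trans 'C(p.+1, q)); last first.
  by apply: leq_bin2l; rewrite leq_divRL // -cV mulnC mulnS addnC leq_add2l.
apply: leq_trans (subset_leq_card sG) _; apply: leq_trans (leq_card_setU _ _) _.
have small := trace_class_small; case: (q) q2 c0 hp small => // q' q2 c0 hp small.
rewrite binS leq_add //; rewrite subn1 /= in hp; apply: leq_trans hp.
rewrite -mulnA; apply: leq_trans (card_bigcup_le_const (n := k * p ^ (q'.+1 - 2)) _) _.
  by move=> S; rewrite inE => /andP[]; apply: small.
rewrite leq_mul2r; apply/orP; right; rewrite -card_powerset.
by apply: subset_leq_card; apply/subsetP => S; rewrite !inE => /andP[].
Qed.

End Fam.
End Respected.

(** This estimate has no error term: it is compared with a hypothesis that is
    itself exact. *)
Lemma exact_bound c : exists n0, forall (V : finType) (G : {set {set V}}),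
  class_J r t G -> n0 <= #|V| -> #|V| <= t * #|blocks G| + c ->
  #|G| <= 'C(#|V| %/ t, q).
Proof.
pose L := (q.-1)`! * (2 ^ c * k) + q.-1 * q.-1.
exists (c + t * (L + 1)) => V G GJ nbig nb.
have q2 := q_ge2.
have [Bs rBs maxBs] := arg_maxnP (fun Bs : {set {set V}} => #|Bs|) (blocks_respected GJ).
have cb : #|blocks G| <= #|Bs| by apply: maxBs; apply: blocks_respected.
have Lp : L < #|Bs|.
  have : t * (L + 1) <= t * #|blocks G| by nat_lia.
  by rewrite leq_pmul2l; nat_lia.
apply: (@edges_le_blocks V G GJ Bs rBs maxBs); first by nat_lia.
have rest_c : #|rest Bs| <= c.
  have := rest_card rBs; have : t * #|blocks G| <= t * #|Bs| by rewrite leq_mul2l cb orbT.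
  nat_lia.
have := @bin_big q.-1 #|Bs| 1 (2 ^ c * k) #|Bs| _ _ _.
rewrite !mul1n exp1n muln1 leqnn => /(_ ltac:(nat_lia) isT Lp).
rewrite -subn1 -subnDA => /ltnW; apply: leq_trans.
by rewrite leq_mul2r leq_mul2r leq_pexp2l ?orbT.
Qed.

(** * The full size is linear in the number of vertices *)

(** What is used of an extremal hypergraph: the bound for competitors, and the
    least size N such that a complete star with N body vertices has at least D
    - 1 edges. *)
Record extremal_data (V : finType) (E : {set {set V}}) (n m N : nat) : Prop := ExtremalData {
  st_J : class_J r t E;
  st_V : #|V| = n;
  st_E : #|E| = m;
  st_D : 0 < max_degree E;
  st_cl : forall l, \sum_(a <- l) (a + r * t * (t - 1)) <= n ->
    \sum_(a <- l) minn (max_degree E).-1 'C(a, r * t) < m;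
  st_Nge : (max_degree E).-1 <= 'C(N, r * t);
  st_Nlt : forall x, x < N -> 'C(x, r * t) < (max_degree E).-1 }.

(** The centres whose cores have linear size; there are at most B of them. *)
Definition mains (V : finType) (E : {set {set V}}) (n B : nat) : {set {set V}} :=
  [set C : {set V} | [&& #|C| == s, core_of E n C != set0 & n <= B * #|core_of E n C|]].

Lemma mains_centers (V : finType) (E : {set {set V}}) n B : centers E n (mains E n B).
Proof. by move=> C; rewrite inE => /and3P[/eqP]. Qed.

(** The choice B = 2 beta t^2 for the threshold of main centres makes stars
    below it thinner, by the factor beta, than the average number n^(q-1) /
    (t^q q!) of edges per vertex. *)
Lemma main_scale_ge beta : 0 < beta -> beta * t ^ q * 2 ^ (q - 1) <= (2 * beta * t ^ 2) ^ (q - 1).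
Proof.
move=> b0; have q2 := q_ge2; rewrite !expnMn mulnC -mulnA leq_mul2l; apply/orP; right.
apply: leq_mul.
  by rewrite -{1}(expn1 beta) leq_pexp2l //; nat_lia.
by rewrite -expnD leq_pexp2l; nat_lia.
Qed.

(** The blocks carry at most (b/t)^q / q! edges, where b is the number of
    vertices in blocks. The star groups have centres without large core, so
    they are small, hence thin by [small_star_scaling]. The right side is the
    resulting bound multiplied by beta t^q q!. *)
Lemma loose_bound beta : 0 < beta -> exists n0, forall (V : finType) (E : {set {set V}}) n m N,
  extremal_data E n m N -> n0 <= n ->
  let M := mains E n (2 * beta * t ^ 2) in
  let w := #|outside E n M| in
  let b := t * #|blocks (loose E M)| in
  b <= w /\
  beta * t ^ q * q`! * #|loose E M| <=
    beta * b ^ q + (w - b) * n ^ (q - 1) + beta * t ^ q * q`! * K * w ^ (q - 1).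
Proof.
move=> b0; set B := 2 * beta * t ^ 2; have q2 := q_ge2.
have B0 : 0 < B by rewrite /B !muln_gt0 b0 /=; nat_lia.
exists (q`! * B ^ q * A + 1) => V E n m N st nbig M w b.
have EJ := st_J st; have hM : centers E n M by apply: mains_centers.
have GJ : class_J r t (loose E M) := loose_J EJ M.
have GW e : e \in loose E M -> e \subset outside E n M.
  by apply: loose_sub; [exact: EJ|exact: st_V st|exact: hM].
have c1 := decomposition_card GJ GW; have c2 := decomposition_space GJ GW.
have each (C : {set V}) : #|C| == s ->
   beta * t ^ q * q`! * #|star_group (loose E M) C| <= #|star_body (loose E M) C| * n ^ (q - 1).
  move=> /eqP cC; set g := #|star_group _ _|; set d := #|star_body _ _|.
  have [CM|CM] := boolP (C \in M).
    suff -> : g = 0 by rewrite muln0.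
    apply/eqP; rewrite cards_eq0; apply/eqP/setP => e; rewrite in_set0; apply/negP.
    move=> /star_groupP[eG Ce _]; move: eG; rewrite inE => /andP[_ /forall_inP/(_ C CM)].
    by rewrite Ce.
  have PB : B * #|core_of E n C| <= n.
    move: CM; rewrite inE cC eqxx /= negb_and negbK -ltnNge => /orP[/eqP->|/ltnW//].
    by rewrite cards0 muln0.
  have g1 : q`! * g <= d ^ q.
    apply: leq_trans (bin_fact_le q d); rewrite mulnC leq_mul2r; apply/orP; right.
    exact: star_group_card.
  have g2 : g <= 'C(#|core_of E n C|, q) + A * n ^ (q - 1).
    have dC : [disjoint C & ~: C] by rewrite disjoint_sym disjoints_subset.
    have dP : [disjoint C & core_of E n C] := peel_disjoint _ _ _.
    have sP : core_of E n C \subset ~: C by rewrite -disjoints_subset disjoint_sym.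
    have := peel_count EJ cC sP dC.
    have : g <= #|star_in E C (~: C)|.
      apply: subset_leq_card; apply/subsetP => e /star_groupP[eG Ce _].
      by apply/star_inP; rewrite setUCr subsetT; move: eG; rewrite inE => /andP[].
    move=> h1 h2; apply: leq_trans h1 _; apply: leq_trans h2 _; rewrite leq_add2l -mulnA leq_mul2l.
    apply/orP; right; have -> : q - 1 = (q - 2).+1 by nat_lia.
    rewrite expnSr leq_mul2l; apply/orP; right.
    by apply: leq_trans (max_card _) _; rewrite (st_V st).
  have g3 : B ^ q * (q`! * g) <= (2 * n) ^ q.
    have h1 : q`! * 'C(#|core_of E n C|, q) <= #|core_of E n C| ^ q by rewrite mulnC bin_fact_le.
    have h2 : B ^ q * #|core_of E n C| ^ q <= n ^ q by rewrite -expnMn leq_exp.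
    have h3 : (q`! * B ^ q * A) * n ^ (q - 1) <= n ^ q.
      have -> : n ^ q = n * n ^ (q - 1) by apply: expn_pred_mul; apply: ltnW.
      by rewrite leq_mul2r; apply/orP; right; nat_lia.
    have h4 : 2 * n ^ q <= (2 * n) ^ q.
      by rewrite expnMn leq_mul2r; apply/orP; right; rewrite -{1}(expn1 2) leq_pexp2l //; nat_lia.
    apply: leq_trans h4; apply: (@leq_trans (B ^ q * (q`! * ('C(#|core_of E n C|, q) + A * n ^ (q - 1))))).
      by rewrite leq_mul2l leq_mul2l g2 !orbT.
    rewrite mulnDr mulnDr mul2n -addnn leq_add //.
      by apply: leq_trans h2; rewrite leq_mul2l h1 orbT.
    by apply: leq_trans h3; rewrite !mulnA [B ^ q * _]mulnC.
  have := small_star_scaling B0 _ g1 g3 => /(_ ltac:(nat_lia)) h.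
  have Bq : 0 < B ^ (q - 1) by rewrite expn_gt0 B0.
  rewrite -(leq_pmul2l Bq).
  apply: (@leq_trans (beta * t ^ q * (d * (2 * n) ^ (q - 1)))).
    have -> : B ^ (q - 1) * (beta * t ^ q * q`! * g) = beta * t ^ q * (B ^ (q - 1) * (q`! * g)).
      by rewrite !mulnA [B ^ _ * beta]mulnC -!mulnA; congr (_ * _); rewrite mulnCA.
    by rewrite leq_mul2l h orbT.
  rewrite expnMn; have := main_scale_ge b0; rewrite -/B.
  move: (B ^ (q - 1)) (beta * t ^ q) (2 ^ (q - 1)) (n ^ (q - 1)) => x1 x2 x3 x4 h5.
  have : x2 * x3 * (d * x4) <= x1 * (d * x4) by rewrite leq_mul2r h5 orbT.
  by apply: leq_trans; rewrite -!mulnA leq_mul2l; apply/orP; right; rewrite mulnCA.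
split; first by apply: leq_trans c2; apply: leq_addr.
apply: (@leq_trans (beta * t ^ q * q`! * ('C(#|blocks (loose E M)|, q) +
   \sum_(C : {set V} | #|C| == s) #|star_group (loose E M) C| + K * w ^ (q - 1)))).
  by rewrite leq_mul2l; apply/orP; right; rewrite -[q.-1]subn1 in c1.
rewrite !mulnDr; apply: leq_add; last by rewrite mulnA.
apply: leq_add.
  rewrite /b expnMn -!mulnA leq_mul2l; apply/orP; right; rewrite leq_mul2l; apply/orP; right.
  by rewrite mulnC bin_fact_le.
rewrite big_distrr /=; apply: leq_trans (leq_sum _ each) _.
rewrite -big_distrl /= leq_mul2r; apply/orP; right.
by rewrite leq_subRL //; apply: leq_trans c2; apply: leq_addr.
Qed.

Lemma few_cores (V : finType) (E : {set {set V}}) n m N (M : {set {set V}}) B : extremal_data E n m N ->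
  centers E n M -> 0 < n -> (forall C, C \in M -> n <= B * #|core_of E n C|) -> #|M| <= B.
Proof.
move=> st hM n0 hB; rewrite -(leq_pmul2r n0) -sum_nat_const.
apply: leq_trans (leq_sum _ hB) _; rewrite -big_distrr /= leq_mul2l; apply/orP; right.
by rewrite -[X in _ <= X](cores_card (st_J st) (st_V st) hM) leq_addr.
Qed.

Lemma star_error_le (V : finType) (E : {set {set V}}) n m N (M : {set {set V}}) B : extremal_data E n m N ->
  0 < n -> #|M| <= B -> star_error E n M <= (1 + A + B) * n ^ (q - 1).
Proof.
move=> st n0 MB; rewrite /star_error; have q2 := q_ge2.
have -> : q - 1 = (q - 2).+1 by nat_lia.
have w_n : #|outside E n M| <= n by rewrite -[X in _ <= X](st_V st) max_card.
have X1 : 0 < n ^ (q - 2) by rewrite expn_gt0 n0.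
rewrite expnS; move: (n ^ (q - 2)) X1 => X X1.
have h1 : A * X * #|outside E n M| <= A * X * n by rewrite leq_mul2l w_n orbT.
have h2 : #|M| * X <= B * X by rewrite leq_mul2r MB orbT.
have h3 : B * X <= B * X * n by rewrite leq_pmulr.
have h4 : 1 <= X * n by rewrite muln_gt0 X1.
have -> : (1 + A + B) * (n * X) = X * n + A * X * n + B * X * n by nia.
nat_lia.
Qed.

(** A star with core of x vertices has about min(D, C(x, q)) edges, at most x
    N^(q-1) / q!. *)
Lemma star_sum_bound (V : finType) (E : {set {set V}}) n m N (M : {set {set V}}) B : extremal_data E n m N ->
  centers E n M -> 0 < n -> #|M| <= B ->
  q`! * \sum_(C in M) #|star_of E C| <=
    (\sum_(C in M) #|core_of E n C|) * N ^ (q - 1) + q`! * (B * (1 + A + B)) * n ^ (q - 1).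
Proof.
move=> st hM n0 MB; have q2 := q_ge2.
have each C : C \in M -> q`! * #|star_of E C| <=
    #|core_of E n C| * N ^ (q - 1) + q`! * ((1 + A + B) * n ^ (q - 1)).
  move=> CM; have := star_of_error (st_J st) (st_V st) (st_D st) (st_Nge st) (st_Nlt st) hM CM.
  set x := minn #|_| N => h.
  have h1 : minn (max_degree E).-1 'C(x, q) * q`! <= #|core_of E n C| * N ^ (q - 1).
    apply: (@leq_trans (x ^ q)).
      by apply: leq_trans (bin_fact_le q x); rewrite leq_mul2r geq_minr orbT.
    have -> : x ^ q = x * x ^ (q - 1) by apply: expn_pred_mul; apply: ltnW.
    by rewrite leq_mul ?geq_minl // leq_exp // geq_minr.
  have := star_error_le st n0 MB => h2.
  apply: (@leq_trans (q`! * (minn (max_degree E).-1 'C(x, q) + (1 + A + B) * n ^ (q - 1)))).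
    by rewrite leq_mul2l; apply/orP; right; apply: leq_trans h _; rewrite leq_add2l.
  by rewrite mulnDr leq_add2r mulnC.
rewrite big_distrr /=; apply: leq_trans (leq_sum _ each) _.
rewrite big_split /= -big_distrl /= leq_add2l sum_nat_const.
rewrite -!mulnA mulnCA leq_mul2l; apply/orP; right.
by rewrite leq_mul2r MB orbT.
Qed.

Lemma binom_floor n : t <= n ->
  n ^ q <= t ^ q * q`! * 'C(n %/ t, q) + (t ^ q * (q * q) + q * t * 2 ^ (q - 1)) * n ^ (q - 1).
Proof.
move=> tn; set x := n %/ t; have t0 : 0 < t by nat_lia.
have n_le : n <= t * x + t.
  by have := ltn_ceil n t0; rewrite -/x mulSn mulnC; nat_lia.
have x_n : t * x <= n by rewrite mulnC leq_trunc_div.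
have h1 : n ^ q <= (t * x + t) ^ q by apply: leq_exp.
have h2 := expnD_le q (t * x) t.
have h3 : (t * x + t) ^ (q - 1) <= 2 ^ (q - 1) * n ^ (q - 1).
  by rewrite -expnMn leq_exp //; nat_lia.
have h4 := exp_le_bin q x.
have h5 : x ^ (q - 1) <= n ^ (q - 1).
  by apply: leq_exp; apply: leq_trans x_n; rewrite leq_pmull.
have h6 : (t * x) ^ q <= t ^ q * ('C(x, q) * q`! + q * q * n ^ (q - 1)).
  rewrite expnMn leq_mul2l; apply/orP; right; apply: leq_trans h4 _.
  by rewrite leq_add2l leq_mul2l h5 orbT.
have h7 : q * t * (t * x + t) ^ (q - 1) <= q * t * (2 ^ (q - 1) * n ^ (q - 1)).
  by rewrite leq_mul2l h3 orbT.
apply: leq_trans h1 _; apply: leq_trans h2 _; apply: leq_trans (leq_add h6 h7) _.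
by rewrite mulnDr mulnDl -!mulnA ['C(_, _) * _]mulnC addnA.
Qed.

(** Compare the lower bound m > C(floor(n/t), q), about n^q / (t^q q!), with
    the upper bound from the stars and the loose edges. The blocks cancel b^q,
    and dividing n^q - b^q by n - b in two ways gives both claims. The
    division absorbs the error terms if n - b exceeds a constant; otherwise
    there are no main centres and [exact_bound] contradicts the hypothesis on
    m. *)
Lemma full_size_bounds beta : 4 <= beta -> exists n0, forall (V : finType) (E : {set {set V}}) n m N,
  extremal_data E n m N -> 'C(n %/ t, q) < m -> n0 <= n ->
  let b := t * #|blocks (loose E (mains E n (2 * beta * t ^ 2)))| in
  n ^ (q - 1) <= 2 * t ^ q * N ^ (q - 1) /\
  beta * (q * b ^ (q - 1)) <= (beta + 4) * (t ^ q * N ^ (q - 1)).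
Proof.
move=> b4; have b0 : 0 < beta by nat_lia.
have [n1 hn1] := loose_bound b0; set B := 2 * beta * t ^ 2 in hn1 *.
have q2 := q_ge2; have q0 : 0 < q by nat_lia.
pose c0 := t ^ q * (q * q) + q * t * 2 ^ (q - 1).
pose c1 := q`! * (B * (1 + A + B)).
pose K3 := beta * c0 + beta * t ^ q * c1 + beta * t ^ q * q`! * K.
have [n2 hn2] := exact_bound K3.
exists (n1 + n2 + t + B * K3 + 1) => V E n m N st mbig nbig b.
have [n1n n2n tn n0 BKn] : [/\ n1 <= n, n2 <= n, t <= n, 0 < n & B * K3 < n].
  by move: nbig; clear; move: (B * K3) => x; split; nat_lia.
set M := mains E n B in b *.
have hM : centers E n M by apply: mains_centers.
have MB : #|M| <= B by apply: (few_cores st hM n0) => C; rewrite inE => /and3P[].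
have [bw] := hn1 V E n m N st n1n; rewrite -/M -/b in bw *; set w := #|outside _ _ _| in bw *.
move=> H1; have H2 := star_sum_bound st hM n0 MB.
have sumP := cores_card (st_J st) (st_V st) hM; rewrite -/w in sumP.
have H3 := edges_le M (st_E st).
have H4 := binom_floor tn; rewrite -/c0 in H4.
set SP := \sum_(C in M) #|core_of E n C| in H2 sumP.
have wn : w <= n by rewrite -sumP leq_addl.
have wX : w ^ (q - 1) <= n ^ (q - 1) by apply: leq_exp.
have H5 : beta * n ^ q <= beta * t ^ q * (SP * N ^ (q - 1)) +
     beta * b ^ q + (w - b) * n ^ (q - 1) + K3 * n ^ (q - 1).
  have e1 : beta * n ^ q <= beta * t ^ q * q`! * m + beta * c0 * n ^ (q - 1).
    rewrite -!mulnA -mulnDr leq_mul2l; apply/orP; right; apply: leq_trans H4 _.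
    by rewrite leq_add2r -!mulnA leq_mul2l leq_mul2l (ltnW mbig) !orbT.
  have e2 : beta * t ^ q * q`! * m <= beta * t ^ q * (q`! * \sum_(C in M) #|star_of E C|) +
      beta * t ^ q * q`! * #|loose E M|.
    by rewrite [_ * (q`! * _)]mulnA -mulnDr leq_mul2l H3 orbT.
  have e3 : beta * t ^ q * (q`! * \sum_(C in M) #|star_of E C|) <=
     beta * t ^ q * (SP * N ^ (q - 1)) + beta * t ^ q * c1 * n ^ (q - 1).
    by rewrite -[_ * c1 * n ^ _]mulnA -mulnDr leq_mul2l H2 orbT.
  have e4 : beta * t ^ q * q`! * K * w ^ (q - 1) <= beta * t ^ q * q`! * K * n ^ (q - 1).
    by rewrite leq_mul2l wX orbT.
  rewrite /K3 2!(mulnDl _ _ (n ^ (q - 1))).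
  apply: leq_trans e1 _; move: e2 e3 e4 H1; clear.
  move: (beta * t ^ q * q`! * m) (beta * c0 * n ^ (q - 1)) (beta * t ^ q * c1 * n ^ (q - 1)) => x1 x2 x3.
  move: (beta * t ^ q * (q`! * \sum_(C in M) #|star_of E C|)) (beta * t ^ q * q`! * #|loose E M|) => x4 x5.
  move: (beta * t ^ q * q`! * K * w ^ (q - 1)) (beta * t ^ q * q`! * K * n ^ (q - 1)) => x6 x7.
  move: (beta * t ^ q * (SP * N ^ (q - 1))) (beta * b ^ q) ((w - b) * n ^ (q - 1)) => x8 x9 x10.
  clear; nat_lia.
have bn : b <= n by apply: leq_trans bw wn.
have [far|near] := leqP K3 (n - b); last first.
  have M0 : M = set0.
    apply/eqP/negPn/negP => /set0Pn[C CM].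
    have h2 : #|core_of E n C| <= SP by rewrite /SP (bigD1 C) //= leq_addr.
    move: (CM); rewrite inE => /and3P[_ _ h1].
    have h3 : #|core_of E n C| <= K3.
      clear - near sumP h2 bw; clearbody b SP w K3; nat_lia.
    have : B * #|core_of E n C| <= B * K3 by rewrite leq_mul2l h3 orbT.
    by move/(leq_trans h1); rewrite leqNgt BKn.
  have lE : loose E M = E.
    apply/setP => e; rewrite inE; case: (e \in E) => //=; apply/forall_inP => C.
    by rewrite M0 inE.
  have := hn2 V E (st_J st); rewrite (st_V st) (st_E st) => /(_ n2n).
  have : n <= t * #|blocks E| + K3.
    by move: near; rewrite /b lE; clear; nat_lia.
  by move=> h /(_ h); rewrite leqNgt mbig.
set Y := N ^ (q - 1) in H5 *; set X := n ^ (q - 1) in H5 *; set Z := b ^ (q - 1).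
have d_gt0 : 0 < n - b.
  apply: leq_trans far; rewrite /K3 /c0 -!addnA addn_gt0; apply/orP; left.
  by rewrite muln_gt0 b0 addn_gt0 muln_gt0 expn_gt0 muln_gt0 q0; move: ht; clear; nat_lia.
(* H5 divided by n - b; the last two terms on the right of H5 are at most
   (n - b) n^(q-1) each, because n - b exceeds the constant K3. *)
have key x : (n - b) * x + b ^ q <= n ^ q -> beta * x <= beta * t ^ q * Y + 2 * X.
  move=> hx; rewrite -(leq_pmul2l d_gt0).
  have f1 : beta * ((n - b) * x + b ^ q) <= beta * n ^ q by rewrite leq_mul2l hx orbT.
  have f2 : beta * t ^ q * (SP * Y) <= beta * t ^ q * ((n - b) * Y).
    rewrite leq_mul2l leq_mul2r; apply/orP; right; apply/orP; right.
    by move: sumP bw; clear; nat_lia.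
  have f3 : (w - b) * X <= (n - b) * X by rewrite leq_mul2r leq_sub2r ?orbT.
  have f4 : K3 * X <= (n - b) * X by rewrite leq_mul2r far orbT.
  rewrite mulnDr in f1; rewrite [_ * (_ + 2 * X)]mulnDr.
  rewrite [(n - b) * (beta * x)]mulnCA [(n - b) * (_ * Y)]mulnCA [(n - b) * (2 * X)]mulnCA.
  move: f1 f2 f3 f4 H5; clear.
  set x1 := beta * (_ * x); set x2 := beta * b ^ _; set x3 := beta * n ^ _.
  set x4 := _ * (SP * Y); set x5 := (w - b) * X; set x6 := K3 * X.
  set x7 := (n - b) * X; set x8 := _ * ((n - b) * Y).
  move: x1 x2 x3 x4 x5 x6 x7 x8; clear; nat_lia.
have k1 := key X; have k2 := key (q * Z).
have g1 : beta * X <= beta * t ^ q * Y + 2 * X by apply: k1; rewrite addnC; apply: expn_gap_top.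
have g2 : beta * (q * Z) <= beta * t ^ q * Y + 2 * X by apply: k2; rewrite addnC; apply: expn_gap_bot.
have g3 : X <= 2 * t ^ q * Y.
  have h : beta * X <= 2 * (beta * t ^ q * Y).
    have : 4 * X <= beta * X by rewrite leq_mul2r b4 orbT.
    move: g1; clear; move: (beta * X) (_ * Y) => x y; nat_lia.
  rewrite -(leq_pmul2l b0); apply: leq_trans h _; rewrite eq_leq //.
  by rewrite !mulnA [beta * 2]mulnC.
split=> //; apply: leq_trans g2 _; rewrite mulnDl -mulnA leq_add2l.
apply: (@leq_trans (2 * (2 * t ^ q * Y))); first by rewrite leq_mul2l g3.
by rewrite !mulnA.
Qed.

(** * Comparison with a baseline *)

Section Baseline.
Variables (V : finType) (E : {set {set V}}) (n m N : nat).
Hypothesis st : extremal_data E n m N.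
Variable M : {set {set V}}.
Hypothesis hM : centers E n M.
Local Notation D := (max_degree E).
Local Notation P := (core_of E n).
Local Notation w := #|outside E n M|.

(** The true number of edges is at most that of truncated stars on the cores,
    plus errors, plus the loose edges. *)
Lemma baseline_move (a : {set V} -> nat) (l : seq nat) :
  \sum_(C in M) (a C + s) + \sum_(x <- l) (x + s) <= n ->
  \sum_(C in M) minn D.-1 'C(a C, q) + \sum_(x <- l) minn D.-1 'C(x, q) <
  \sum_(C in M) minn D.-1 'C(minn #|P C| N, q) + #|M| * star_error E n M + #|loose E M|.
Proof.
move=> /(exchange (st_cl st)) h; apply: leq_trans h _.
apply: leq_trans (edges_le M (st_E st)) _; rewrite leq_add2r -sum_nat_const -big_split /=.
apply: leq_sum => C CM.
apply: (star_of_error (st_J st) (st_V st) (st_D st) (st_Nge st) (st_Nlt st) hM CM).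
Qed.

(** Keep all cores and put new stars of sizes l, together with the centres, on
    the outside vertices. *)
Lemma baseline (l : seq nat) : s * #|M| + \sum_(x <- l) (x + s) <= w ->
  \sum_(x <- l) minn D.-1 'C(x, q) < #|M| * star_error E n M + #|loose E M|.
Proof.
move=> le; have := @baseline_move (fun C => minn #|P C| N) l.
move=> h; rewrite -(ltn_add2l (\sum_(C in M) minn D.-1 'C(minn #|P C| N, q))) addnA; apply: h.
rewrite -[X in _ <= X](cores_card (st_J st) (st_V st) hM).
rewrite big_split /= sum_nat_const -addnA [#|M| * s]mulnC; apply: leq_add => //.
by apply: leq_sum => C _; apply: geq_minl.
Qed.

End Baseline.

Lemma full_size_linear n N : n ^ (q - 1) <= 2 * t ^ q * N ^ (q - 1) -> n <= 2 * t ^ 2 * N.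
Proof.
have q2 := q_ge2; move=> h; rewrite -(@leq_exp2r _ _ (q - 1)); last by nat_lia.
apply: leq_trans h _; rewrite !expnMn leq_mul2r; apply/orP; right; apply: leq_mul.
  by rewrite -{1}(expn1 2) leq_pexp2l //; nat_lia.
by rewrite -expnD leq_pexp2l; nat_lia.
Qed.

(** * Few vertices outside the cores *)

(** If w < N, one star on the w outside vertices would have about w^q / q!
    edges. The loose edges are fewer, since they consist of thin stars and of
    blocks, which are less efficient by a factor t^q. If w is at least N, use
    as many stars of size N as possible and one star on the remaining
    vertices. *)
Lemma outside_small eta : 0 < eta -> exists beta n0, [/\ 0 < beta & forall (V : finType) (E : {set {set V}}) n m N,
  extremal_data E n m N -> 'C(n %/ t, q) < m -> n0 <= n ->
  eta * #|outside E n (mains E n (2 * beta * t ^ 2))| <= n].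
Proof.
move=> eta0; have q2 := q_ge2; have q0 : 0 < q by nat_lia.
(* beta >= eta^(q-1) keeps the thin stars small when w > n / eta; the other
   terms serve the comparison with stars of size N. *)
pose beta := eta ^ (q - 1) + 4 * q + 73; exists beta.
have b4 : 4 <= beta by rewrite /beta; clear; nat_lia.
have b0 : 0 < beta by apply: leq_trans b4.
have b64 : 64 <= beta by rewrite /beta; clear; nat_lia.
have b8q : 8 + 4 * q < beta by rewrite /beta; clear; nat_lia.
have beta_eta : eta ^ (q - 1) <= beta by rewrite /beta; clear; nat_lia.
clearbody beta.
have [n1 hn1] := loose_bound b0; have [n2 hn2] := full_size_bounds b4.
set B := 2 * beta * t ^ 2 in hn1 hn2 *.
pose e := 1 + A + B; pose CE := q`! * (B * e); pose c := s * (B + 2).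
pose c' := q * q + q * c; pose C2 := beta * t ^ q * q`! * K.
pose C3 := beta * t ^ q * CE + beta * t ^ q * c' + C2.
pose CC := beta * q * t ^ q * CE * 2 + beta * q * (c' * (2 * t ^ 2 + 1)) + 2 * q * C2.
exists (n1 + n2 + eta * c + 2 * t ^ 2 * c + eta * (C3 * eta ^ (q - 1)) + 2 * t ^ 2 * CC + 1).
split=> // V E n m N st mbig nbig.
have [n1n n2n ec tc [eC tC n0]] : [/\ n1 <= n, n2 <= n, eta * c < n, 2 * t ^ 2 * c < n &
    [/\ eta * (C3 * eta ^ (q - 1)) < n, 2 * t ^ 2 * CC < n & 0 < n]].
  move: nbig; clear; move: (eta * c) (2 * t ^ 2 * c) (eta * (C3 * _)) (_ * CC) => x1 x2 x3 x4 h.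
  by split; [nat_lia|nat_lia|nat_lia|nat_lia|split; nat_lia].
clear nbig; set M := mains _ _ _; set w := #|_|.
have hM : centers E n M by apply: mains_centers.
have MB : #|M| <= B by apply: (few_cores st hM n0) => C; rewrite inE => /and3P[].
have [bw H1] := hn1 V E n m N st n1n; rewrite -/M -/w in bw H1.
have [N1 N2] := hn2 V E n m N st mbig n2n; rewrite -/M in N2.
set b := t * #|blocks (loose E M)| in bw H1 N2.
have nN := full_size_linear N1.
have wn : w <= n by rewrite -[X in _ <= X](st_V st) max_card.
have wX : w ^ (q - 1) <= n ^ (q - 1) by apply: leq_exp.
have errM : q`! * (#|M| * star_error E n M) <= CE * n ^ (q - 1).
  rewrite /CE -mulnA leq_mul2l; apply/orP; right; rewrite -mulnA; apply: leq_mul => //.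
  exact: (star_error_le st n0 MB).
have H1' : beta * t ^ q * q`! * #|loose E M| <= beta * b ^ q + (w - b) * n ^ (q - 1) + C2 * n ^ (q - 1).
  by apply: leq_trans H1 _; rewrite leq_add2l leq_mul2l wX orbT.
have s0 : 0 < s by apply: leq_trans (t_le_s); apply: ltnW.
have c_gt0 : 0 < c by rewrite /c muln_gt0 s0 addn2.
have sM : s * #|M| + s + s <= c.
  by rewrite /c mulnDr -addnA leq_add ?leq_mul2l ?MB ?orbT // muln2 addnn.
rewrite leqNgt; apply/negP => nw.
have cw : c <= w.
  by rewrite -(leq_pmul2l eta0) ltnW // (ltn_trans ec).
have [wN|Nw] := leqP w N.
  have bl := @baseline V E n m N st M hM [:: w - c].
  rewrite !big_seq1 (minn_small (st_Nlt st)) in bl; last first.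
    by move: c_gt0 cw wN; clear; clearbody c; nat_lia.
  have {}bl : 'C(w - c, q) < #|M| * star_error E n M + #|loose E M|.
    by apply: bl; rewrite -/w; move: sM cw; clear; clearbody c; move: (s * _) => x; nat_lia.
  have sh := @expn_shrink q w c q0; rewrite -/c' in sh.
  have w0 : 0 < w by apply: leq_trans cw.
  have f1 : beta * t ^ q * w ^ q <= beta * t ^ q * (q`! * (#|M| * star_error E n M + #|loose E M|) + c' * n ^ (q - 1)).
    rewrite leq_mul2l; apply/orP; right; apply: leq_trans sh _; apply: leq_add.
      by rewrite leq_mul2l (ltnW bl) orbT.
    by rewrite leq_mul2l wX orbT.
  have f2 : beta * t ^ q * (q`! * (#|M| * star_error E n M)) <= beta * t ^ q * CE * n ^ (q - 1).
    by rewrite -[_ * CE * _]mulnA leq_mul2l errM orbT.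
  have f3 : beta * b ^ q <= beta * w ^ q by rewrite leq_mul2l leq_exp ?orbT.
  have X_w : n ^ (q - 1) <= eta ^ (q - 1) * w ^ (q - 1) by rewrite -expnMn leq_exp // ltnW.
  have f4 : (w - b) * n ^ (q - 1) <= beta * w ^ q.
    have -> : w ^ q = w * w ^ (q - 1) by apply: expn_pred_mul; apply: ltnW.
    apply: (@leq_trans (w * (eta ^ (q - 1) * w ^ (q - 1)))); first by rewrite leq_mul // leq_subr.
    by rewrite mulnCA leq_mul2r beta_eta orbT.
  have t4 : 4 * (beta * w ^ q) <= beta * t ^ q * w ^ q.
    rewrite -[beta * _ * _]mulnA mulnCA leq_mul2l; apply/orP; right; rewrite leq_mul2r; apply/orP; right.
    by apply: (@leq_trans (2 ^ q)); [rewrite -[4]/(2 ^ 2) leq_pexp2l|apply: leq_exp].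
  have f5 : 2 * (beta * w ^ q) <= C3 * n ^ (q - 1).
    rewrite /C3 2!(mulnDl _ _ (n ^ (q - 1))).
    move: f1 f2 f3 f4 t4 H1'; rewrite [q`! * (_ + _)]mulnDr [beta * t ^ q * (_ + _)]mulnDr.
    rewrite [beta * t ^ q * (_ + _)]mulnDr [beta * t ^ q * (q`! * #|_|)]mulnA.
    rewrite [beta * t ^ q * (c' * _)]mulnA; clear.
    move: (beta * t ^ q * w ^ q) (beta * t ^ q * (q`! * (#|M| * star_error E n M))) => x1 x2.
    move: (beta * t ^ q * q`! * #|loose E M|) (beta * t ^ q * c' * n ^ (q - 1)) => x3 x4.
    move: (beta * t ^ q * CE * n ^ (q - 1)) (beta * b ^ q) (beta * w ^ q) => x5 x6 x7.
    move: ((w - b) * n ^ (q - 1)) (C2 * n ^ (q - 1)) => x8 x9; clear; nat_lia.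
  have f6 : w * w ^ (q - 1) <= C3 * eta ^ (q - 1) * w ^ (q - 1).
    apply: (@leq_trans (2 * (beta * w ^ q))).
      rewrite -(expn_pred_mul w q0).
      by rewrite mulnA leq_pmull // muln_gt0.
    by apply: leq_trans f5 _; rewrite -mulnA leq_mul2l X_w orbT.
  rewrite leq_pmul2r ?expn_gt0 ?w0 // in f6.
  have : eta * w <= eta * (C3 * eta ^ (q - 1)) by rewrite leq_mul2l f6 orbT.
  by move/(leq_trans nw); rewrite ltnNge ltnW.
have t20 : 0 < 2 * t ^ 2 by rewrite muln_gt0 expn_gt0; move: ht; clear; nat_lia.
have cN : c < N by rewrite -(ltn_pmul2l t20); apply: leq_trans tc nN.
have CCN : CC < N by rewrite -(ltn_pmul2l t20); apply: leq_trans tC nN.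
have N0 : 0 < N by apply: leq_ltn_trans cN.
set a := w %/ N; set f := w %% N.
have waf : w = a * N + f by apply: divn_eq.
have a0 : 0 < a by rewrite divn_gt0 // ltnW.
have fN : f < N by apply: ltn_pmod.
have a_le : a <= 2 * t ^ 2.
  rewrite -(leq_pmul2r N0); apply: leq_trans nN; apply: leq_trans wn; rewrite waf; exact: leq_addr.
have bl := @baseline V E n m N st M hM (f - c :: nseq a (N - c)).
rewrite !big_cons !big_nseq !iter_addn_0 in bl.
have {}bl : 'C(N - c, q) * a + 'C(f - c, q) < #|M| * star_error E n M + #|loose E M|.
  rewrite addnC; move: bl; rewrite !(minn_small (st_Nlt st)); last first.
  - by apply: leq_ltn_trans fN; apply: leq_subr.
  - by move: cN c_gt0; clear; clearbody c; nat_lia.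
  apply; rewrite -/w waf; move: sM cN a0; clear; clearbody c a f.
  move: (s) => y; move: (y * #|M|) => x h1 h2 h3; have : (N - c + y) * a + (x + y) <= a * N.
    have g1 : (N - c + y) * a <= (N - (x + y)) * a by rewrite leq_mul2r; apply/orP; right; nat_lia.
    have g2 : x + y <= (x + y) * a by rewrite leq_pmulr.
    have g3 : (x + y) * a <= N * a by rewrite leq_mul2r; apply/orP; right; nat_lia.
    by move: g1 g2 g3; rewrite mulnBl; clear; nat_lia.
  by clear; nat_lia.
set Y := N ^ (q - 1) in N1 N2; set X := n ^ (q - 1) in N1 errM H1'.
have shN := @expn_shrink q N c q0; have shf := @expn_shrink q f c q0; rewrite -/c' -/Y in shN shf.
have fY : f ^ (q - 1) <= Y by apply: leq_exp; apply: ltnW.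
apply: (@loose_count_contra q beta a f N CC q2 b8q b64 a0 fN CCN); rewrite -/Y -waf.
have tq0 : 0 < t ^ q by rewrite expn_gt0; move: ht; clear; nat_lia.
rewrite -(leq_pmul2l tq0).
have g1 : a * N ^ q + f ^ q <= q`! * (#|M| * star_error E n M + #|loose E M|) + c' * (2 * t ^ 2 + 1) * Y.
  apply: (@leq_trans (a * (q`! * 'C(N - c, q) + c' * Y) + (q`! * 'C(f - c, q) + c' * Y))).
    apply: leq_add; first by rewrite leq_mul2l shN orbT.
    by apply: leq_trans shf _; rewrite leq_add2l leq_mul2l fY orbT.
  apply: (@leq_trans (q`! * ('C(N - c, q) * a + 'C(f - c, q)) + c' * (a + 1) * Y)).
    by rewrite eq_leq // !mulnDr mulnDl; clear; move: ('C(_, _)) ('C(_, _)) (q`!) => *; nat_lia.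
  apply: leq_add; first by rewrite leq_mul2l (ltnW bl) orbT.
  by rewrite leq_mul2r leq_mul2l leq_add2r a_le !orbT.
have g2 : beta * q * t ^ q * (q`! * (#|M| * star_error E n M)) <= t ^ q * (beta * q * t ^ q * CE * 2 * Y).
  apply: (@leq_trans (beta * q * t ^ q * (CE * (2 * t ^ q * Y)))).
    rewrite leq_mul2l; apply/orP; right; apply: leq_trans errM _.
    by rewrite leq_mul2l N1 orbT.
  by rewrite eq_leq //; clear; move: (t ^ q) (q) => *; nat_lia.
have g3 : q * (beta * b ^ q) <= t ^ q * (w * Y * (beta + 4)).
  have -> : b ^ q = b * b ^ (q - 1) by apply: expn_pred_mul; apply: ltnW.
  apply: (@leq_trans (b * ((beta + 4) * (t ^ q * Y)))).
    have -> : q * (beta * (b * b ^ (q - 1))) = b * (beta * (q * b ^ (q - 1))).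
      by clear; move: (b ^ (q - 1)) => z; clearbody b; move: (q) => x; nat_lia.
    by rewrite leq_mul2l N2 orbT.
  apply: (@leq_trans (w * ((beta + 4) * (t ^ q * Y)))); first by rewrite leq_mul2r bw orbT.
  by rewrite eq_leq //; clear; move: (t ^ q) => *; nat_lia.
have g4 : q * ((w - b) * X) <= t ^ q * (w * Y * (2 * q)).
  apply: (@leq_trans (q * (w * (2 * t ^ q * Y)))).
    by rewrite leq_mul2l leq_mul ?orbT // leq_subr.
  by rewrite eq_leq //; clear; move: (t ^ q) (q) => *; nat_lia.
have g5 : q * (C2 * X) <= t ^ q * (2 * q * C2 * Y).
  apply: (@leq_trans (q * (C2 * (2 * t ^ q * Y)))); first by rewrite !leq_mul2l N1 !orbT.
  by rewrite eq_leq //; clear; move: (t ^ q) (q) => *; nat_lia.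
have g6 : q * (beta * t ^ q * q`! * #|loose E M|) <= q * (beta * b ^ q) + q * ((w - b) * X) + q * (C2 * X).
  by rewrite -!mulnDr leq_mul2l H1' orbT.
have g7 : t ^ q * (beta * q * (a * N ^ q + f ^ q)) <=
   beta * q * t ^ q * (q`! * (#|M| * star_error E n M)) + q * (beta * t ^ q * q`! * #|loose E M|) +
   t ^ q * (beta * q * (c' * (2 * t ^ 2 + 1)) * Y).
  have -> : beta * q * t ^ q * (q`! * (#|M| * star_error E n M)) + q * (beta * t ^ q * q`! * #|loose E M|) +
     t ^ q * (beta * q * (c' * (2 * t ^ 2 + 1)) * Y) =
     t ^ q * (beta * q * (q`! * (#|M| * star_error E n M + #|loose E M|) + c' * (2 * t ^ 2 + 1) * Y)).
    clear; move: (t ^ q) (q) (q`!) (#|M| * _) (#|loose _ _|) (c' * _) => *; nat_lia.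
  by rewrite leq_mul2l leq_mul2l g1 !orbT.
apply: leq_trans g7 _; apply: leq_trans (leq_add (leq_add g2 (leq_trans g6 (leq_add (leq_add g3 g4) g5))) (leqnn _)) _.
rewrite eq_leq // /CC; clear; clearbody C2 CE c' Y.
move: (t ^ q) (q) (c' * _) => x1 x2 x3; nat_lia.
Qed.

(** * Comparing two stars *)

(** Besides the shift of g points the larger star gives up c0 points to make
    room for centres. *)
Lemma shift_gain x y g c0 n : g <= y -> y <= x -> x + g <= n ->
  'C(x, q) + 'C(y, q) + 'C(g, q) <= 'C(x + g - c0, q) + 'C(y - g, q) + c0 * n ^ (q - 1).
Proof.
move=> gy yx xgn; have q2 := q_ge2; have q0 : 0 < q by nat_lia.
have := @bin_shift q x (y - g) g q2; rewrite subnK // => /(_ yx).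
have := @bin_drop q (x + g) c0 n q0 xgn; clear.
move: ('C(x, _)) ('C(y, _)) ('C(g, _)) ('C(_ - _, _)) ('C(_ - _, _)) ('C(_, _)) (_ * _ ^ _) => *.
nat_lia.
Qed.

Section TwoStars.
Variables (V : finType) (E : {set {set V}}) (n m N : nat).
Hypothesis st : extremal_data E n m N.
Variable M : {set {set V}}.
Hypothesis hM : centers E n M.
Local Notation D := (max_degree E).
Local Notation P := (core_of E n).
Local Notation w := #|outside E n M|.

Lemma loose_card_le : #|loose E M| <= 'C(w, q) + K * w ^ (q - 1).
Proof.
apply: J_card_le => //; first exact: (loose_J (st_J st) M).
by move=> e; apply: (loose_sub (st_J st) (st_V st) hM).
Qed.

Lemma sum_two_split (i j : {set V}) (F : {set V} -> nat) : i \in M -> j \in M -> i != j ->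
  \sum_(C in M) F C = F i + F j + \sum_(C in M | (C != i) && (C != j)) F C.
Proof.
move=> iM jM ij; rewrite (bigD1 i) //= (bigD1 j) /=; last by rewrite jM eq_sym.
by rewrite addnA; congr (_ + _); apply: eq_bigl => C; rewrite andbA.
Qed.

Lemma exchange_two (i j : {set V}) (ai aj : nat) : i \in M -> j \in M -> i != j -> w < N ->
  ai + aj + s * (#|M| + 1) <= #|P i| + #|P j| ->
  minn D.-1 'C(ai, q) + minn D.-1 'C(aj, q) +
    \sum_(C in M | (C != i) && (C != j)) minn D.-1 'C(minn #|P C| N, q) + 'C(w, q) < m.
Proof.
move=> iM jM ij wN le.
have ji : j != i by rewrite eq_sym.
pose a C := if C == i then ai else if C == j then aj else minn #|P C| N.
have h := @exchange V E n m (st_cl st) M a [:: w].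
have split2 F := sum_two_split F iM jM ij.
rewrite !big_seq1 (minn_small (st_Nlt st)) // in h.
have : \sum_(C in M) (a C + s) + (w + s) <= n.
  rewrite big_split /= sum_nat_const -[X in _ <= X](cores_card (st_J st) (st_V st) hM).
  rewrite (split2 a) (split2 (fun C => #|P C|)) {1 2}/a !eqxx (negPf ji).
  have : \sum_(C in M | (C != i) && (C != j)) a C <= \sum_(C in M | (C != i) && (C != j)) #|P C|.
    by apply: leq_sum => C /and3P[_ ni nj]; rewrite /a (negPf ni) (negPf nj) geq_minl.
  move: le; rewrite [s * _]mulnC mulnDl mul1n; clear; move: (#|M| * _) => x.
  move: (\sum_(_ in _ | _) _) (\sum_(_ in _ | _) _) => *; nat_lia.
move=> /h; rewrite split2 {1 2}/a !eqxx (negPf ji).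
rewrite (eq_bigr (fun C => minn D.-1 'C(minn #|P C| N, q))) //.
by move=> C /and3P[_ ni nj]; rewrite /a (negPf ni) (negPf nj).
Qed.

Lemma edges_le_two (i j : {set V}) (b : nat) : i \in M -> j \in M -> i != j ->
  #|star_of E i :|: star_of E j| <= b ->
  m <= b + \sum_(C in M | (C != i) && (C != j)) minn D.-1 'C(minn #|P C| N, q) +
    #|M| * star_error E n M + ('C(w, q) + K * w ^ (q - 1)).
Proof.
move=> iM jM ij hb; apply: (@leq_trans (b + \sum_(C in M | (C != i) && (C != j)) #|star_of E C| + #|loose E M|)).
  rewrite -(st_E st); apply: leq_trans (leq_add (leq_add hb (card_bigcup_le _ _)) (leqnn _)).
  apply: leq_trans (leq_add (leq_card_setU _ _) (leqnn _)).
  apply: leq_trans (leq_card_setU _ _); apply: subset_leq_card; apply/subsetP => e eE.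
  rewrite !in_setU; have [hl|/forall_inPn[C CM]] := boolP [forall C in M, ~~ (C \subset e)].
    by rewrite [e \in loose _ _]inE eE hl orbT.
  rewrite negbK => Ce; have eC : e \in star_of E C by rewrite inE eE.
  have [<-|Ci] := eqVneq C i; first by rewrite eC.
  have [<-|Cj] := eqVneq C j; first by rewrite eC orbT.
  have -> : e \in \bigcup_(C in M | (C != i) && (C != j)) star_of E C by apply/bigcupP; exists C; rewrite ?CM ?Ci ?Cj.
  by rewrite orbT.
apply: leq_add; last exact: loose_card_le.
rewrite -addnA leq_add2l -sum_nat_const; apply: (@leq_trans
  (\sum_(C in M | (C != i) && (C != j)) (minn D.-1 'C(minn #|P C| N, q) + star_error E n M))).
  apply: leq_sum => C /andP[CM _].
  exact: (star_of_error (st_J st) (st_V st) (st_D st) (st_Nge st) (st_Nlt st) hM CM).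
rewrite big_split /= leq_add2l [X in _ <= X](bigID (fun C => (C != i) && (C != j))) /= leq_addr //.
Qed.

End TwoStars.

(** The gain C(g, q) of a shift is of order n^q if g is linear in n, whereas
    all errors are of order n^(q-1). *)
Lemma no_profitable_shift B B' : 0 < B' -> exists n0, forall (V : finType) (E : {set {set V}}) n m N
    (M : {set {set V}}) i j g,
  extremal_data E n m N -> centers E n M -> n0 <= n ->
  (forall C, C \in M -> n <= B * #|core_of E n C|) -> #|outside E n M| < N ->
  i \in M -> j \in M -> i != j ->
  #|core_of E n j| <= #|core_of E n i| -> g <= #|core_of E n j| ->
  #|core_of E n i| + g < N -> n <= B' * g -> False.
Proof.
move=> B'0; have q2 := q_ge2; have q0 : 0 < q by nat_lia.
pose Cg := s * (B + 1) + B * (1 + A + B) + K.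
exists (B' * (q`! * Cg * B' ^ (q - 1) + q * q) + 1) => V E n m N M i j g st hM nbig hB wN.
move=> iM jM ij le gy gN ng.
have [n0 nb] : 0 < n /\ B' * (q`! * Cg * B' ^ (q - 1) + q * q) < n.
  by move: nbig; clear; move: (B' * _) => x; nat_lia.
have MB : #|M| <= B := few_cores st hM n0 hB.
set x := #|core_of E n i| in gN le *; set y := #|core_of E n j| in gy le *.
pose c0 := s * (#|M| + 1).
have xy_n : x + y <= n.
  rewrite -[X in _ <= X](cores_card (st_J st) (st_V st) hM) (bigD1 i) //= (bigD1 j) /=.
    by rewrite addnA -addnA leq_addr.
  by rewrite jM eq_sym.
have big := bin_big q0 ng nb.
have X0 : c0 <= Cg * n ^ (q - 1).
  apply: (@leq_trans (s * (B + 1))); first by rewrite leq_mul2l leq_add2r MB orbT.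
  apply: (@leq_trans Cg); first by rewrite /Cg -addnA leq_addr.
  by rewrite leq_pmulr // expn_gt0 n0.
have c0g : c0 <= g.
  have [//|lt] := leqP c0 g.
  exfalso.
  have : g < s * (B + 1) by apply: leq_trans lt _; rewrite leq_mul2l leq_add2r MB orbT.
  move=> lt2.
  have : n <= B' * (s * (B + 1)) by apply: leq_trans ng _; rewrite leq_mul2l ltnW ?orbT.
  apply/negP; rewrite -ltnNge; apply: leq_ltn_trans nb; rewrite leq_mul2l; apply/orP; right.
  apply: (@leq_trans Cg); first by rewrite /Cg -addnA leq_addr.
  apply: (@leq_trans (q`! * Cg * B' ^ (q - 1))); last exact: leq_addr.
  by rewrite -mulnA mulnCA leq_pmulr // muln_gt0 fact_gt0 expn_gt0 B'0.
have mv := exchange_two st hM iM jM ij wN.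
have := mv (x + g - c0) (y - g).
rewrite !(minn_small (st_Nlt st)); last first.
- by apply: leq_ltn_trans gN; apply: leq_subr.
- by move: le gN; clear; clearbody x y; nat_lia.
have fits : x + g - c0 + (y - g) + s * (#|M| + 1) <= x + y.
  by rewrite -/c0; move: c0g gy; clear; clearbody x y c0; nat_lia.
move=> /(_ fits) lt1.
have := edges_le M (st_E st) => m_le.
have hx : minn #|core_of E n i| N = x.
  by apply/minn_idPl; rewrite -/x; move: gN; clear; clearbody x; nat_lia.
have hy : minn #|core_of E n j| N = y.
  by apply/minn_idPl; rewrite -/y; move: gN le; clear; clearbody x y; nat_lia.
have {}m_le : m <= 'C(x, q) + 'C(y, q) +
   \sum_(C in M | (C != i) && (C != j)) minn (max_degree E).-1 'C(minn #|core_of E n C| N, q) +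
   #|M| * star_error E n M + ('C(#|outside E n M|, q) + K * #|outside E n M| ^ (q - 1)).
  apply: leq_trans m_le _; apply: leq_add; last exact: (loose_card_le st hM).
  have := sum_two_split (fun C => minn (max_degree E).-1 'C(minn #|core_of E n C| N, q)) iM jM ij.
  rewrite hx hy !(minn_small (st_Nlt st)).
  - move=> <-; rewrite -sum_nat_const -big_split /=; apply: leq_sum => C CM.
    exact: (star_of_error (st_J st) (st_V st) (st_D st) (st_Nge st) (st_Nlt st) hM CM).
  - by move: gN le; clear; clearbody x y; nat_lia.
  - by move: gN; clear; clearbody x; nat_lia.
have shg := @shift_gain x y g c0 n gy le ltac:(by apply: leq_trans xy_n; rewrite leq_add2l).
have errM : #|M| * star_error E n M <= B * (1 + A + B) * n ^ (q - 1).
  by rewrite -mulnA leq_mul // (star_error_le st n0 MB).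
have wX : K * #|outside E n M| ^ (q - 1) <= K * n ^ (q - 1).
  by rewrite leq_mul2l leq_exp ?orbT // -[X in _ <= X](st_V st) max_card.
have c0X : c0 * n ^ (q - 1) <= s * (B + 1) * n ^ (q - 1).
  by rewrite leq_mul2r leq_mul2l leq_add2r MB !orbT.
move: big; rewrite /Cg 2!(mulnDl _ _ (n ^ (q - 1))).
move: lt1 m_le shg errM wX c0X; clear.
move: (n ^ (q - 1)) (#|M| * star_error _ _ _) (K * _ ^ _) => X e1 e2.
move: (c0 * X) (s * (B + 1) * X) (B * (1 + A + B) * X) (K * X) => x1 x2 x3 x4.
move: ('C(x + g - c0, q)) ('C(y - g, q)) ('C(g, q)) ('C(x, q)) ('C(y, q)) ('C(_, q)) (\sum_(_ in _ | _) _) => *.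
nat_lia.
Qed.

Lemma full_size_ge2 n N : n <= 2 * t ^ 2 * N -> 8 * t ^ 2 < n -> 2 <= N.
Proof.
move=> h1 h2; have : t ^ 2 * 8 < t ^ 2 * (2 * N).
  by rewrite mulnC mulnA [t ^ 2 * 2]mulnC; apply: leq_trans h1.
by rewrite ltn_pmul2l ?expn_gt0; move: ht; clear; nat_lia.
Qed.

(** Half of a full size leaves room for a linear shift. *)
Lemma nonfull_core_unique B : exists n0, forall (V : finType) (E : {set {set V}}) n m N (M : {set {set V}}) i j,
  extremal_data E n m N -> centers E n M -> n0 <= n -> n <= 2 * t ^ 2 * N ->
  (forall C, C \in M -> n <= B * #|core_of E n C|) -> #|outside E n M| < N ->
  i \in M -> j \in M -> i != j ->
  2 * #|core_of E n i| < N -> 2 * #|core_of E n j| < N -> False.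
Proof.
have B'0 : 0 < B + 8 * t ^ 2 by rewrite addn_gt0 muln_gt0 expn_gt0; move: ht; clear; nat_lia.
have [n1 hn1] := no_profitable_shift B B'0.
exists (n1 + 8 * t ^ 2 + 1) => V E n m N M i j st hM nbig nN hB wN.
have [n1n nt] : n1 <= n /\ 8 * t ^ 2 < n by move: nbig; clear; move: (8 * _) => x; nat_lia.
have N2 := full_size_ge2 nN nt.
wlog le : i j / #|core_of E n j| <= #|core_of E n i| => [wl|].
  move=> iM jM ij hi hj; have [le|/ltnW le] := leqP #|core_of E n j| #|core_of E n i|.
    exact: (wl i j).
  by apply: (wl j i) => //; rewrite eq_sym.
move=> iM jM ij hi hj.
apply: (hn1 V E n m N M i j (minn #|core_of E n j| (N - 1 - #|core_of E n i|))) => //.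
- exact: geq_minl.
- by move: hi N2; clear; move: #|_| #|_| => x y; nat_lia.
have h1 : n <= B * #|core_of E n j| by apply: hB.
have h3 : n <= 8 * t ^ 2 * (N - 1 - #|core_of E n i|).
  have h2 : N <= 4 * (N - 1 - #|core_of E n i|) by move: hi N2; clear; move: #|_| => x; nat_lia.
  apply: leq_trans nN _; apply: (@leq_trans (2 * t ^ 2 * (4 * (N - 1 - #|core_of E n i|)))).
    by rewrite leq_mul2l h2 orbT.
  by rewrite eq_leq //; clear; move: (t ^ 2) (_ - _) => z u; nat_lia.
rewrite mulnDl; have [_|_] := leqP #|core_of E n j| (N - 1 - #|core_of E n i|).
  by apply: leq_trans h1 (leq_addr _ _).
by apply: leq_trans h3 (leq_addl _ _).
Qed.

(** Both stars together have at most D edges. If their cores are large enough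
    for a full star and a star of linear size, this competitor is better.
    Otherwise a shift is profitable. *)
Lemma centers_disjoint B : exists n0, forall (V : finType) (E : {set {set V}}) n m N (M : {set {set V}}) i j,
  extremal_data E n m N -> centers E n M -> n0 <= n -> n <= 2 * t ^ 2 * N ->
  (forall C, C \in M -> n <= B * #|core_of E n C|) -> #|outside E n M| < N ->
  i \in M -> j \in M -> i != j -> [disjoint i & j].
Proof.
have q2 := q_ge2; have q0 : 0 < q by nat_lia.
have [n1 hn1] := @no_profitable_shift B (4 * B + 1) ltac:(by rewrite addn1).
pose B' := 4 * B + 4 * t ^ 2.
pose Cg := 1 + B * (1 + A + B) + K.
exists (n1 + 8 * t ^ 2 + B * (4 * (s * (B + 1)) + 4) + B' * (q`! * Cg * B' ^ (q - 1) + q * q) + 1).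
move=> V E n m N M i j st hM nbig nN hB wN.
have [[n1n nt] ny nb n0] : [/\ n1 <= n /\ 8 * t ^ 2 < n, B * (4 * (s * (B + 1)) + 4) < n,
    B' * (q`! * Cg * B' ^ (q - 1) + q * q) < n & 0 < n].
  by move: nbig; clear; move: (8 * _) (B * _) (B' * _) => x y z; split; nat_lia.
have N2 := full_size_ge2 nN nt.
have MB : #|M| <= B := few_cores st hM n0 hB.
wlog le : i j / #|core_of E n j| <= #|core_of E n i| => [wl|].
  move=> iM jM ij; have [le|/ltnW le] := leqP #|core_of E n j| #|core_of E n i|.
    exact: (wl i j).
  by rewrite disjoint_sym; apply: (wl j i) => //; rewrite eq_sym.
move=> iM jM ij; apply/negPn/negP; rewrite -setI_eq0 => /set0Pn[v]; rewrite inE => /andP[vi vj].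
have cD : #|star_of E i :|: star_of E j| <= max_degree E.
  apply: leq_trans (leq_bigmax v); apply: subset_leq_card; apply/subsetP => e.
  by rewrite !inE => /orP[] /andP[-> /subsetP sub]; rewrite sub.
set x := #|core_of E n i| in le *; set y := #|core_of E n j| in le *.
have ny' : n <= B * y by apply: hB.
have yc : 4 * (s * (#|M| + 1)) + 4 < y.
  have : 4 * (s * (B + 1)) + 4 < y.
    rewrite ltnNge; apply/negP => h; have : B * y <= B * (4 * (s * (B + 1)) + 4) by rewrite leq_mul2l h orbT.
    by move/(leq_trans ny'); rewrite leqNgt ny.
  by apply: leq_ltn_trans; rewrite leq_add2r leq_mul2l leq_mul2l leq_add2r MB !orbT.
set c0 := s * (#|M| + 1) in yc.
(* Either half of the smaller core can be shifted to the larger one without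
   making it full, or the two cores can be replaced by a full star and a star
   with about y / 2 body vertices. *)
have [xN|xN] := ltnP (x + y %/ 2) N.
  apply: (hn1 V E n m N M i j (y %/ 2)) => //; first by apply: leq_div.
  rewrite mulnDl mul1n; apply: leq_trans ny' _; apply: leq_trans (leq_addr _ _).
  rewrite -mulnA mulnCA leq_mul2l; apply/orP; right.
  by move: yc; clear; clearbody y c0; nat_lia.
have mv := @exchange_two V E n m N st M hM i j N (minn (y - y %/ 2 - c0) (N - 1)) iM jM ij wN.
have fits : N + minn (y - y %/ 2 - c0) (N - 1) + s * (#|M| + 1) <= x + y.
  rewrite -/c0; apply: (@leq_trans (N + (y - y %/ 2 - c0) + c0)).
    by rewrite leq_add2r leq_add2l geq_minl.
  by move: yc xN; clear; clearbody x y c0; nat_lia.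
have {}mv := mv fits.
rewrite (minn_large (st_Nge st)) // (minn_small (st_Nlt st)) in mv; last first.
  by move: N2; clear; move: (y - _ - _) => u; nat_lia.
have := edges_le_two st hM iM jM ij cD => ml.
set g := minn _ _ in mv.
have ng : n <= B' * g.
  have h1 : n <= 4 * B * (y - y %/ 2 - c0).
    apply: leq_trans ny' _; rewrite -mulnA mulnCA leq_mul2l; apply/orP; right.
    by move: yc; clear; clearbody y c0; nat_lia.
  have h2 : n <= 4 * t ^ 2 * (N - 1).
    apply: leq_trans nN _; apply: (@leq_trans (2 * t ^ 2 * (2 * (N - 1)))).
      by rewrite leq_mul2l; apply/orP; right; move: N2; clear; nat_lia.
    by rewrite eq_leq //; clear; move: (t ^ 2) (_ - _) => z u; nat_lia.
  rewrite /B' mulnDl /g; have [_|_] := leqP (y - y %/ 2 - c0) (N - 1).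
    by apply: leq_trans h1 (leq_addr _ _).
  by apply: leq_trans h2 (leq_addl _ _).
have big := bin_big q0 ng nb.
have errM : #|M| * star_error E n M <= B * (1 + A + B) * n ^ (q - 1).
  by rewrite -mulnA leq_mul // (star_error_le st n0 MB).
have wX : K * #|outside E n M| ^ (q - 1) <= K * n ^ (q - 1).
  by rewrite leq_mul2l leq_exp ?orbT // -[X in _ <= X](st_V st) max_card.
have X0 : 0 < n ^ (q - 1) by rewrite expn_gt0 n0.
move: big; rewrite /Cg 2!(mulnDl _ _ (n ^ (q - 1))) mul1n.
have D0 := st_D st.
move: mv ml errM wX X0 D0; clear.
move: (n ^ (q - 1)) (#|M| * star_error _ _ _) (K * _ ^ _) => X e1 e2.
move: (B * (1 + A + B) * X) (K * X) (max_degree E) => x3 x4 D.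
move: ('C(_, q)) ('C(g, q)) (\sum_(_ in _ | _) _) => *.
nat_lia.
Qed.

(** * Second-order comparison *)

(** Room for the centres of |M| + 1 stars and for one extra vertex in each
    core. *)
Definition slack k1 := s * (k1 + 1) + k1 + 1.

(** Enlarging a core of size x < N - 1 by a vertex gains C(x, q-1), a fixed
    fraction of n^(q-1). The errors are at most w n^(q-2) and w^(q-1) up to
    constants, hence a smaller fraction when w is a small fraction of n. Once
    all cores have at least N - 1 vertices, the competitor with stars of size
    N and one more star on the outside vertices gives the lower bound for m. *)
Lemma cores_full k1 : exists k2 n0, forall (V : finType) (E : {set {set V}}) n m N (M : {set {set V}}),
  extremal_data E n m N -> centers E n M -> n0 <= n ->
  (forall C, C \in M -> n <= k1 * #|core_of E n C|) ->
  k2 * #|outside E n M| <= n -> #|outside E n M| < N -> slack k1 <= #|outside E n M| ->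
  (forall C, C \in M -> N <= #|core_of E n C|.+1) /\
  #|M| * (max_degree E).-1 + 'C(#|outside E n M| - slack k1, q) < m.
Proof.
have q2 := q_ge2; have q0 : 0 < q by nat_lia.
have q1 : 0 < q - 1 by nat_lia.
pose c := slack k1; pose G := k1 ^ (q - 1) * (2 * (q - 1)`!).
pose Lc := k1 * (A + 1) + K + c; pose k2 := G * Lc + 1.
exists k2, (k2 * (1 + k1) + k1 * (2 * ((q - 1) * (q - 1)) + q) + 1).
move=> V E n m N M st hM nbig hB wn wN cw; set w := #|outside _ _ _| in wn wN cw *.
have [n0 nk nx] : [/\ 0 < n, k2 * (1 + k1) <= n & k1 * (2 * ((q - 1) * (q - 1)) + q) < n].
  by move: nbig; clear; move: (k2 * _) (k1 * _) => x y; split; nat_lia.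
have MB : #|M| <= k1 := few_cores st hM n0 hB.
have sM : s * #|M| + s + #|M| + 1 <= c.
  rewrite /c /slack mulnDr muln1 leq_add2r; apply: leq_add => //.
  by rewrite leq_add2r leq_mul2l MB orbT.
have c0 : 0 < c by rewrite /c /slack addn1.
have sumP := cores_card (st_J st) (st_V st) hM; rewrite -/w in sumP.
have wcN : w - c < N by move: c0 cw wN; rewrite -/c; clear; clearbody c w; nat_lia.
suff hN C : C \in M -> N <= #|core_of E n C|.+1.
  split=> //.
  have := @exchange V E n m (st_cl st) M (fun=> N) [:: w - c].
  rewrite !big_seq1 !sum_nat_const (minn_large (st_Nge st)) // (minn_small (st_Nlt st)) //.
  apply; rewrite -sumP mulnDr.
  have : #|M| * N <= \sum_(C in M) #|core_of E n C| + #|M|.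
    rewrite -sum_nat_const -[X in _ + X]sum1_card -big_split /=; apply: leq_sum => C CM.
    by rewrite addn1 hN.
  move: sM cw; rewrite -/c [#|M| * s]mulnC; clear; clearbody c w.
  move: (s * #|M|) (#|M| * N) (\sum_(_ in _) _) => *; nat_lia.
move: C => i iM; rewrite leqNgt; apply/negP => iN.
set x := #|core_of E n i| in iN *.
pose a C := if C == i then x.+1 else minn #|core_of E n C| N.
have mv := @baseline_move V E n m N st M hM a [:: w - c].
have xN : minn x N = x by apply/minn_idPl; move: iN; clear; clearbody x; nat_lia.
have fits : \sum_(C in M) (a C + s) + \sum_(x <- [:: w - c]) (x + s) <= n.
  rewrite big_seq1 big_split /= sum_nat_const -sumP (bigD1 i) //= [\sum_(C in M) #|_|](bigD1 i) //= {1}/a eqxx.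
  have : \sum_(C in M | C != i) a C <= \sum_(C in M | C != i) #|core_of E n C|.
    by apply: leq_sum => C /andP[_ ni]; rewrite /a (negPf ni) geq_minl.
  move: sM cw; rewrite -/c -/x [#|M| * s]mulnC; clear; clearbody c w x.
  move: (s * #|M|) (\sum_(_ in _ | _) _) (\sum_(_ in _ | _) _) => *; nat_lia.
have {}mv := mv fits.
have loose_le : #|loose E M| <= 'C(w - c, q) + (c + K) * w ^ (q - 1).
  apply: (@leq_trans ('C(w, q) + K * w ^ (q - 1))).
    apply: J_card_le => //; first exact: (loose_J (st_J st) M).
    by move=> e; apply: (loose_sub (st_J st) (st_V st) hM).
  rewrite mulnDl addnA leq_add2r.
  have := bin_add_le (q - 1) (w - c) c; rewrite subnK //.
  by rewrite (_ : (q - 1).+1 = q) //; move: q0; clear; nat_lia.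
have small : 'C(x, q - 1) < #|M| * star_error E n M + (c + K) * w ^ (q - 1).
  move: mv loose_le; rewrite big_seq1 (minn_small (st_Nlt st) wcN).
  rewrite (bigD1 i) //= [\sum_(C in M) minn _ 'C(minn _ _, _)](bigD1 i) //= {1}/a eqxx -/x xN.
  rewrite (minn_small (st_Nlt st) iN) (minn_small (st_Nlt st)); last by apply: ltnW.
  rewrite (eq_bigr (fun C => minn (max_degree E).-1 'C(minn #|core_of E n C| N, q))).
    have -> : 'C(x.+1, q) = 'C(x, q) + 'C(x, q - 1).
      by case: (q) q0 => // q' _; rewrite binS subn1.
    clear; move: ('C(w - c, q)) ('C(x, q)) ('C(x, q - 1)) (\sum_(_ in _ | _) _) (#|M| * _) ((c + K) * _) => *.
    nat_lia.
  by move=> C /andP[_ ni]; rewrite /a (negPf ni).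
have ni : n <= k1 * x by apply: hB.
have k10 : 0 < k1 by case: (k1) ni n0 => //; rewrite mul0n; clear; nat_lia.
have xbig : 2 * ((q - 1) * (q - 1)) + q < x.
  by rewrite -(ltn_pmul2l k10); apply: leq_trans ni.
have xC := @exp_le_bin2 (q - 1) x q1 ltac:(by move: xbig; clear; move: (_ * _) => y; nat_lia).
have XG : n ^ (q - 1) <= G * 'C(x, q - 1).
  rewrite /G -mulnA; apply: leq_trans (leq_exp _ ni) _.
  by rewrite expnMn leq_mul2l xC orbT.
have C0 : 0 < 'C(x, q - 1) by rewrite bin_gt0; move: xbig; clear; move: (_ * _) => y; nat_lia.
have eX : n ^ (q - 1) = n * n ^ (q - 2).
  by rewrite (expn_pred_mul _ q1) -subnDA.
have X20 : 0 < n ^ (q - 2) by rewrite expn_gt0 n0.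
have errX : k2 * star_error E n M <= (A + 1) * n ^ (q - 1).
  rewrite /star_error -/w eX.
  have g1 : n ^ (q - 2) * (k2 * w) <= n ^ (q - 2) * n by rewrite leq_mul2l wn orbT.
  have g2 : k2 * (1 + #|M|) * n ^ (q - 2) <= n * n ^ (q - 2).
    rewrite leq_mul2r; apply/orP; right; apply: leq_trans nk.
    by rewrite leq_mul2l leq_add2l MB orbT.
  have g3 : A * (n ^ (q - 2) * (k2 * w)) <= A * (n ^ (q - 2) * n) by rewrite leq_mul2l g1 orbT.
  have g4 : k2 * 1 <= k2 * n ^ (q - 2) by rewrite leq_mul2l X20 orbT.
  move: g2 g3 g4; clear; clearbody k2 w; move: (n ^ (q - 2)) #|M| (A) => X y z.
  nia.
have wX : k2 * w ^ (q - 1) <= n ^ (q - 1).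
  rewrite (expn_pred_mul _ q1) mulnA [in X in _ <= X](expn_pred_mul _ q1) leq_mul //.
  by apply: leq_exp; rewrite -sumP leq_addl.
have k20 : 0 < k2 by rewrite /k2 addn1.
have : k2 * 'C(x, q - 1) < k2 * (#|M| * star_error E n M + (c + K) * w ^ (q - 1)) by rewrite ltn_pmul2l.
rewrite ltnNge => /negP; apply.
have g5 : #|M| * (k2 * star_error E n M) <= k1 * ((A + 1) * n ^ (q - 1)) by apply: leq_mul.
have g6 : (c + K) * (k2 * w ^ (q - 1)) <= (c + K) * n ^ (q - 1) by rewrite leq_mul2l wX orbT.
rewrite mulnDr mulnCA [k2 * (_ * _ ^ _)]mulnCA; apply: leq_trans (leq_add g5 g6) _.
apply: (@leq_trans (Lc * n ^ (q - 1))).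
  by rewrite eq_leq // /Lc [c + K]addnC -!addnA [in RHS]mulnDl !mulnA.
apply: (@leq_trans (Lc * (G * 'C(x, q - 1)))); first by rewrite leq_mul2l XG orbT.
by rewrite mulnA [Lc * G]mulnC leq_mul2r /k2 leq_addr orbT.
Qed.

(** In the decomposition, bodies and blocks that all are bounded away from w
    would hold only a fraction of w^q / q! edges, so one body contains nearly
    all of W. Its core P misses h vertices. First h is a small fraction of w,
    by comparing leading terms. Then every missed vertex costs C(|P|, q-1)
    edges and returns only th + O(h^(q-1)), so that h is bounded. *)
Lemma near_complete c6 kap : exists c7 Kw, forall (V : finType) (G : {set {set V}}) (W : {set V}),
  class_J r t G -> (forall e, e \in G -> e \subset W) -> Kw <= #|W| ->
  'C(#|W| - c6, q) < #|G| + kap ->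
  exists C P, [/\ heavy_pair G C P, P \subset W & #|W| <= #|P| + c7].
Proof.
have q2 := q_ge2; have q0 : 0 < q by nat_lia.
have q1 : 0 < q - 1 by nat_lia.
(* G2 C(|P|, q-1) is at least w^(q-1) once |P| >= w / 2, and z is the factor
   by which the missed part of W has to be small for (1 + K) h^q to be
   absorbed. *)
pose G2 := 2 ^ (q - 1) * (2 * (q - 1)`!); pose z := 8 * G2 * (1 + K).
have G20 : 0 < G2 by rewrite !muln_gt0 expn_gt0 fact_gt0.
have z0 : 0 < z by rewrite /z muln_gt0 (muln_gt0 8) G20.
have z8 : 8 <= z by rewrite /z -mulnA leq_pmulr // (muln_gt0 G2) G20.
pose c' := q * q + q * c6; pose C1 := q`! * (A + K + kap) + c'.
pose c7 := 2 * c6 + 1.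
exists c7, (z * (q`! * (K + kap) + c') + z * C1 + 4 * G2 * (kap + A) + 4 * ((q - 1) * (q - 1)) + 1).
move=> V G W GJ GW wbig big; set w := #|W| in wbig big *.
have [w1 w2 w3 [w4 w0]] : [/\ z * (q`! * (K + kap) + c') < w, z * C1 < w, 4 * G2 * (kap + A) < w
   & 4 * ((q - 1) * (q - 1)) < w /\ 0 < w].
  move: wbig; clear; move: (z * (q`! * (K + kap) + c')) (z * C1) (4 * G2 * (kap + A)) (4 * ((q - 1) * (q - 1))) => x1 x2 x3 x4.
  by split; [nat_lia|nat_lia|nat_lia|split; nat_lia].
clear wbig.
set X := w ^ (q - 1).
have X0 : 0 < X by rewrite expn_gt0 w0.
have wq : w ^ q = w * X := expn_pred_mul w q0.
have low := @expn_shrink q w c6 q0; rewrite -/c' -/X in low.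
have c1 := decomposition_card GJ GW; have c2 := decomposition_space GJ GW.
set p := #|blocks G| in c1 c2; rewrite -/w -[q.-1]subn1 -/X in c1 c2.
pose d C := #|star_body G C|.
have {}c2 : t * p + \sum_(C : {set V} | #|C| == s) d C <= w by exact: c2.
have each (C : {set V}) : #|C| == s -> #|star_group G C| <= 'C(d C, q).
  by move=> /eqP cC; apply: star_group_card.
have p2w : z * p <= (z - 1) * w.
  have h : 2 * p <= w by apply: leq_trans c2; apply: leq_trans (leq_addr _ _); rewrite leq_mul2r ht orbT.
  by move: h z8; clear; clearbody z p w; nia.
have [/existsP[C /andP[/eqP cC dC]]|] := boolP [exists C : {set V}, (#|C| == s) && (z * (w - d C) < w)]; last first.
  rewrite negb_exists => /forallP hd; exfalso.
  have zpow x : z * x <= (z - 1) * w -> z * x ^ q <= (z - 1) * (x * X).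
    move=> zx; rewrite (expn_pred_mul x q0) (expn_pred_mul x q1).
    have xw : x <= w by move: zx z8; clear; clearbody z w; nia.
    rewrite /X (expn_pred_mul w q1).
    have h := @leq_exp x w (q - 1 - 1) xw.
    apply: (@leq_trans (x * (((z - 1) * w) * x ^ (q - 1 - 1)))).
      by rewrite mulnCA leq_mul2l mulnA leq_mul2r zx !orbT.
    apply: (@leq_trans (x * (((z - 1) * w) * w ^ (q - 1 - 1)))); first by rewrite !leq_mul2l h !orbT.
    by rewrite eq_leq //; clear; move: (w ^ _) (z - 1) => *; nat_lia.
  have h1 : z * (q`! * 'C(p, q)) <= (z - 1) * (p * X).
    by apply: leq_trans (zpow p p2w); rewrite leq_mul2l mulnC bin_fact_le orbT.
  have h2 : z * (q`! * \sum_(C : {set V} | #|C| == s) #|star_group G C|) <=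
      (z - 1) * ((\sum_(C : {set V} | #|C| == s) d C) * X).
    rewrite [q`! * _]big_distrr [z * _]big_distrr /=.
    rewrite [(\sum_(_ | _) d _) * _]big_distrl [(z - 1) * _]big_distrr /=; apply: leq_sum => C cC.
    apply: (@leq_trans (z * d C ^ q)).
      rewrite leq_mul2l; apply/orP; right; apply: leq_trans (bin_fact_le q _).
      by rewrite mulnC leq_mul2r each ?orbT.
    apply: zpow; have := hd C; rewrite cC /= -leqNgt.
    have : d C <= w by apply: subset_leq_card; apply: star_body_sub.
    by move: z8; clear; clearbody z w; move: (d C) => y; nia.
  have h3 : z * (w * X) <= (z - 1) * (w * X) + z * ((q`! * (K + kap) + c') * X).
    have h4 : q`! * 'C(w - c6, q) <= q`! * ('C(p, q) + \sum_(C : {set V} | #|C| == s) #|star_group G C| + K * X + kap).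
      by rewrite leq_mul2l; apply/orP; right; apply: ltnW; apply: leq_trans big _; rewrite leq_add2r.
    have h5 : q`! * kap * 1 <= q`! * kap * X by rewrite leq_mul2l X0 orbT.
    have h6 : (z - 1) * ((p + \sum_(C : {set V} | #|C| == s) d C) * X) <= (z - 1) * (w * X).
      rewrite leq_mul2l leq_mul2r; apply/orP; right; apply/orP; right.
      apply: leq_trans c2; rewrite leq_add2r leq_pmull //; move: ht; clear; nat_lia.
    have h7 : z * (w * X) <= z * (q`! * ('C(p, q) + \sum_(C : {set V} | #|C| == s) #|star_group G C| + K * X + kap) + c' * X).
      rewrite leq_mul2l; apply/orP; right; rewrite -wq; apply: leq_trans low _.
      by rewrite leq_add2r.
    apply: leq_trans h7 _.
    have h8 : z * (q`! * kap * 1) <= z * (q`! * kap * X) by rewrite leq_mul2l h5 orbT.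
    move: h1 h2 h6 h8; clear; clearbody X c' z p w.
    rewrite [(p + _) * X]mulnDl [(z - 1) * (_ + _)]mulnDr.
    move: ((z - 1) * (p * X)) ((z - 1) * (w * X)) ((z - 1) * (_ * X)) => y1 y2 y3.
    move: ('C(p, q)) (\sum_(_ | _) _) (q`!) => y4 y5 y6; nat_lia.
  have h4 : w * X <= z * ((q`! * (K + kap) + c') * X).
    move: h3; rewrite mulnBl mul1n; have : w * X <= z * (w * X) by rewrite leq_pmull.
    clear; move: (w * X) (z * (w * X)) (z * _) => *; nat_lia.
  rewrite mulnA leq_pmul2r // in h4; by move: w1; rewrite ltnNge h4.
have [dw sub_w] : d C <= w /\ star_body G C \subset W.
  by split; [apply: subset_leq_card; apply: star_body_sub | apply: star_body_sub].
pose th := A * w ^ (q - 2); pose P := peel G th C.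
have dCP : [disjoint C & P] := peel_disjoint _ _ _.
have w20 : 0 < w ^ (q - 2) by rewrite expn_gt0 w0.
have Apos : 0 < A by exact: (leq_ltn_trans _ heavy_factor_gt).
have PW : P \subset W.
  apply/subsetP => v vP; have := peel_deg vP; rewrite -/th => hdeg.
  have : 0 < star_deg G C (peel G th C) v by apply: leq_trans hdeg; rewrite muln_gt0 Apos.
  rewrite card_gt0 => /set0Pn[e]; rewrite inE => /andP[/star_inP[eG _ _] ve].
  exact: (subsetP (GW e eG)).
have XW2 : X = w * w ^ (q - 2) by rewrite /X (expn_pred_mul _ q1) -subnDA.
set h := #|W :\: P|.
have hP : #|P| + h = w by rewrite /h cardsD (setIidPr PW) subnKC // subset_leq_card.
have star_le : #|star_in G C (W :\: C)| <= 'C(#|P|, q) + th * h.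
  have sP : P \subset W :\: C.
    by rewrite subsetD PW disjoint_sym.
  have dW : [disjoint C & W :\: C].
    by rewrite -setI_eq0; apply/eqP/setP => v; rewrite !inE; case: (v \in C).
  apply: leq_trans (peel_count GJ cC sP dW) _.
  rewrite leq_add2l leq_mul2l; apply/orP; right; apply: subset_leq_card.
  by apply/subsetP => v; rewrite !inE => /and3P[-> _ ->].
have inStar e : e \in G -> C \subset e -> e \in star_in G C (W :\: C).
  move=> eG Ce; apply/star_inP; split=> //; apply/subsetP => v ve.
  by rewrite !inE (subsetP (GW e eG)) // andbT orbN.
have h_small : z * h <= 2 * w.
  pose h0 := w - d C.
  have rest_le : #|G| <= #|star_group G C| + 'C(h0, q) + K * X.
    apply: leq_trans c1 _; rewrite leq_add2r (bigD1 C) /=; last by rewrite cC.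
    rewrite addnCA leq_add2l.
    apply: (@leq_trans ('C(p, q) + 'C(\sum_(C' : {set V} | (#|C'| == s) && (C' != C)) d C', q))).
      rewrite leq_add2l; apply: leq_trans (bin_sum_le _ _ _ q0).
      by apply: leq_sum => C' /andP[cC' _]; apply: each.
    apply: leq_trans (bin_superadd _ _ q0) _; apply: leq_bin2l.
    move: c2; rewrite (bigD1 C) /=; last by rewrite cC.
    rewrite /h0; have : p <= t * p by rewrite leq_pmull //; move: ht; clear; nat_lia.
    clear; clearbody p w; move: (t * p) (d C) (\sum_(_ | _) _) => *; nat_lia.
  have grp_le : #|star_group G C| <= 'C(#|P|, q) + A * X.
    apply: (@leq_trans #|star_in G C (W :\: C)|).
      by apply: subset_leq_card; apply/subsetP => e /star_groupP[eG Ce _]; apply: inStar.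
    apply: leq_trans star_le _; rewrite leq_add2l /th XW2 -mulnA leq_mul2l mulnC leq_mul2r.
    by rewrite -hP leq_addl !orbT.
  have xle x : x <= w -> q`! * 'C(x, q) <= x * X.
    move=> xw; rewrite mulnC; apply: leq_trans (bin_fact_le q x) _.
    by rewrite (expn_pred_mul x q0) leq_mul2l leq_exp ?orbT.
  have l1 := xle #|P| ltac:(by rewrite -hP leq_addr).
  have l2 := xle h0 ltac:(by rewrite leq_subr).
  have l3 : q`! * 'C(w - c6, q) <= q`! * ('C(#|P|, q) + A * X + 'C(h0, q) + K * X + kap).
    rewrite leq_mul2l; apply/orP; right; apply: ltnW; apply: leq_trans big _; rewrite leq_add2r.
    by apply: leq_trans rest_le _; rewrite !leq_add2r.
  have l5 : q`! * kap * 1 <= q`! * kap * X by rewrite leq_mul2l X0 orbT.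
  have l4 : w * X <= (#|P| + h0 + C1) * X.
    rewrite -wq; apply: leq_trans low _; rewrite /C1.
    move: l1 l2 l3 l5; clear; clearbody X c' h0; move: #|P| ('C(_, _)) ('C(_, _)) ('C(_, _)) (q`!) => *.
    nat_lia.
  rewrite leq_pmul2r // in l4.
  have : z * h <= z * h0 + z * C1.
    by rewrite -mulnDr leq_mul2l; apply/orP; right; move: l4 hP; clear; clearbody w h0 C1 h; nat_lia.
  move: dC w2; rewrite -/h0; clear; move: (z * h) (z * h0) (z * C1) => *; nat_lia.
have P2w : w <= 2 * #|P|.
  by move: h_small hP z8; clear; clearbody z w h; move: #|P| => x; nia.
exists C, P; split=> //.
  apply: peel_heavy => //.
    by rewrite -card_gt0 -/P; move: P2w w0; clear; move: #|_| => x; nat_lia.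
  by rewrite -/P leq_mul2l leq_exp ?orbT // -hP leq_addr.
rewrite -hP leq_add2l leqNgt; apply/negP => c7h.
have split_le : #|G| <= 'C(#|P|, q) + th * h + (1 + K) * h ^ q.
  have cov : G \subset star_in G C (W :\: C) :|: [set e in G | ~~ (C \subset e)].
    apply/subsetP => e eG; rewrite inE [X in _ || X]inE eG /=.
    by have [/inStar->|] := boolP (C \subset e); rewrite ?orbT.
  apply: leq_trans (subset_leq_card cov) _; apply: leq_trans (leq_card_setU _ _) _.
  apply: leq_add => //.
  apply: (@leq_trans ('C(h, q) + K * h ^ (q - 1))).
    apply: J_card_le => //.
      by apply: class_J_sub GJ; apply/subsetP => e; rewrite inE => /andP[].
    move=> e; rewrite inE => /andP[eG nCe]; rewrite subsetD (GW e eG) /=.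
    apply: contraR nCe => nd; apply: (heavy_pair_edge GJ (P := P)) => //.
      apply: peel_heavy => //.
        by rewrite -card_gt0 -/P; move: P2w w0; clear; move: #|_| => x; nat_lia.
      by rewrite -/P leq_mul2l leq_exp ?orbT // -hP leq_addr.
    by rewrite disjoint_sym.
  rewrite mulnDl mul1n leq_add ?bin_le_exp // leq_mul2l; apply/orP; right.
  rewrite leq_pexp2l //; last by rewrite leq_subr.
  by move: c7h; clear; nat_lia.
have hc6 : c6 <= h by move: c7h; rewrite /c7; clear; nat_lia.
have gap : 'C(#|P|, q) + (h - c6) * 'C(#|P|, q - 1) <= 'C(w - c6, q).
  have := bin_add_ge (q - 1) #|P| (h - c6); rewrite addnBA // hP.
  by rewrite (_ : (q - 1).+1 = q) //; move: q0; clear; nat_lia.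
have XG : X <= G2 * 'C(#|P|, q - 1).
  rewrite /G2 -mulnA /X; apply: leq_trans (leq_exp _ P2w) _; rewrite expnMn leq_mul2l; apply/orP; right.
  by apply: exp_le_bin2 => //; move: w4 P2w; clear; move: (_ * (q - 1)) #|_| => *; nat_lia.
have main : (h - c6) * 'C(#|P|, q - 1) < kap + th * h + (1 + K) * h ^ q.
  move: gap big split_le; clear; move: ('C(_, _)) ('C(_, _)) (_ * 'C(_, _)) (_ * h) (_ * h ^ _) => *; nat_lia.
have h_gt0 : 0 < h by move: c7h; clear; nat_lia.
have hq : z * h ^ q <= h * (2 * X).
  rewrite (expn_pred_mul h q0) (expn_pred_mul h q1) XW2 mulnCA leq_mul2l; apply/orP; right.
  rewrite mulnA [2 * _]mulnA; apply: leq_mul; first exact: h_small.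
  by rewrite -subnDA; apply: leq_exp; rewrite -hP; apply: leq_addl.
have f1 : h * X <= 2 * G2 * (kap + th * h + (1 + K) * h ^ q).
  apply: (@leq_trans (2 * (h - c6) * (G2 * 'C(#|P|, q - 1)))).
    by apply: leq_mul => //; move: c7h; rewrite /c7; clear; nat_lia.
  have -> : 2 * (h - c6) * (G2 * 'C(#|P|, q - 1)) = 2 * G2 * ((h - c6) * 'C(#|P|, q - 1)).
    by clear; move: ('C(_, _)) (_ - _) => *; nat_lia.
  by rewrite leq_mul2l (ltnW main) orbT.
have f2 : z * (h * X) <= 2 * G2 * (z * kap * h * w ^ (q - 2) + z * A * h * w ^ (q - 2) + (1 + K) * (h * (2 * X))).
  apply: (@leq_trans (z * (2 * G2 * (kap + th * h + (1 + K) * h ^ q)))); first by rewrite leq_mul2l f1 orbT.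
  rewrite mulnCA leq_mul2l; apply/orP; right; rewrite (mulnDr z _ ((1 + K) * _)) (mulnDr z kap); apply: leq_add; last first.
    by rewrite mulnCA leq_mul2l hq orbT.
  apply: leq_add; last by rewrite /th eq_leq //; clear; move: (w ^ _) => *; nat_lia.
  by rewrite -[z * kap * h * _]mulnA leq_pmulr // muln_gt0 h_gt0.
have f3 : (h * w ^ (q - 2)) * (z * w) <= (h * w ^ (q - 2)) * (2 * G2 * (z * (kap + A) + 2 * (1 + K) * w)).
  move: f2; rewrite XW2; clear; clearbody h G2 z w; move: (w ^ _) (K) => x y; nat_lia.
rewrite leq_pmul2l ?muln_gt0 ?h_gt0 // in f3.
have f4 : z * w <= z * (4 * G2 * (kap + A)).
  have e : z * w = 2 * (2 * G2 * (2 * (1 + K) * w)).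
    by rewrite /z; clear; clearbody G2; move: (K) => y; nat_lia.
  move: f3; rewrite mulnDr; move: e; clear; move: (2 * G2 * (2 * _ * w)) => y.
  have -> : z * (4 * G2 * (kap + A)) = 2 * (2 * G2 * (z * (kap + A))) by clear; clearbody G2 z; nat_lia.
  move: (2 * G2 * _) (z * w) => *; nat_lia.
rewrite leq_pmul2l // in f4; by move: w3; rewrite ltnNge f4.
Qed.

(** * The list of stars *)

Definition uncovered (V : finType) (L : seq ({set V} * {set V})) : {set V} :=
  ~: \bigcup_(p <- L) p.2.

(** A pair in the list consists of a centre and a subset of the body of the
    star. [sl_body] makes the body of the full star at most twice as large as
    this subset, and [sl_big] exempts the last pair, which may be small. *)
Record star_list (V : finType) (E : {set {set V}}) n c2 (L : seq ({set V} * {set V})) : Prop := StarList {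
  sl_size : size L <= 7 * t ^ 2;
  sl_heavy : forall p, p \in L -> heavy_pair E p.1 p.2;
  sl_disj : pairwise (fun p p' : {set V} * {set V} => [disjoint p.1 & p'.1]) L;
  sl_unc : #|uncovered L| <= c2;
  sl_body : forall p, p \in L -> #|uncovered L| <= #|p.2|;
  sl_big : forall p, p \in take (size L).-1 L -> n <= 7 * t ^ 2 * #|p.2| }.

Lemma heavy_pair_sub (V : finType) (G E : {set {set V}}) C P : G \subset E ->
  heavy_pair G C P -> heavy_pair E C P.
Proof.
move=> /subsetP sGE /heavy_pairP[cC d P0 h]; apply/heavy_pairP; split=> // v vP.
apply: leq_trans (h v vP) _; apply: subset_leq_card; apply/subsetP => e.
by rewrite !inE => /andP[/and3P[/sGE-> -> ->] ->].
Qed.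

Lemma bin_ge_linear x b : q + b <= x -> b <= 'C(x, q).
Proof.
move=> le; have q2 := q_ge2; have := bin_add_ge (q - 1) (q - 1) b.
rewrite binn muln1 (_ : (q - 1).+1 = q); last by nat_lia.
move=> h; apply: leq_trans (leq_trans (leq_addl _ _) h) _; apply: leq_bin2l; nat_lia.
Qed.

(** If boundedly many vertices are outside the cores, the cores themselves
    form the list, with the core of less than N/2 vertices, if any, at the
    end. Otherwise all cores are full and the loose edges form an almost
    complete star, which becomes the last pair. *)
Lemma star_list_of_cores kap : exists k2 c2 n0, forall (V : finType) (E : {set {set V}}) n m N (M : {set {set V}}),
  extremal_data E n m N -> centers E n M -> n0 <= n -> n <= 2 * t ^ 2 * N ->
  (forall C, C \in M -> n <= kap * #|core_of E n C|) ->
  k2 * #|outside E n M| <= n -> #|outside E n M| < N ->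
  #|[set C in M | 2 * #|core_of E n C| < N]| <= 1 ->
  exists L, star_list E n c2 L.
Proof.
have q2 := q_ge2.
have [k2 [n1 hn1]] := cores_full kap; have [n2 hn2] := centers_disjoint kap.
have [c7 [Kw hnc]] := near_complete (slack kap) kap.
(* With w > Kw', the almost complete star has more than 2^c7 + kap edges, which
   makes its centre disjoint from the others. *)
pose Kw' := slack kap + Kw + 2 * c7 + q + kap + 2 ^ c7.
exists k2, Kw', (n1 + n2 + kap * Kw' + 1) => V E n m N M st hM nbig nN hB wn wN nf1.
have [n1n n2n nK n0] : [/\ n1 <= n, n2 <= n, kap * Kw' < n & 0 < n].
  by move: nbig; clear; move: (_ * Kw') => x; split; nat_lia.
set P := core_of E n; set w := #|_| in wn wN.
have KP C : C \in M -> Kw' <= #|P C|.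
  move=> CM; have kap0 : 0 < kap by case: (kap) (hB C CM) n0 => //; rewrite mul0n leqn0 => /eqP->.
  by rewrite -(leq_pmul2l kap0); apply: leq_trans (hB C CM); apply: ltnW.
have MB : #|M| <= kap := few_cores st hM n0 hB.
have disM C C' : C \in M -> C' \in M -> C != C' -> [disjoint C & C'].
  by move=> CM C'M; apply: (hn2 V E n m N M C C' st hM n2n nN hB wN CM C'M).
have heavyM C : C \in M -> heavy_pair E C (P C) by apply: (core_heavy (st_V st) hM).
have full_n C : C \in M -> N <= 2 * #|P C| -> n <= 4 * t ^ 2 * #|P C|.
  move=> CM h; apply: leq_trans nN _; apply: (@leq_trans (2 * t ^ 2 * (2 * #|P C|))).
    by rewrite leq_mul2l h orbT.
  by rewrite eq_leq //; clear; move: (t ^ 2) #|_| => *; nat_lia.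
set nf := [set C in M | _] in nf1; pose fl := M :\: nf.
have flP C : C \in fl -> C \in M /\ n <= 4 * t ^ 2 * #|P C|.
  rewrite !inE => /andP[+ CM]; rewrite CM /= -leqNgt => h; split=> //; exact: full_n.
have cfl : #|fl| <= 4 * t ^ 2.
  apply: (few_cores st (M := fl) _ n0); first by move=> C /flP[CM _]; apply: hM.
  by move=> C /flP[].
have cM : #|M| <= (4 * t ^ 2).+1.
  rewrite -(cardsID nf M) -addn1 addnC leq_add //; apply: leq_trans nf1.
  by apply: subset_leq_card; apply: subsetIr.
have t2 : 4 <= t ^ 2 by rewrite -[4]/(2 ^ 2) leq_exp.
have le47 x : 4 * t ^ 2 * x <= 7 * t ^ 2 * x by apply: leq_mul => //; apply: leq_mul.
have [wK|wK] := leqP w Kw'.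
  pose L := [seq (C, P C) | C <- enum fl ++ enum nf].
  have memL p : p \in L -> p.1 \in M /\ p.2 = P p.1.
    case/mapP => C; rewrite mem_cat !mem_enum => hC -> /=; split=> //.
    by case/orP: hC; [case/flP|rewrite inE => /andP[]].
  have uncL : uncovered L = outside E n M.
    rewrite /uncovered /outside; congr (~: _); rewrite big_map big_cat /= !big_enum /=.
    apply/setP => v; apply/setUP/bigcupP => [[]/bigcupP[C hC vC]|[C CM vC]].
    - by exists C => //; case: (flP C hC).
    - by exists C => //; move: hC; rewrite inE => /andP[].
    - have [Cn|Cn] := boolP (C \in nf); [right|left]; apply/bigcupP; exists C => //.
      by rewrite inE Cn.
  exists L; split.
  - rewrite size_map size_cat -!cardE; apply: (@leq_trans (4 * t ^ 2 + 1)); first exact: leq_add.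
    by move: t2; clear; move: (t ^ 2) => x; nat_lia.
  - by move=> p /memL[pM ->]; apply: heavyM.
  - rewrite pairwise_map; have : uniq (enum fl ++ enum nf).
      rewrite cat_uniq !enum_uniq /= andbT; apply/hasPn => C; rewrite mem_enum => Cn.
      by rewrite /= mem_enum in_setD Cn.
    have : {subset enum fl ++ enum nf <= M}.
      move=> C; rewrite mem_cat !mem_enum => /orP[/flP[]//|]; by rewrite inE => /andP[].
    elim: (enum fl ++ enum nf) => //= C l IH sub /andP[Cl ul]; apply/andP; split; last first.
      by apply: IH => // C' C'l; apply: sub; rewrite inE C'l orbT.
    apply/allP => C' C'l /=; apply: disM; try by apply: sub; rewrite inE ?eqxx ?C'l ?orbT.
    by apply: contraNneq Cl => ->.
  - by rewrite uncL.
  - by move=> p /memL[pM ->]; rewrite uncL; apply: leq_trans wK (KP _ pM).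
  - move=> p; rewrite size_map size_cat -!cardE => hp.
    have : p \in [seq (C, P C) | C <- enum fl].
      move: hp; rewrite /L map_cat; set l1 := map _ _; have -> : #|fl| = size l1 by rewrite size_map -cardE.
      have : (size l1 + #|nf|).-1 <= size l1 by move: nf1; clear; move: #|_| (size _) => *; nat_lia.
      by rewrite take_cat leq_eqVlt => /orP[/eqP->|->]; rewrite ?ltnn ?subnn ?take0 ?cats0 // => /mem_take.
    case/mapP => C; rewrite mem_enum => /flP[_ h] -> /=; exact: leq_trans h (le47 _).
have wslack : slack kap <= w by apply: leq_trans (ltnW wK); rewrite /Kw'; clear; move: (2 ^ _) (slack _) => *; nat_lia.
have [full gain] := hn1 V E n m N M st hM n1n hB wn wN wslack; rewrite -/w in gain.
have D0 := st_D st.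
have starD C : C \in M -> #|star_of E C| <= max_degree E.
  by case/hM => cC _; exact: (star_of_card_le E cC).
have sumD : \sum_(C in M) #|star_of E C| <= #|M| * max_degree E.
  by rewrite -sum_nat_const; apply: leq_sum.
have mD : #|M| * max_degree E = #|M| * (max_degree E).-1 + #|M| by rewrite -mulnSr prednK.
have big : 'C(w - slack kap, q) < #|loose E M| + kap.
  have := edges_le M (st_E st); move: gain sumD mD MB; clear.
  move: (#|M| * (max_degree E).-1) (#|M| * max_degree E) => x1 x2.
  move: ('C(_, _)) #|loose E M| #|M| (\sum_(_ in _) _) => *; nat_lia.
have GJ : class_J r t (loose E M) := loose_J (st_J st) M.
have GW e : e \in loose E M -> e \subset outside E n M.
  exact: (loose_sub (st_J st) (st_V st) hM).
have KwW : Kw <= w by apply: leq_trans (ltnW wK); rewrite /Kw'; clear; nat_lia.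
have [C' [P' [hp' P'W wP']]] := hnc V (loose E M) (outside E n M) GJ GW KwW big.
rewrite -/w in wP'.
have hpE : heavy_pair E C' P'.
  by apply: heavy_pair_sub hp'; apply/subsetP => e; rewrite inE => /andP[].
have C'M : C' \notin M.
  apply/negP => C'M; have [e /star_inP[eG Ce _]] := heavy_pair_edge_exists GJ hp'.
  by move: eG; rewrite inE => /andP[_ /forall_inP/(_ C' C'M)]; rewrite Ce.
have cR : #|outside E n M :\: P'| <= c7.
  by rewrite cardsD (setIidPr P'W) -/w; move: wP'; clear; clearbody w; nat_lia.
have disC' C : C \in M -> [disjoint C & C'].
  move=> CM; apply/negPn/negP; rewrite -setI_eq0 => /set0Pn[v]; rewrite inE => /andP[vC vC'].
  pose S' := [set e in loose E M | C' \subset e].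
  have cD : #|star_of E C| + #|S'| <= max_degree E.
    have d0 : star_of E C :&: S' = set0.
      apply/setP => e; rewrite in_setI in_set0; apply/negP => /andP[].
      by rewrite !in_set => /andP[_ Ce] /andP[/andP[_ /forall_inP/(_ C CM)/negP[]]].
    have := cardsUI (star_of E C) S'; rewrite d0 cards0 addn0 => <-.
    apply: leq_trans (leq_bigmax v); apply: subset_leq_card; apply/subsetP => e.
    by rewrite !inE => /orP[/andP[-> /subsetP->]|/andP[/andP[-> _] /subsetP->]].
  have cO : #|loose E M| <= #|S'| + 2 ^ c7.
    rewrite -(cardsID S' (loose E M)); apply: leq_add; first by rewrite subset_leq_card ?subsetIr.
    apply: (@leq_trans (2 ^ #|outside E n M :\: P'|)); last by rewrite leq_exp2l.
    rewrite -card_powerset; apply: subset_leq_card; apply/subsetP => e.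
    rewrite inE [e \in S']inE => /andP[+ eG]; rewrite eG /= => nC.
    rewrite inE subsetD (GW e eG) /=; apply: contraR nC => nd.
    by apply: (heavy_pair_edge GJ hp' eG); rewrite disjoint_sym.
  have cS : \sum_(C in M) #|star_of E C| <= #|star_of E C| + #|M :\ C| * max_degree E.
    rewrite (bigD1 C) //= leq_add2l -sum_nat_const.
    have -> : \sum_(C0 in M | C0 != C) #|star_of E C0| = \sum_(C0 in M :\ C) #|star_of E C0|.
      by apply: eq_bigl => C0; rewrite !inE andbC.
    by apply: leq_sum => C0; rewrite inE => /andP[_ /starD].
  have cM1 : #|M| * max_degree E = #|M :\ C| * max_degree E + max_degree E.
    by rewrite (cardsD1 C M) CM mulSn addnC.
  have low : kap + 2 ^ c7 <= 'C(w - slack kap, q).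
    apply: bin_ge_linear; move: wK; rewrite /Kw'; clear; clearbody w; move: (2 ^ c7) => *; nat_lia.
  have := edges_le M (st_E st); move: gain low cS cO cD mD cM1 MB; clear.
  move: ('C(_, _)) #|loose E M| #|S'| #|star_of E C| (2 ^ c7) (#|M| * (max_degree E).-1)
    (#|M| * max_degree E) (#|M :\ C| * max_degree E) => x1 x2 x3 x4 x5 x6 x7 x8.
  move: (\sum_(_ in _) _) #|M| => *; nat_lia.
pose L := rcons [seq (C, P C) | C <- enum M] (C', P').
have memL p : p \in L -> p = (C', P') \/ (p.1 \in M /\ p.2 = P p.1).
  rewrite mem_rcons inE => /orP[/eqP->|/mapP[C]]; first by left.
  by rewrite mem_enum => CM ->; right.
have uncL : uncovered L = outside E n M :\: P'.
  rewrite /uncovered /outside big_rcons big_map big_enum /=.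
  by apply/setP => v; rewrite !inE negb_or andbC.
exists L; split.
- rewrite size_rcons size_map -cardE; apply: (@leq_trans (4 * t ^ 2).+2); first by [].
  by move: t2; clear; move: (t ^ 2) => x; nat_lia.
- by move=> p /memL[->//|[pM ->]]; apply: heavyM.
- rewrite pairwise_rcons; apply/andP; split.
    by apply/allP => p /mapP[C]; rewrite mem_enum => CM -> /=; apply: disC'.
  rewrite pairwise_map; have : {subset enum M <= M} by move=> C; rewrite mem_enum.
  have := enum_uniq M; elim: (enum _) => //= C l IH /andP[Cl ul] sub; apply/andP; split; last first.
    by apply: IH => // C0 C0l; apply: sub; rewrite inE C0l orbT.
  apply/allP => C0 C0l /=; apply: disM; try by apply: sub; rewrite inE ?eqxx ?C0l ?orbT.
  by apply: contraNneq Cl => ->.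
- by rewrite uncL; apply: leq_trans cR _; rewrite /Kw'; clear; move: (2 ^ _) => *; nat_lia.
- have c7K : c7 <= Kw' by rewrite /Kw'; clear; move: (2 ^ _) => *; nat_lia.
  move=> p /memL[->|[pM ->]]; rewrite uncL; apply: leq_trans cR _.
    by move: wK wP'; rewrite /Kw' /=; clear; clearbody w; move: (2 ^ _) #|_| => *; nat_lia.
  exact: leq_trans c7K (KP _ pM).
- move=> p; rewrite size_rcons /= /L -cats1 take_size_cat // => /mapP[C].
  rewrite mem_enum => CM -> /=; apply: leq_trans (le47 _); apply: full_n => //.
  have := full C CM; have [_] := hM C CM; rewrite -card_gt0 -/(P C).
  by clear; move: #|_| => *; nat_lia.
Qed.

Lemma extremal_data_exists (V : finType) (E : {set {set V}}) n m : extremal r t n m E -> 0 < m ->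
  exists N, extremal_data E n m N.
Proof.
move=> ex m0; have [cV cE EJ _] := ex; have q2 := q_ge2.
have D0 : 0 < max_degree E.
  have [e eE] : exists e, e \in E by apply/set0Pn; rewrite -card_gt0 cE.
  have [v ve] : exists v, v \in e.
    apply/set0Pn; rewrite -card_gt0 (class_J_card EJ eE) (k_split); nat_lia.
  apply: leq_trans (leq_bigmax v); rewrite card_gt0; apply/set0Pn; exists e.
  by rewrite inE eE.
have exN : exists x, (max_degree E).-1 <= 'C(x, q).
  by exists (q + (max_degree E).-1); apply: bin_ge_linear.
case: (ex_minnP exN) => N hN minN; exists N; split=> //.
- by move=> l; apply: (extremal_competitor ex D0).
- move=> x xN; rewrite ltnNge; apply/negP => /minN; by rewrite leqNgt xN.
Qed.

(** The constant k2 of [star_list_of_cores] depends on the lower bound for the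
    cores, so the one core of less than N/2 vertices needs care. It is kept if
    it has at least n / B2 vertices, and otherwise it is dropped and its
    vertices count as outside. *)
Theorem star_structure : exists c2 n0, forall (V : finType) (E : {set {set V}}) n m,
  extremal r t n m E -> 'C(n %/ t, q) < m -> n0 <= n -> exists L, star_list E n c2 L.
Proof.
pose ka := 4 * t ^ 2.
have [k2a [ca [na hna]]] := star_list_of_cores ka.
(* A core below n / B2 can be dropped: the outside stays below n / k2a. *)
pose B2 := 2 * k2a + 8 * t ^ 2 + 1; pose kb := B2 + ka.
have [k2b [cb [nb hnb]]] := star_list_of_cores kb.
pose eta := 2 * k2a + k2b + 8 * t ^ 2 + 1.
have [|beta [n1 [b0 hn1]]] := @outside_small eta; first by rewrite /eta addn1.
have [n2 hn2] := nonfull_core_unique (2 * beta * t ^ 2).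
have [n3 hn3] := @full_size_bounds (beta + 4) ltac:(by rewrite addnC).
exists (ca + cb), (na + nb + n1 + n2 + n3 + 1) => V E n m ex mbig nbig.
have [N st] := extremal_data_exists ex (leq_ltn_trans (leq0n _) mbig).
have [nna nnb nn1 [nn2 nn3 n0]] : [/\ na <= n, nb <= n, n1 <= n & [/\ n2 <= n, n3 <= n & 0 < n]].
  by move: nbig; clear; split; try nat_lia; split; nat_lia.
have wn := hn1 V E n m N st mbig nn1.
have nN : n <= 2 * t ^ 2 * N.
  by apply: (full_size_linear); case: (hn3 V E n m N st mbig nn3).
set M := mains _ _ _ in wn.
have hM : centers E n M by apply: mains_centers.
set w := #|_| in wn.
have hB C : C \in M -> n <= 2 * beta * t ^ 2 * #|core_of E n C| by rewrite inE => /and3P[].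
have t20 : 0 < t ^ 2 by rewrite expn_gt0; move: ht; clear; nat_lia.
have N0 : 0 < N by case: (N) nN n0 => //; rewrite muln0 leqn0 => /eqP->.
have scale x y : y * x <= n -> 8 * t ^ 2 <= y -> 4 * x <= N.
  move=> h1 h2; have h3 : 8 * t ^ 2 * x <= 2 * t ^ 2 * N.
    by apply: leq_trans nN; apply: leq_trans h1; rewrite leq_mul2r h2 orbT.
  rewrite -(leq_pmul2l t20); move: h3; clear; move: (t ^ 2) => z; nat_lia.
have w4 : 4 * w <= N by apply: (scale w eta) => //; rewrite /eta; clear; nat_lia.
have wN : w < N by move: w4 N0; clear; clearbody w; nat_lia.
have weaken c L : c <= ca + cb -> star_list E n c L -> star_list E n (ca + cb) L.
  by move=> le [h1 h2 h3 h4 h5 h6]; split=> //; apply: leq_trans h4 le.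
have full_n C : C \in M -> N <= 2 * #|core_of E n C| -> n <= ka * #|core_of E n C|.
  move=> CM h; apply: leq_trans nN _; apply: (@leq_trans (2 * t ^ 2 * (2 * #|core_of E n C|))).
    by rewrite leq_mul2l h orbT.
  by rewrite eq_leq // /ka; clear; move: (t ^ 2) #|_| => *; nat_lia.
have nf_eq i j : i \in M -> j \in M -> 2 * #|core_of E n i| < N -> 2 * #|core_of E n j| < N -> i = j.
  move=> iM jM hi hj; apply/eqP/negPn/negP => ij.
  exact: (hn2 V E n m N M i j st hM nn2 nN hB wN iM jM ij hi hj).
have nf1 : #|[set C in M | 2 * #|core_of E n C| < N]| <= 1.
  by apply/card_le1_eqP => i j /setIdP[iM hi] /setIdP[jM hj]; apply: nf_eq.
have [nf0|/set0Pn[i]] := eqVneq [set C in M | 2 * #|core_of E n C| < N] set0.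
  have hF C : C \in M -> n <= ka * #|core_of E n C|.
    move=> CM; apply: full_n => //; rewrite leqNgt; apply/negP => h.
    have : C \in [set C in M | 2 * #|core_of E n C| < N] by apply/setIdP.
    by rewrite nf0 inE.
  have [|L hL] := hna V E n m N M st hM nna nN hF _ wN nf1.
    by apply: leq_trans wn; rewrite leq_mul2r /eta; apply/orP; right; clear; nat_lia.
  by exists L; apply: weaken hL; apply: leq_addr.
case/setIdP => iM hi.
have [big_i|small_i] := leqP n (B2 * #|core_of E n i|).
  have hF C : C \in M -> n <= kb * #|core_of E n C|.
    move=> CM; rewrite /kb mulnDl; have [h|h] := leqP N (2 * #|core_of E n C|).
      by apply: leq_trans (full_n C CM h) (leq_addl _ _).
    by rewrite (nf_eq C i CM iM h hi); apply: leq_trans big_i (leq_addr _ _).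
  have [|L hL] := hnb V E n m N M st hM nnb nN hF _ wN nf1.
    by apply: leq_trans wn; rewrite leq_mul2r /eta; apply/orP; right; clear; nat_lia.
  by exists L; apply: weaken hL; apply: leq_addl.
pose M2 := M :\ i.
have hM2 : centers E n M2 by move=> C /setD1P[_ /hM].
have hF C : C \in M2 -> n <= ka * #|core_of E n C|.
  case/setD1P=> Ci CM; apply: full_n => //; rewrite leqNgt; apply/negP => h.
  by move: Ci; rewrite (nf_eq C i CM iM h hi) eqxx.
have w2 : #|outside E n M2| = w + #|core_of E n i|.
  have := cores_card (st_J st) (st_V st) hM; have := cores_card (st_J st) (st_V st) hM2.
  rewrite -/w (bigD1 i iM) /=.
  have -> : \sum_(C in M | C != i) #|core_of E n C| = \sum_(C in M2) #|core_of E n C|.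
    by apply: eq_bigl => C; rewrite in_setD1 andbC.
  by clear; clearbody w; move: (\sum_(_ in _) _) #|_| #|_| => *; nat_lia.
have i4 : 4 * #|core_of E n i| <= N.
  by apply: (scale _ B2); [exact: ltnW|rewrite /B2; clear; nat_lia].
have [|||L hL] := hna V E n m N M2 st hM2 nna nN hF.
- rewrite w2 mulnDr.
  have h1 : 2 * (k2a * w) <= n.
    by apply: leq_trans wn; rewrite mulnA leq_mul2r /eta; apply/orP; right; clear; nat_lia.
  have h2 : 2 * (k2a * #|core_of E n i|) <= n.
    apply: leq_trans (ltnW small_i); rewrite mulnA leq_mul2r /B2; apply/orP; right; clear; nat_lia.
  by move: h1 h2; clear; move: (k2a * _) (k2a * _) => *; nat_lia.
- by rewrite w2; move: w4 i4 N0; clear; clearbody w; move: #|_| => *; nat_lia.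
- apply: leq_trans nf1; apply: subset_leq_card; apply/subsetP => C.
  by case/setIdP => /setD1P[_ CM] h; apply/setIdP.
by exists L; apply: weaken hL; apply: leq_addr.
Qed.

(** * Greedy cores and the final count *)

Section CoreContains.
Variables (d : Order.disp_t) (V : finOrderType d).
Variables (C P : {set V}) (F S : {set {set V}}).
Hypothesis SF : S \subset F.
Hypothesis SP : forall e, e \in S -> e \subset C :|: P.
Hypothesis S_deg : forall v, v \in P ->
  2 * r ^ 2 * t ^ 3 * #|body C F| ^ (r * t - 2) <= degree S v.

Lemma body_mono (F1 F2 : {set {set V}}) : F1 \subset F2 -> body C F1 \subset body C F2.
Proof.
move=> /subsetP sF; apply/bigcupsP => e /sF eF; exact: (bigcup_sup e).
Qed.

Lemma degree_mono (F1 F2 : {set {set V}}) v : F1 \subset F2 -> degree F1 v <= degree F2 v.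
Proof.
move=> /subsetP sF; apply: subset_leq_card; apply/subsetP => e.
by rewrite !inE => /andP[/sF-> ->].
Qed.

(** A deleted vertex has least degree in a star that is not heavy, hence a
    smaller degree than the vertices of P have in S. *)
Lemma core_step_sup (F1 : {set {set V}}) : F1 \subset F -> S \subset F1 ->
  core_step r t C F1 \subset F /\ S \subset core_step r t C F1.
Proof.
move=> F1F SF1; rewrite /core_step; case: ifP => // /negbT nheavy.
rewrite /first_min_vertex; case: pickP => [v /andP[vB /forall_inP vmin]|//].
split; first by apply: subset_trans F1F; apply/subsetP => e; rewrite inE => /andP[].
apply/subsetP => e eS; rewrite inE (subsetP SF1) //=; apply/negP => ve.
have vC : v \notin C by case/bigcupP: vB => f _; rewrite inE => /andP[].
have vP : v \in P by have := subsetP (SP eS) v ve; rewrite inE (negPf vC).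
case/negP: nheavy; apply/forall_inP => u uB; apply: (@leq_trans (degree F1 v)).
  apply: leq_trans (degree_mono v SF1); apply: leq_trans (S_deg vP).
  by rewrite leq_mul2l leq_exp ?orbT // subset_leq_card // body_mono.
by have /orP[/ltnW//|/andP[/eqP-> _]] := vmin u uB.
Qed.

Lemma core_sup : S \subset core r t C F.
Proof.
rewrite /core; have : forall j, iter j (core_step r t C) F \subset F /\ S \subset iter j (core_step r t C) F.
  by elim=> [|j [IH1 IH2]] //=; apply: core_step_sup.
by move=> /(_ #|F|)[].
Qed.

Hypothesis CP : [disjoint C & P].
Hypothesis S_pos : forall v, v \in P -> 0 < degree S v.

Lemma core_body_sup : P \subset core_body r t C F.
Proof.
apply/subsetP => v vP; have := S_pos vP; rewrite card_gt0 => /set0Pn[e].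
rewrite inE => /andP[eS ve]; apply/bigcupP; exists e; first exact: (subsetP core_sup).
by rewrite inE ve andbT; have := pred0P CP v; rewrite /= vP andbT => ->.
Qed.

End CoreContains.

Section Assembly.

Variables (d : Order.disp_t) (V : finOrderType d) (E : {set {set V}}) (n c2 : nat).
Hypothesis EJ : class_J r t E.
Hypothesis cV : #|V| = n.
Variable L : seq ({set V} * {set V}).
Hypothesis sL : star_list E n c2 L.
Local Notation l := (size L).
Local Notation W := (uncovered L).

Definition ctr (i : 'I_l) := (nth (set0, set0) L i).1.
Definition bod (i : 'I_l) := (nth (set0, set0) L i).2.

Lemma ctr_heavy i : heavy_pair E (ctr i) (bod i).
Proof. by apply: (sl_heavy sL); apply: mem_nth. Qed.

Lemma ctr_card i : #|ctr i| = s.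
Proof. by have [] := heavy_pairP _ _ _ (ctr_heavy i). Qed.

Lemma ctr_disj i j : i != j -> [disjoint ctr i & ctr j].
Proof.
have h := pairwiseP (set0, set0) (sl_disj sL).
move=> ij; have [lt|lt|e] := ltngtP i j.
- by apply: h; rewrite ?inE.
- by rewrite disjoint_sym; apply: h; rewrite ?inE.
- by case/eqP: ij; apply: val_inj.
Qed.

Lemma ctr_neq i j : i != j -> ctr i != ctr j.
Proof.
move=> ij; apply: contraTneq (ctr_disj ij) => ->; rewrite -setI_eq0 setIid -card_gt0 ctr_card.
exact: leq_trans (ltnW ht) (t_le_s).
Qed.

Lemma uncovered_bod : W = ~: \bigcup_(i < l) bod i.
Proof.
rewrite /uncovered (big_nth (set0, set0)) big_mkord //.
Qed.

Lemma bod_ctr i j : [disjoint bod i & ctr j].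
Proof.
have [->|ij] := eqVneq i j.
  by have [_ + _ _] := heavy_pairP _ _ _ (ctr_heavy j); rewrite disjoint_sym.
exact: (heavy_pair_body_center EJ (ctr_heavy i) (ctr_heavy j) (ctr_neq ij)).
Qed.

Lemma ctr_unc i : ctr i \subset W.
Proof.
rewrite uncovered_bod; apply/subsetP => v vC; rewrite inE; apply/bigcupP => -[j _ vP].
by have := pred0P (bod_ctr j i) v; rewrite /= vP vC.
Qed.

Lemma bod_edge i e v : e \in E -> v \in e -> v \in bod i -> ctr i \subset e.
Proof.
move=> eE ve vP; apply: (heavy_pair_edge EJ (ctr_heavy i)) => //.
by apply/negP => dd; have := pred0P dd v; rewrite /= vP ve.
Qed.

(** Otherwise the edge contains two disjoint centres and a vertex of a body,
    that is more than 2s, and 2s is at least s + q. *)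
Lemma edge_one_body i j e v : e \in E -> ctr i \subset e -> v \in e -> v \in bod j -> i = j.
Proof.
move=> eE Ci ve vP; have Cj := bod_edge eE ve vP; apply/eqP/negPn/negP => ij.
have : #|v |: (ctr i :|: ctr j)| <= #|e|.
  by apply: subset_leq_card; rewrite !subUset sub1set ve Ci Cj.
rewrite cardsU1 !inE cardsU.
have /pred0P/(_ v) := bod_ctr j i; have /pred0P/(_ v) := bod_ctr j j; rewrite /= vP /= => -> -> /=.
have /eqP -> : ctr i :&: ctr j == set0 by rewrite setI_eq0 ctr_disj.
rewrite cards0 !ctr_card (class_J_card EJ eE) (k_split).
have : q <= s by rewrite leq_pmulr //; move: ht; clear; nat_lia.
clear; move: (q) (s) => *; nat_lia.
Qed.

(** The body of the whole star has at most 2|P| vertices, and the factor 2^q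
    in [heavy_factor] compensates for this. *)
Lemma bod_core i : bod i \subset core_body r t (ctr i) (star_of E (ctr i)).
Proof.
have [cC dCP P0 hdeg] := heavy_pairP _ _ _ (ctr_heavy i).
have bsub : body (ctr i) (star_of E (ctr i)) \subset bod i :|: W.
  apply/bigcupsP => e; rewrite inE => /andP[eE Ce]; apply/subsetP => v; rewrite inE => /andP[_ ve].
  rewrite inE uncovered_bod inE; have [/bigcupP[j _ vP]|] := boolP (v \in \bigcup_(j < l) bod j); last by rewrite orbT.
  by rewrite (edge_one_body eE Ce ve vP) vP.
have cb : #|body (ctr i) (star_of E (ctr i))| <= 2 * #|bod i|.
  apply: leq_trans (subset_leq_card bsub) _; apply: leq_trans (leq_card_setU _ _) _.
  by rewrite mul2n -addnn leq_add2l; apply: (sl_body sL); apply: mem_nth.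
have Ppos : 0 < #|bod i| by rewrite card_gt0.
apply: (@core_body_sup _ _ _ _ _ (star_in E (ctr i) (bod i))) => //.
- by apply/subsetP => e /star_inP[eE Ce _]; rewrite inE eE.
- by move=> e /star_inP[].
- move=> v vP; apply: leq_trans (hdeg v vP).
  apply: (@leq_trans (2 * r ^ 2 * t ^ 3 * (2 * #|bod i|) ^ (q - 2))).
    by rewrite leq_mul2l leq_exp ?orbT.
  rewrite /heavy_factor expnMn mulnA leq_mul2r; apply/orP; right; rewrite leq_mul2l; apply/orP; right.
  by rewrite leq_exp2l // leq_subr.
- move=> v vP; apply: leq_trans (hdeg v vP); rewrite muln_gt0 expn_gt0 Ppos andbT.
  by exact: (leq_ltn_trans _ heavy_factor_gt).
Qed.

Definition leftover := E :\: \bigcup_(i < l) star_of E (ctr i).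

(** Such an edge meets no body, so it is a subset of the boundedly many
    uncovered vertices. *)
Lemma leftover_card : #|leftover| <= 2 ^ c2.
Proof.
apply: (@leq_trans (2 ^ #|W|)); last by rewrite leq_exp2l // (sl_unc sL).
rewrite -card_powerset; apply: subset_leq_card; apply/subsetP => e; rewrite !inE => /andP[nF eE].
apply/subsetP => v ve; rewrite uncovered_bod inE; apply: contra nF => /bigcupP[j _ vP].
by apply/bigcupP; exists j => //; rewrite inE eE (bod_edge eE ve vP).
Qed.

Lemma star_of_star i (F : {set {set V}}) : F \subset star_of E (ctr i) -> is_star k s (ctr i) F.
Proof.
move=> /subsetP sF; rewrite /is_star ctr_card eqxx /=; apply/andP; split.
  by apply/forall_inP => e /sF; rewrite inE => /andP[/(class_J_card EJ)-> _].
by apply/forall_inP => e /sF; rewrite inE => /andP[].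
Qed.

(** Less than t vertices lie outside the centre and all bodies. This is too
    few for a nonempty intersection with an edge of another star. *)
Definition tight (i : 'I_l) := [set e in star_of E (ctr i) | #|(e :&: W) :\: ctr i| < t].

Lemma small_meet e f (X : {set V}) : e \in E -> f \in E -> e :&: f \subset X -> #|X| < t -> e :&: f = set0.
Proof.
move=> eE fE sX cX; apply/eqP; rewrite -cards_eq0 -leqn0 leqNgt; apply/negP => pos.
have lt : #|e :&: f| < t by apply: leq_ltn_trans cX; apply: subset_leq_card.
have := admissible_small (class_J_inter EJ eE fE) (leq_trans lt (t_le_s)).
by move/(dvdn_leq pos); rewrite leqNgt lt.
Qed.

Lemma tightP i e : e \in tight i -> [/\ e \in E, ctr i \subset e & #|(e :&: W) :\: ctr i| < t].
Proof. by rewrite !inE => /andP[/andP[]]. Qed.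

Lemma tight_ctr i j e : i != j -> e \in tight i -> e :&: ctr j = set0.
Proof.
move=> ij /tightP[eE Ce small].
have [f /star_inP[fE Cf fP]] := heavy_pair_edge_exists EJ (ctr_heavy j).
have sub : e :&: f \subset (e :&: W) :\: ctr i.
  apply/subsetP => v /setIP[ve vf]; have := subsetP fP v vf; rewrite inE => /orP[vC|vP]; last first.
    by rewrite (edge_one_body eE Ce ve vP) eqxx in ij.
  rewrite in_setD in_setI ve (subsetP (ctr_unc j) v vC) !andbT.
  by have := pred0P (ctr_disj ij) v; rewrite /= vC andbT => ->.
apply/eqP; rewrite -subset0 -(small_meet eE fE sub small); exact: setIS.
Qed.

Lemma tight_disjoint i j e f : i != j -> e \in tight i -> f \in tight j -> e :&: f = set0.
Proof.
move=> ij ei fj; have [eE Ce small] := tightP ei; have [fE Cf _] := tightP fj.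
apply: (small_meet eE fE _ small); apply/subsetP => v /setIP[ve vf].
have ji : j != i by rewrite eq_sym.
rewrite in_setD in_setI ve /=; apply/andP; split.
  apply/negP => vC; have /setP/(_ v) := tight_ctr ji fj; by rewrite !inE vf vC.
rewrite uncovered_bod inE; apply/bigcupP => -[h _ vP].
by case/eqP: ij; rewrite (edge_one_body eE Ce ve vP) (edge_one_body fE Cf vf vP).
Qed.

Lemma tight_vertices i j : i != j ->
  [disjoint star_vertices (ctr i) (tight i) & star_vertices (ctr j) (tight j)].
Proof.
move=> ij; have ji : j != i by rewrite eq_sym.
rewrite -setI_eq0; apply/eqP/setP => v; rewrite !inE; apply/negP => /andP[].
case/orP => [vi|/bigcupP[e ei]]; last rewrite inE => /andP[_ ve].
  case/orP => [vj|/bigcupP[f fj]]; last rewrite inE => /andP[_ vf].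
    by have := pred0P (ctr_disj ij) v; rewrite /= vi vj.
  by have /setP/(_ v) := tight_ctr ji fj; rewrite !inE vf vi.
case/orP => [vj|/bigcupP[f fj]]; last rewrite inE => /andP[_ vf].
  by have /setP/(_ v) := tight_ctr ij ei; rewrite !inE ve vj.
by have /setP/(_ v) := tight_disjoint ij ei fj; rewrite !inE ve vf.
Qed.

Definition untight := E :\: \bigcup_(i < l) tight i.

(** An edge that is not tight contains a centre and t further vertices of the
    uncovered set, which leaves (r-1)t vertices to be chosen. *)
Lemma untight_card : 0 < n -> #|untight| <= (2 ^ c2 + 7 * t ^ 2 * 2 ^ c2) * n ^ ((r - 1) * t).
Proof.
move=> n0; have X0 : 0 < n ^ ((r - 1) * t) by rewrite expn_gt0 n0.
pose Z (i : 'I_l) := \bigcup_(Y in [set Y : {set V} | (Y \subset W :\: ctr i) && (#|Y| == t)])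
   [set e in E | ctr i :|: Y \subset e].
have cover : untight \subset leftover :|: \bigcup_(i in [set: 'I_l]) Z i.
  apply/subsetP => e /setDP[eE nT]; rewrite inE.
  have [eL|] := boolP (e \in leftover) => //=.
  rewrite inE eE andbT negbK => /bigcupP[i _ eF]; apply/bigcupP; exists i; first by rewrite inE.
  have Ce : ctr i \subset e by move: eF; rewrite inE => /andP[].
  have tr : t <= #|(e :&: W) :\: ctr i|.
    by rewrite leqNgt; apply: contra nT => h; apply/bigcupP; exists i => //; rewrite inE eF.
  have [Y sY cY] := exists_subset_card tr; apply/bigcupP; exists Y.
    by rewrite inE cY eqxx andbT; apply: subset_trans sY _; apply: setSD; apply: subsetIr.
  rewrite inE eE subUset Ce; apply: subset_trans sY _; apply: subset_trans (subsetDl _ _) _.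
  exact: subsetIl.
have cZ i : i \in [set: 'I_l] -> #|Z i| <= 2 ^ c2 * n ^ ((r - 1) * t).
  move=> _; apply: (@leq_trans (#|[set Y : {set V} | (Y \subset W :\: ctr i) && (#|Y| == t)]| * n ^ ((r - 1) * t))).
    apply: card_bigcup_le_const => Y; rewrite inE => /andP[sY /eqP cY].
    have -> : (r - 1) * t = k - #|ctr i :|: Y|.
      rewrite cardsU (_ : ctr i :&: Y = set0); last first.
        apply/eqP; rewrite setI_eq0 disjoint_sym; move: sY; rewrite subsetD => /andP[_] //.
      rewrite cards0 ctr_card cY (k_split) mulnBl mul1n; clear; move: (s) (q) => *; nat_lia.
    apply: leq_trans (@card_edges_through V k _ (ctr i :|: Y) setT _) _.
      by move=> e; rewrite inE => /andP[/(class_J_card EJ)-> ->]; rewrite setUT subsetT.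
    by rewrite cardsT cV bin_le_exp.
  rewrite leq_mul2r; apply/orP; right; apply: (@leq_trans (2 ^ #|W|)); last by rewrite leq_exp2l // (sl_unc sL).
  rewrite -card_powerset; apply: subset_leq_card; apply/subsetP => Y.
  rewrite !inE => /andP[sY _]; by apply: subset_trans sY (subsetDl _ _).
apply: leq_trans (subset_leq_card cover) _; apply: leq_trans (leq_card_setU _ _) _.
rewrite mulnDl; apply: leq_add.
  by apply: leq_trans leftover_card _; rewrite leq_pmulr.
apply: leq_trans (card_bigcup_le_const cZ) _; rewrite cardsT card_ord -mulnA leq_mul2r.
by rewrite (sl_size sL) orbT.
Qed.

End Assembly.

End Extremal.

Theorem theorem3p5 (r t : nat) (hr : 1 <= r) (ht : 2 <= t) :
  exists n0 c1 c2 c3 : nat,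
  forall (n m : nat) (d : Order.disp_t) (V : finOrderType d)
         (E : {set {set V}}),
    n0 <= n -> 'C(n %/ t, r * t) < m -> extremal r t n m E ->
    exists (R : {set {set V}}) (l : nat)
           (C : 'I_l -> {set V}) (F : 'I_l -> {set {set V}}),
      [/\ R \subset E, #|R| <= c1, l <= 7 * t ^ 2,
          (forall i : 'I_l, is_star (r * t ^ 2) (r * t * (t - 1)) (C i) (F i))
        & E :\: R = \bigcup_(i < l) F i] /\
      [/\ (forall i : 'I_l, i.+1 < l ->
             n <= 7 * t ^ 2 * #|core_body r t (C i) (F i)|),
          #|~: \bigcup_(i < l) core_body r t (C i) (F i)| <= c2
        & (forall i j : 'I_l, i != j -> [disjoint C i & C j])] /\
      exists (R' : {set {set V}}) (l' : nat)
             (C' : 'I_l' -> {set V}) (F' : 'I_l' -> {set {set V}}),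
        [/\ R' \subset E, #|R'| <= c3 * n ^ ((r - 1) * t), l' <= l,
            (forall i : 'I_l',
               is_star (r * t ^ 2) (r * t * (t - 1)) (C' i) (F' i))
          & E :\: R' = \bigcup_(i < l') F' i] /\
        (forall i j : 'I_l', i != j ->
           [disjoint star_vertices (C' i) (F' i)
                   & star_vertices (C' j) (F' j)]).
Proof.
have [c2 [n0 hn0]] := star_structure hr ht.
exists (n0 + 1), (2 ^ c2), c2, (2 ^ c2 + 7 * t ^ 2 * 2 ^ c2) => n m d V E nbig mbig ex.
have [cV _ EJ _] := ex.
have [L sL] := hn0 V E n m ex mbig ltac:(nat_lia).
have n_gt0 : 0 < n by nat_lia.
have cupE (F : 'I_(size L) -> {set {set V}}) : (forall i, F i \subset E) ->
    E :\: (E :\: \bigcup_(i < size L) F i) = \bigcup_(i < size L) F i.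
  by move=> FE; rewrite setDDr setDv set0U; apply/setIidPr/bigcupsP => i _; apply: FE.
have starE i : star_of E (ctr (L := L) i) \subset E by apply/subsetP => e; rewrite inE => /andP[].
have tightE i : tight t E (L := L) i \subset E.
  by apply: subset_trans (starE i); apply/subsetP => e; rewrite inE => /andP[].
exists (leftover E L), (size L), (@ctr _ V L), (fun i => star_of E (ctr i)); split; [split|split;[split|]].
- exact: subsetDl.
- exact: (leftover_card hr ht EJ sL).
- exact: sl_size sL.
- by move=> i; apply: (star_of_star EJ sL).
- exact: cupE.
- move=> i il; apply: (@leq_trans (7 * t ^ 2 * #|bod i|)).
    have lt : i < (size L).-1 by rewrite ltn_predRL.
    apply: (sl_big sL); rewrite /bod -(nth_take _ lt).
    by apply: mem_nth; rewrite size_takel ?leq_pred.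
  by rewrite leq_mul2l subset_leq_card ?orbT // (bod_core hr ht EJ sL).
- apply: leq_trans (sl_unc sL); rewrite uncovered_bod; apply: subset_leq_card; rewrite setCS.
  by apply/bigcupsP => i _; apply: subset_trans (bod_core hr ht EJ sL i) _; apply: (bigcup_sup i).
- by move=> i j; apply: (ctr_disj sL).
exists (untight t E L), (size L), (@ctr _ V L), (fun i => tight t E i); split; first split.
- exact: subsetDl.
- exact: (untight_card hr ht EJ cV sL n_gt0).
- by [].
- by move=> i; apply: (star_of_star EJ sL); apply/subsetP => e; rewrite inE => /andP[].
- exact: cupE.
- by move=> i j; apply: (tight_vertices hr ht EJ sL).
Qed.
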